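(* Let $d\ge 1$, let $\alpha,\beta$ be positive constants, and let $\{X_t,t\ge 0\}$ be the super-Brownian motion on $\mathbb{R}^d$ corresponding to the operator $\frac12\Delta u+\beta u-\alpha u^2$. For every $x\in\mathbb{R}^d$ and every continuous function $f$ on $\mathbb{R}^d$ with compact support, we have $$\lim_{t\to\infty}\frac{\langle X_t,f\rangle}{e^{\beta t}t^{-d/2}}=(2\pi)^{-d/2}\int_{\mathbb{R}^d}f(y)\,dy\cdot W(0),\qquad \mathbb{P}_{\delta_x}\text{-a.s.},$$ where $W(0)$ is the $\mathbb{P}_{\delta_x}$-almost sure limit of $e^{-\beta t}\langle X_t,1\rangle$ as $t\to\infty$.
   Context: $M_F(\mathbb{R}^d)$ is the space of finite Borel measures on $\mathbb{R}^d$ with the topology of weak convergence, and $\langle\mu,f\rangle=\langle f,\mu\rangle=\int f\,d\mu$. Let $P_t$ be the transition semigroup of standard Brownian motion on $\mathbb{R}^d$ (generator $\frac12\Delta$) and $P_t^\beta=e^{\beta t}P_t$. The super-Brownian motion on $\mathbb{R}^d$ corresponding to the operator $\frac12\Delta u+\beta u-\alpha u^2$ is the time-homogeneous càdlàg $M_F(\mathbb{R}^d)$-valued Markov process $\{X_t,t\ge0\}$, with laws $\mathbb{P}_\mu$ for $\mu\in M_F(\mathbb{R}^d)$ (under $\mathbb{P}_\mu$, $X_0=\mu$), such that for every bounded non-negative Borel function $f$, $$\mathbb{E}_\mu[e^{-\langle f,X_t\rangle}]=e^{-\langle u(t,\cdot),\mu\rangle},$$ where $\mathbb{E}_\mu$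 is expectation under $\mathbb{P}_\mu$ and $u$ is the unique solution of $$u(t,x)+\int_0^t P^\beta_{t-s}\big(\alpha\, u(s,\cdot)^2\big)(x)\,ds=P_t^\beta f(x).$$ $\delta_x$ is the unit mass at $x$. *)

(* Defs.v *)
From HB Require Import structures.
From mathcomp Require Import all_boot all_order all_algebra.
From mathcomp Require Import all_classical all_reals all_analysis.
From mathcomp Require Import measurable_realfun.

Set Implicit Arguments.
Unset Strict Implicit.
Unset Printing Implicit Defensive.

Import Order.TTheory GRing.Theory Num.Theory.
Import numFieldNormedType.Exports.

Local Open Scope classical_set_scope.
Local Open Scope ring_scope.

Definition borel_display : measure_display.
Proof. by constructor. Qed.

Section borel_matrix.
Context (R : realType) (m n : nat).

Let borel : set (set 'M[R]_(m, n)) := <<s @open 'M[R]_(m, n) >>.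

Let borel0 : borel set0. Proof. exact: sigma_algebra0. Qed.

Let borelC A : borel A -> borel (~` A). Proof. exact: sigma_algebraC. Qed.

Let borelU (F : (set 'M[R]_(m, n))^nat) :
  (forall i, borel (F i)) -> borel (\bigcup_i F i).
Proof. exact: sigma_algebra_bigcup. Qed.

HB.instance Definition _ :=
  @isMeasurable.Build borel_display 'M[R]_(m, n) borel borel0 borelC borelU.

End borel_matrix.

Section measurable_matrix.
Context {R : realType}.

Lemma open_measurable_mx m n (U : set 'M[R]_(m, n)) : open U -> measurable U.
Proof. by move=> oU; exact: sub_sigma_algebra. Qed.

Lemma measurable_mx_coord m n (i : 'I_m) (j : 'I_n) :
  measurable_fun [set: 'M[R]_(m, n)] (fun M => M i j : R).
Proof.
apply: (measurability _ (RGenOpens.measurableE R)).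
move=> _ [_ [a [b ->]] <-].
rewrite setTI; apply: open_measurable_mx.
by apply: open_comp; [move=> M _; exact: coord_continuous|exact: interval_open].
Qed.

Let rational_ball m n (p : 'M[rat]_(m, n) * nat) : set 'M[R]_(m, n) :=
  [set M | forall i j, ball (ratr (p.1 i j) : R) (p.2.+1%:R^-1) (M i j)].

Let rational_ballP m n (U : set 'M[R]_(m, n)) : open U ->
  U = \bigcup_(p in [set p | rational_ball p `<=` U]) rational_ball p.
Proof.
move=> oU; apply/seteqP; split => [M UM|M [p pU]]; last exact: pU.
have /nbhs_ballP[e /= e0 eU] : nbhs M U by exact: open_nbhs_nbhs.
have [k ke] : exists k : nat, k.+1%:R^-1 < e / 2.
  have e20 : 0 < e / 2 by rewrite divr_gt0.
  by have [k] := ltr_add_invr e20; rewrite add0r; exists k.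
have H i j : exists q : rat, ball (M i j) k.+1%:R^-1 (ratr q : R).
  have [] := @dense_rat R (ball (M i j) k.+1%:R^-1).
  - by exists (M i j); exact: ballxx.
  - exact: ball_open.
  - by move=> r [Br [q _ qr]]; exists q; rewrite qr.
pose q : 'M[rat]_(m, n) := \matrix_(i, j) projT1 (cid (H i j)).
exists (q, k) => /=; last first.
  by move=> i j; apply: ball_sym; rewrite mxE; exact: (projT2 (cid (H i j))).
move=> N /= qN; apply: eU; split => // i j.
have qM : ball (M i j) (k.+1%:R^-1) (ratr (q i j)).
  by rewrite /q mxE; exact: (projT2 (cid (H i j))).
have le_e : k.+1%:R^-1 <= e / 2 by exact: ltW.
apply: (@ball_split R R (ratr (q i j)) (M i j) (N i j) e).
  exact: le_ball qM.
exact: le_ball (qN i j).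
Qed.

Lemma measurable_fun_mx d (T : measurableType d) m n (g : T -> 'M[R]_(m, n)) :
  (forall i j, measurable_fun [set: T] (fun x => g x i j : R)) ->
  measurable_fun [set: T] g.
Proof.
move=> mg; apply: (@measurability _ _ _ _ _ _ (@open 'M[R]_(m, n))) => //.
move=> _ [U oU <-]; rewrite setTI (rational_ballP oU) preimage_bigcup.
rewrite bigcup_mkcond; apply: countable_bigcupT_measurable; first exact: countableP.
move=> p; case: ifPn => // _.
rewrite (_ : _ @^-1` _ = \bigcap_i \bigcap_j
  [set x | ball (ratr (p.1 i j) : R) (p.2.+1%:R^-1) (g x i j)]); last first.
  by apply/seteqP; split => [x gx i _ j _|x gx i j]; [exact: gx|exact: gx].
apply: fin_bigcap_measurable => // i _; apply: fin_bigcap_measurable => // j _.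
rewrite -[X in measurable X]setTI.
apply: (mg i j measurableT); apply: open_measurable; exact: ball_open.
Qed.

End measurable_matrix.

Section lebesgue_vector.
Context {R : realType}.

Definition vcons n (p : R * 'rV[R]_n) : 'rV[R]_(1 + n) :=
  row_mx (const_mx p.1 : 'rV[R]_1) p.2.

Let vuncons n (v : 'rV[R]_(1 + n)) : R * 'rV[R]_n :=
  (v 0 0, rsubmx (v : 'rV[R]_(1 + n))).

Let vconsK n : cancel (@vcons n) (@vuncons n).
Proof.
case=> x v; rewrite /vuncons /vcons row_mxKr; congr pair => /=.
transitivity (row_mx (const_mx x : 'rV[R]_1) v 0 (lshift n 0)).
  by congr (_ _ _); exact: val_inj.
by rewrite row_mxEl mxE.
Qed.

Lemma measurable_vcons n : measurable_fun [set: R * 'rV[R]_n] (@vcons n).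
Proof.
apply: measurable_fun_mx => i j; case: (@split_ordP 1 n j) => k ->.
  rewrite (_ : (fun _ => _) = fst); first exact: measurable_fst.
  by apply/funext => p; rewrite /vcons row_mxEl mxE.
rewrite (_ : (fun _ => _) = (fun v : 'rV[R]_n => v i k) \o snd).
  by apply: measurableT_comp; [exact: measurable_mx_coord|exact: measurable_snd].
by apply/funext => p; rewrite /vcons row_mxEr.
Qed.

Let measurable_vuncons n : measurable_fun [set: 'rV[R]_(1 + n)] (@vuncons n).
Proof.
apply: measurable_fun_pair; first exact: measurable_mx_coord.
apply: measurable_fun_mx => i j; under eq_fun do rewrite mxE.
exact: measurable_mx_coord.
Qed.

Section lebesgue_cons.
Variables (n : nat) (m : {sigma_finite_measure set 'rV[R]_n -> \bar R}).

Definition lebesgue_cons : set 'rV[R]_(1 + n) -> \bar R :=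
  pushforward ((@lebesgue_measure R \x m)%E : set (R * 'rV[R]_n) -> \bar R)
    (@vcons n).

Let lebesgue_cons0 : lebesgue_cons set0 = 0%E.
Proof. by rewrite /lebesgue_cons /pushforward preimage_set0 measure0. Qed.

Let lebesgue_cons_ge0 A : (0 <= lebesgue_cons A)%E.
Proof. exact: measure_ge0. Qed.

Let lebesgue_cons_sigma_additive : semi_sigma_additive lebesgue_cons.
Proof.
move=> F mF tF mUF; rewrite /lebesgue_cons /pushforward preimage_bigcup.
apply: measure_semi_sigma_additive.
- by move=> i; rewrite -[X in measurable X]setTI; exact: measurable_vcons.
- apply/trivIsetP => i j _ _ ij; rewrite -preimage_setI.
  by move/trivIsetP : tF => /(_ _ _ _ _ ij) ->//; rewrite preimage_set0.
- rewrite -preimage_bigcup -[X in measurable X]setTI.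
  exact: measurable_vcons.
Qed.

HB.instance Definition _ := isMeasure.Build _ _ _ lebesgue_cons
  lebesgue_cons0 lebesgue_cons_ge0 lebesgue_cons_sigma_additive.

Let lebesgue_cons_sigma_finite : sigma_finite setT lebesgue_cons.
Proof.
have /sigma_finiteP[F [TF ndF Foo]] := sigma_finiteT (@lebesgue_measure R).
have /sigma_finiteP[G [TG ndG Goo]] := sigma_finiteT m.
exists (fun i => @vuncons n @^-1` (F i `*` G i)).
  rewrite -preimage_bigcup; apply/seteqP; split => // v _.
  have [i _ Fi] : (\bigcup_i F i) (vuncons v).1 by rewrite -TF.
  have [j _ Gj] : (\bigcup_i G i) (vuncons v).2 by rewrite -TG.
  exists (maxn i j) => //; split.
    by move: Fi; exact/subsetPset/ndF/leq_maxl.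
  by move: Gj; exact/subsetPset/ndG/leq_maxr.
move=> i; have [mF Fioo] := Foo i; have [mG Gioo] := Goo i; split.
  rewrite -[X in measurable X]setTI; apply: measurable_vuncons => //.
  exact: measurableX.
rewrite /lebesgue_cons /pushforward -comp_preimage.
rewrite (_ : _ \o _ = id); last by apply/funext => p; exact: vconsK.
by rewrite preimage_id product_measure1E// lte_mul_pinfty// ge0_fin_numE.
Qed.

HB.instance Definition _ := Measure_isSigmaFinite.Build _ _ _ lebesgue_cons
  lebesgue_cons_sigma_finite.

End lebesgue_cons.

Fixpoint lebesgue_vec n : {sigma_finite_measure set 'rV[R]_n -> \bar R} :=
  if n is n'.+1 then lebesgue_cons (lebesgue_vec n') else dirac (0 : 'rV[R]_0).

Lemma lebesgue_vec_box n (a b : 'rV[R]_n) : (forall i, a 0 i <= b 0 i) ->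
  lebesgue_vec n [set x | forall i, a 0 i <= x 0 i <= b 0 i] =
  (\prod_(i < n) (b 0 i - a 0 i))%:E.
Proof.
elim: n a b => [|n IH] a b ab.
  by rewrite /= diracE mem_set ?big_ord0// => -[].
pose a' : 'rV[R]_n := rsubmx (a : 'rV[R]_(1 + n)).
pose b' : 'rV[R]_n := rsubmx (b : 'rV[R]_(1 + n)).
have ab' i : a' 0 i <= b' 0 i by rewrite !mxE.
rewrite /= /lebesgue_cons /pushforward.
rewrite (_ : _ @^-1` _ = `[a 0 0, b 0 0] `*`
    [set x : 'rV[R]_n | forall i, a' 0 i <= x 0 i <= b' 0 i]); last first.
  have v0 p : @vcons n p 0 0 = p.1 by exact: (congr1 fst (vconsK p)).
  have vS p i : @vcons n p 0 (rshift 1 i) = p.2 0 i by rewrite row_mxEr.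
  apply/seteqP; split => [p abp|p [p0 pS] i].
    split; first by have := abp 0; rewrite v0 /= in_itv.
    by move=> i; have := abp (rshift 1 i); rewrite vS !mxE.
  case: (@split_ordP 1 n i) => k ->.
    rewrite (_ : lshift n k = 0) ?v0; last by apply: val_inj; rewrite [k]ord1.
    by move: p0; rewrite /= in_itv.
  by rewrite vS; have := pS k; rewrite !mxE.
rewrite product_measure1E//; last first.
  rewrite (_ : mkset _ = \bigcap_i
    ((fun x : 'rV[R]_n => x 0 i : R) @^-1` `[a' 0 i, b' 0 i])); last first.
    apply/seteqP; split => x xab i; first by move=> _; rewrite /= in_itv /= xab.
    by have := xab i Logic.I; rewrite /= in_itv.
  apply: fin_bigcap_measurable => // i _; rewrite -[X in measurable X]setTI.
  exact: measurable_mx_coord.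
transitivity ((lebesgue_measure (`[a 0%R 0%R, b 0%R 0%R] : set R) *
    (\prod_(i < n) (b' 0 i - a' 0 i))%:E)%E).
  by congr (_ * _)%E; exact: IH.
rewrite lebesgue_measure_itv /= big_ord_recl.
rewrite lte_fin; have := ab 0; rewrite le_eqVlt => /predU1P[ab0|ab0].
  by rewrite ab0 ltxx subrr mul0e mul0r.
rewrite ab0 -EFinD -EFinM; congr (_ * _)%:E.
by apply: eq_bigr => i _; rewrite !mxE; congr (b _ _ - a _ _); exact: val_inj.
Qed.

End lebesgue_vector.

Section finite_measures.
Context (R : realType) (d : nat).

(** Elements are set functions defined on all subsets of [R^d], so measures that
    agree on Borel sets need not be equal as terms; they are topologically
    indistinguishable. *)
Definition finmeas : Type := {finite_measure set 'rV[R]_d -> \bar R}.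

HB.instance Definition _ := gen_eqMixin finmeas.
HB.instance Definition _ := gen_choiceMixin finmeas.
HB.instance Definition _ := isPointed.Build finmeas (mzero : finmeas).

Definition pairing (mu : finmeas) (f : 'rV[R]_d -> R) : R :=
  (\int[mu]_x f x)%R.

Definition bounded_continuous : Type :=
  {f : 'rV[R]_d -> R | continuous f /\ exists M, forall x, `|f x| <= M}.

Definition test_integrals (mu : finmeas) : {ptws bounded_continuous -> R} :=
  fun f => pairing mu (sval f).

HB.instance Definition _ :=
  Topological.copy finmeas (initial_topology test_integrals).

Let ptws_cvgP (F : set_system {ptws bounded_continuous -> R})
    (g : {ptws bounded_continuous -> R}) : Filter F ->
  F --> g <-> forall f, (fun h => h f) @ F --> g f.
Proof.
move=> FF; rewrite cvg_sup; split=> H f; have := H f; rewrite cvg_image.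
- apply: cvg_trans => W /=; rewrite ?nbhs_simpl /fmap /= => [[W' + <-]].
  by apply: filterS => h W'h /=; exists h.
- by rewrite eqEsubset; split=> // v _; exists (cst v).
- move=> + W //=; rewrite ?nbhs_simpl => Q => /Q Q'; exists (@^~ f @^-1` W) => //.
  by rewrite eqEsubset; split => [j [? + <-//]|j Wj]; exists (fun _ => j).
- by rewrite eqEsubset; split=> // v _; exists (cst v).
Qed.

Lemma cvg_finmeasP (F : set_system finmeas) (mu : finmeas) : Filter F ->
  F --> mu <-> forall f : 'rV[R]_d -> R, continuous f ->
    (exists M, forall x, `|f x| <= M) -> pairing nu f @[nu --> F] --> pairing mu f.
Proof.
move=> FF; split=> [Fmu f cf bf|H].
  pose g : bounded_continuous := exist _ f (conj cf bf).
  have : test_integrals @ F --> test_integrals mu.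
    have := @initial_continuous _ _ test_integrals mu.
    by apply: cvg_trans; exact: cvg_app Fmu.
  by move=> /ptws_cvgP/(_ g).
have tF : test_integrals @ F --> test_integrals mu.
  by apply/ptws_cvgP => -[f [cf bf]]; exact: H.
move=> A; rewrite nbhsE => -[B [[C oC <-] Cmu] CA].
by apply: filterS CA _; apply: tF; exact: open_nbhs_nbhs.
Qed.

Let borel : set (set finmeas) := <<s @open finmeas >>.

Let borel0 : borel set0. Proof. exact: sigma_algebra0. Qed.

Let borelC A : borel A -> borel (~` A). Proof. exact: sigma_algebraC. Qed.

Let borelU (F : (set finmeas)^nat) :
  (forall i, borel (F i)) -> borel (\bigcup_i F i).
Proof. exact: sigma_algebra_bigcup. Qed.

HB.instance Definition _ :=
  @isMeasurable.Build borel_display finmeas borel borel0 borelC borelU.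

End finite_measures.

Section brownian_semigroup.
Context {R : realType} {d : nat}.

Definition heat_kernel (t : R) (x : 'rV[R]_d) : R :=
  (2 * pi * t) `^ (- (d%:R / 2)) * expR (- (\sum_i x 0 i ^+ 2) / (2 * t)).

Definition brownian_semigroup (t : R) (g : 'rV[R]_d -> \bar R) (x : 'rV[R]_d) :
    \bar R :=
  if t == 0 then g x
  else (\int[lebesgue_vec d]_y ((heat_kernel t (y - x))%:E * g y))%E.

(** [P_t^beta], the transition semigroup multiplied by [e^(beta t)]. *)
Definition growing_semigroup (beta t : R) (g : 'rV[R]_d -> \bar R)
    (x : 'rV[R]_d) : \bar R :=
  ((expR (beta * t))%:E * brownian_semigroup t g x)%E.

End brownian_semigroup.

Section log_laplace.
Context {R : realType} {d : nat} (alpha beta : R).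

(** Integrals are taken in the extended reals, so the equation itself forces the
    integral term to be finite, and [u t x <= e^(beta t) sup f]. *)
Record log_laplace_solution (f : 'rV[R]_d -> R) (u : R -> 'rV[R]_d -> R) :
    Prop := {
  log_laplace_ge0 : forall t x, 0 <= t -> 0 <= u t x ;
  log_laplace_measurable :
    measurable_fun ((`[0, +oo[ `*` setT)%classic : set (R * 'rV[R]_d))
      (fun p => u p.1 p.2) ;
  log_laplace_eq : forall t x, 0 <= t ->
    ((u t x)%:E + \int[lebesgue_measure]_(s in `[0%R, t])
       growing_semigroup beta (t - s) (fun y => (alpha * u s y ^+ 2)%:E) x)%E =
    growing_semigroup beta t (EFin \o f) x }.

Definition unique_log_laplace_solution f u : Prop :=
  log_laplace_solution f u /\
  forall v, log_laplace_solution f v -> forall t x, 0 <= t -> v t x = u t x.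

End log_laplace.

Section process.
Context {R : realType} {d : nat} {disp : measure_display}
  {Omega : measurableType disp}.
Variables (X : R -> Omega -> finmeas R d) (P : finmeas R d -> probability Omega R).

(** Times are real numbers; nothing is required of [X t] for [t < 0]. *)
Definition cadlag : Prop := forall w,
  (forall t, 0 <= t -> X s w @[s --> t^'+] --> X t w) /\
  (forall t, 0 < t -> exists mu : finmeas R d, X s w @[s --> t^'-] --> mu).

Definition natural_filtration (s : R) : set (set Omega) :=
  <<s \bigcup_(r in `[0, s]) preimage_set_system setT (X r) measurable >>.

Record cadlag_markov_process : Prop := {
  process_measurable : forall t, 0 <= t -> measurable_fun [set: Omega] (X t) ;
  process_cadlag : cadlag ;
  process_start : forall mu, {ae P mu, forall w,
    forall A : set 'rV[R]_d, measurable A -> X 0 w A = mu A} ;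
  process_kernel : forall t (B : set (finmeas R d)), 0 <= t -> measurable B ->
    measurable_fun [set: finmeas R d] (fun mu => P mu (X t @^-1` B)) ;
  process_markov : forall mu s t A (B : set (finmeas R d)),
    0 <= s -> 0 <= t -> natural_filtration s A -> measurable B ->
    P mu (A `&` X (s + t) @^-1` B) =
    (\int[P mu]_(w in A) P (X s w) (X t @^-1` B))%E }.

Definition super_brownian_motion (alpha beta : R) : Prop :=
  cadlag_markov_process /\
  forall f : 'rV[R]_d -> R, measurable_fun [set: 'rV[R]_d] f ->
    (forall x, 0 <= f x) -> (exists M, forall x, f x <= M) ->
    exists2 u, unique_log_laplace_solution alpha beta f u &
      forall mu t, 0 <= t ->
        'E_(P mu)[fun w => expR (- pairing (X t w) f)]%E =
        (expR (- pairing mu (u t)))%:E.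

Definition mass_martingale (beta t : R) (w : Omega) : R :=
  expR (- (beta * t)) * pairing (X t w) (cst 1).

Definition mass_martingale_limit (beta : R) (w : Omega) : R :=
  lim (mass_martingale beta t w @[t --> +oo]).

End process.

(* Main.v *)
Require Import Defs.
From HB Require Import structures.
From mathcomp Require Import all_boot all_order all_algebra.
From mathcomp Require Import all_classical all_reals all_analysis.
From mathcomp Require Import measurable_realfun.
From mathcomp Require Import ring lra.

Set Implicit Arguments.
Unset Strict Implicit.
Unset Printing Implicit Defensive.

Import Order.TTheory GRing.Theory Num.Theory.
Import numFieldNormedType.Exports.

Local Open Scope classical_set_scope.
Local Open Scope ring_scope.

(** For bounded [f], the process [N_t = e^(-beta t) <X_t, P_(T-t) f>] is a martingale
    on [0, T], and a second-order expansion of the log-Laplace equation at [theta = 0]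
    bounds the conditional variance of its increments after time [s] by
    [O(T e^(-beta s))].  Cut the block [m^4 <= t < (m+1)^4] into subblocks of length
    [1/m] and take for [T] the right end of the subblock containing [t].  Three
    comparisons give the limit.
    - [N_t] and [N_m] differ by [o(T^(-d/2))], by a maximal inequality on dyadic
      times and Borel-Cantelli.
    - At time [m] the discounted mass is concentrated at distances much smaller than
      [sqrt (T - m)], so that [P_(T-m) f] is there close to
      [(2 pi T)^(-d/2) \int f] and [T^(d/2) N_m] is close to
      [(2 pi)^(-d/2) \int f * W(0)].
    - [|f - P_(T-t) f| <= eps * g] for a fixed Gaussian [g], and the first two
      comparisons applied to [g] bound [T^(d/2) e^(-beta t) <X_t, g>].
    Right continuity extends the bounds from dyadic times to all [t]. *)

(** * Gaussian integrals and the heat semigroup *)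

(** The fourth powers reconcile two demands on the reference time [m]. The fluctuations after time
    [m] are of order [e^(-beta m / 2)], whereas [T^(d/2)], the factor [T] in the variance and the
    number of subblocks are polynomial in [m], so that very crude bounds stay summable; in
    particular the variance estimate may use nothing about [f] but its supremum. On the other side,
    a first-moment computation places the mass at time [m] at distances of order [sqrt m], against a
    kernel of width at least of order [m^2]. The martingale attached to [T] shows [P_(T-t) f] at
    time [t], not [f]. Hence the subblocks, whose length tends to 0, and an error [f - P_r f] whose
    support is not compact. A Gaussian is the natural majorant: the semigroup maps it to an explicit
    multiple of a wider Gaussian, so [g] is in turn bounded by a constant times [P_r g], which is
    again the value of a martingale. Random variables are kept non-negative wherever possible:
    identities between moments are rearranged into sums of non-negative terms, so that no difference
    of infinite integrals can occur. *)

Section gaussian.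
Context {R : realType}.

(** Height 1 rather than mass 1: these serve as test functions with values in [0, 1], of variance
    [A] around [c]. *)
Definition gauss d (A : R) (c y : 'rV[R]_d) : R :=
  expR (- (\sum_i (y 0 i - c 0 i) ^+ 2) / (2 * A)).

Lemma gauss_ge0 d (A : R) (c y : 'rV[R]_d) : 0 <= gauss A c y.
Proof. exact: expR_ge0. Qed.

Lemma gauss_le1 d (A : R) (c y : 'rV[R]_d) : 0 < A -> gauss A c y <= 1.
Proof.
move=> A0; rewrite -expR0 ler_expR mulNr oppr_le0 divr_ge0//; last first.
  by rewrite mulr_ge0// ltW.
by apply: sumr_ge0 => i _; exact: sqr_ge0.
Qed.

Lemma measurable_gauss2 d (A : R) :
  measurable_fun [set: 'rV[R]_d * 'rV[R]_d] (fun p => gauss A p.1 p.2).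
Proof.
apply: measurableT_comp => //; apply: measurable_funM => //.
apply: measurableT_comp => //; apply: measurable_sum => i.
apply: measurable_funX; apply: measurable_funB.
- exact: (measurableT_comp (measurable_mx_coord 0 i) measurable_snd).
- exact: (measurableT_comp (measurable_mx_coord 0 i) measurable_fst).
Qed.

Lemma measurable_gauss d (A : R) (c : 'rV[R]_d) :
  measurable_fun [set: 'rV[R]_d] (gauss A c).
Proof.
exact: (measurableT_comp (@measurable_gauss2 d A) (measurable_pair1 c)).
Qed.

(** Read off from the total mass 1 of [normal_pdf] with standard deviation [sqrt A], whose peak is
    the inverse of the right-hand side. *)
Lemma integral_gauss1 (A c : R) : 0 < A ->
  (\int[lebesgue_measure]_x (expR (- (x - c) ^+ 2 / (2 * A)))%:E)%E =
  ((2 * pi * A) `^ (2^-1))%:E.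
Proof.
move=> A0; have s0 : Num.sqrt A != 0 by rewrite gt_eqF// sqrtr_gt0.
have sA : Num.sqrt A ^+ 2 = A by rewrite sqr_sqrtr// ltW.
have p0 : 0 < (2 * pi * A) `^ (2^-1) by rewrite powR_gt0// !mulr_gt0// pi_gt0.
have pk : normal_peak (Num.sqrt A) = ((2 * pi * A) `^ (2^-1))^-1.
  rewrite /normal_peak sA powR12_sqrt; last by rewrite !mulr_ge0// ?pi_ge0// ltW.
  by rewrite (_ : A * pi *+ 2 = 2 * pi * A)//; ring.
have := integral_normal_pdf c (Num.sqrt A).
under eq_integral do rewrite normal_pdfE// pk EFinM.
rewrite ge0_integralZl//; last 3 first.
- apply/measurable_EFinP; exact: measurable_normal_fun.
- by move=> x _; rewrite lee_fin normal_fun_ge0.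
- by rewrite lee_fin invr_ge0 ltW.
rewrite /normal_fun sA => H.
transitivity (((2 * pi * A) `^ 2^-1)%:E * 1)%E; last by rewrite mule1.
rewrite -H muleA -EFinM divff ?gt_eqF// mul1e.
by apply: eq_integral => x _; rewrite mulr_natl.
Qed.

Lemma vcons_head n (p : R * 'rV[R]_n) : vcons p (0 : 'I_1) (ord0 : 'I_n.+1) = p.1.
Proof.
rewrite /vcons (_ : ord0 = lshift n (0 : 'I_1)); last exact: val_inj.
by rewrite row_mxEl mxE.
Qed.

Lemma vcons_tail n (p : R * 'rV[R]_n) i : vcons p (0 : 'I_1) (lift ord0 i) = p.2 0 i.
Proof.
rewrite /vcons (_ : lift ord0 i = rshift 1 i); last exact: val_inj.
by rewrite row_mxEr.
Qed.

(** [lebesgue_cons m] is the push-forward of a product measure by [vcons]: change of variables, then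
    Tonelli. *)
Lemma integral_lebesgue_cons n (m : {sigma_finite_measure set 'rV[R]_n -> \bar R})
    (f : 'rV[R]_(1 + n) -> \bar R) :
  measurable_fun [set: 'rV[R]_(1 + n)] f -> (forall y, 0 <= f y)%E ->
  (\int[lebesgue_cons m]_y f y = \int[lebesgue_measure]_x \int[m]_v f (vcons (x, v)))%E.
Proof.
move=> mf f0.
pose mu : {measure set (measurableTypeR R * 'rV[R]_n) -> \bar R} := (@lebesgue_measure R \x m)%E.
have mv : measurable_fun [set: measurableTypeR R * 'rV[R]_n] (@vcons R n) by exact: measurable_vcons.
have f0' : {in [set: 'rV[R]_(1 + n)], forall y, 0 <= f y}%E by [].
have := (ge0_integral_pushforward mv mu measurableT mf f0').
rewrite preimage_setT => H.
transitivity (\int[mu]_x (f \o vcons (n:=n)) x)%E; first exact: H.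
rewrite fubini_tonelli1//.
- exact: measurableT_comp mf mv.
- by move=> p; exact: f0.
Qed.

(** Induction on the dimension, splitting off the first coordinate. In dimension 0 the measure is a
    Dirac mass and both sides are 1. *)
Lemma integral_gauss d (A : R) (c : 'rV[R]_d) : 0 < A ->
  (\int[lebesgue_vec d]_y (gauss A c y)%:E)%E = ((2 * pi * A) `^ (d%:R / 2))%:E.
Proof.
move=> A0; elim: d c => [|d IH] c.
  rewrite /= integral_dirac//=; last first.
    by apply/measurable_EFinP; exact: measurable_gauss.
  by rewrite diracE mem_set// mul1e mul0r powRr0 /gauss big_ord0 oppr0 mul0r expR0.
pose c' : 'rV[R]_d := rsubmx (c : 'rV[R]_(1 + d)).
have mf : measurable_fun [set: 'rV[R]_(1 + d)] (fun y => (gauss A c y)%:E).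
  by apply/measurable_EFinP; exact: (@measurable_gauss d.+1).
rewrite [LHS](integral_lebesgue_cons _ mf); last by move=> y; rewrite lee_fin gauss_ge0.
have E x v : (gauss A c (vcons (x, v)))%:E =
   ((expR (- (x - c 0 0) ^+ 2 / (2 * A)))%:E * (gauss A c' v)%:E)%E.
  have S : \sum_(i < d.+1) (vcons (x, v) 0 i - c 0 i) ^+ 2 =
      (x - c 0 0) ^+ 2 + \sum_i (v 0 i - c' 0 i) ^+ 2.
    rewrite big_ord_recl [in LHS]vcons_head; congr (_ + _).
    by apply: eq_bigr => i _; rewrite vcons_tail [c' 0 i]mxE; congr ((_ - c _ _) ^+ 2); exact: val_inj.
  by rewrite /gauss S opprD mulrDl expRD EFinM.
have m2 : measurable_fun [set: 'rV[R]_d] (fun v => (gauss A c' v)%:E).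
  by apply/measurable_EFinP; exact: measurable_gauss.
transitivity (\int[lebesgue_measure]_x
    ((expR (- (x - c 0 0) ^+ 2 / (2 * A)))%:E * ((2 * pi * A) `^ (d%:R / 2))%:E))%E.
  apply: eq_integral => x _; under eq_integral do rewrite E.
  rewrite ge0_integralZl//; first by congr (_ * _)%E; exact: IH.
  by move=> y _; rewrite lee_fin gauss_ge0.
rewrite ge0_integralZr//; last 2 first.
- apply/measurable_EFinP; apply: measurableT_comp => //.
  apply: measurable_funM => //=; apply: measurableT_comp => //=.
  by apply: measurable_funX => //=; exact: measurable_funB.
- by rewrite lee_fin powR_ge0.
rewrite integral_gauss1// -EFinM -powRD; last first.
  by rewrite implybE gt_eqF// !mulr_gt0// pi_gt0.
by rewrite -[X in X + _]mul1r -mulrDl nat1r.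
Qed.

End gaussian.

(** * The heat semigroup on bounded non-negative functions *)

Section heat.
Context {R : realType} {d : nat}.
Local Notation V := 'rV[R]_d.
Local Notation L := (lebesgue_vec d).

Lemma heat_kernelE (t : R) (x y : V) :
  heat_kernel t (y - x) = (2 * pi * t) `^ (- (d%:R / 2)) * gauss t x y.
Proof.
rewrite /heat_kernel /gauss (eq_bigr (fun i => (y 0 i - x 0 i) ^+ 2))//.
by move=> i _; rewrite mxE mxE.
Qed.

Lemma heat_kernel_ge0 (t : R) (x : V) : 0 <= heat_kernel t x.
Proof. by rewrite mulr_ge0 ?powR_ge0 ?expR_ge0. Qed.

Lemma measurable_heat_kernel2 (t : R) :
  measurable_fun [set: V * V] (fun p => heat_kernel t (p.2 - p.1)).
Proof.
under eq_fun do rewrite heat_kernelE.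
by apply: measurable_funM => //; exact: measurable_gauss2.
Qed.

Lemma measurable_heat_kernel (t : R) (x : V) :
  measurable_fun [set: V] (fun y => heat_kernel t (y - x)).
Proof.
exact: (measurableT_comp (measurable_heat_kernel2 t) (measurable_pair1 x)).
Qed.

Lemma integral_heat_kernel (t : R) (x : V) : 0 < t ->
  (\int[L]_y (heat_kernel t (y - x))%:E)%E = 1%E.
Proof.
move=> t0; under eq_integral do rewrite heat_kernelE EFinM.
rewrite ge0_integralZl//; last 3 first.
- by apply/measurable_EFinP; exact: measurable_gauss.
- by move=> y _; rewrite lee_fin gauss_ge0.
- by rewrite lee_fin powR_ge0.
rewrite integral_gauss// -EFinM powRN mulVf// gt_eqF// powR_gt0//.
by rewrite !mulr_gt0// pi_gt0.
Qed.

(** Non-negativity gives Tonelli and monotonicity without integrability conditions; the bound [M] is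
    what enters the variance estimates. *)
Definition test (M : R) (f : V -> R) :=
  measurable_fun [set: V] f /\ forall x, 0 <= f x <= M.

(** [fine] sends infinite values to 0; [heatE] shows that this does not happen for functions in
    [test] at times [t >= 0]. *)
Definition heat (t : R) (f : V -> R) (x : V) : R :=
  fine (brownian_semigroup t (EFin \o f) x).

Lemma heatE (M t : R) f x : 0 <= t -> test M f ->
  brownian_semigroup t (EFin \o f) x = (heat t f x)%:E.
Proof.
move=> t0 [mf fM]; rewrite /heat fineK//.
have [->|tn0] := eqVneq t 0; first by rewrite /brownian_semigroup eqxx.
have tp : 0 < t by rewrite lt_neqAle eq_sym tn0.
rewrite /brownian_semigroup (negbTE tn0).
rewrite ge0_fin_numE; last first.
  apply: integral_ge0 => y _; apply: mule_ge0; first by rewrite lee_fin heat_kernel_ge0.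
  by rewrite lee_fin; have /andP[] := fM y.
apply: (@le_lt_trans _ _ (\int[L]_y ((heat_kernel t (y - x))%:E * M%:E))%E).
  apply: ge0_le_integral => //.
  - move=> y _; apply: mule_ge0; first by rewrite lee_fin heat_kernel_ge0.
    by rewrite lee_fin; have /andP[] := fM y.
  - by apply: emeasurable_funM; apply/measurable_EFinP => //; exact: measurable_heat_kernel.
  - by apply: emeasurable_funM; apply/measurable_EFinP => //; exact: measurable_heat_kernel.
  - move=> y _; apply: lee_wpmul2l; first by rewrite lee_fin heat_kernel_ge0.
    by rewrite lee_fin; have /andP[] := fM y.
have M0 : 0 <= M by have /andP[a b] := fM x; exact: le_trans b.
rewrite ge0_integralZr//; last 2 first.
- by apply/measurable_EFinP; exact: measurable_heat_kernel.
- by move=> y _; rewrite lee_fin heat_kernel_ge0.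
by rewrite integral_heat_kernel// mul1e ltry.
Qed.

Lemma heat0 f x : heat 0 f x = f x.
Proof. by rewrite /heat /brownian_semigroup eqxx. Qed.

Lemma heat_integral (M t : R) f x : 0 < t -> test M f ->
  (heat t f x)%:E = (\int[L]_y (heat_kernel t (y - x) * f y)%:E)%E.
Proof.
move=> t0 tf; by rewrite -(heatE _ (ltW t0) tf) /brownian_semigroup gt_eqF.
Qed.

Lemma measurable_heat_integrand (M t : R) f x : test M f ->
  measurable_fun [set: V] (fun y => (heat_kernel t (y - x) * f y)%:E).
Proof.
move=> [mf _]; apply/measurable_EFinP; apply: measurable_funM => //.
exact: measurable_heat_kernel.
Qed.

Lemma test_ge0 M f x : test M f -> 0 <= f x.
Proof. by move=> [_ /(_ x)/andP[]]. Qed.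

Lemma test_le M f x : test M f -> f x <= M.
Proof. by move=> [_ /(_ x)/andP[]]. Qed.

Lemma test_bound_ge0 M f : test M f -> 0 <= M.
Proof. by move=> tf; exact: le_trans (test_ge0 0 tf) (test_le 0 tf). Qed.

Lemma heat_integrand_ge0 (M t : R) f x y : test M f ->
  (0 <= (heat_kernel t (y - x) * f y)%:E)%E.
Proof. by move=> tf; rewrite lee_fin mulr_ge0 ?heat_kernel_ge0// (test_ge0 _ tf). Qed.

Lemma le_heat (M N t : R) f g x : 0 <= t -> test M f -> test N g ->
  (forall y, f y <= g y) -> heat t f x <= heat t g x.
Proof.
rewrite le_eqVlt => /predU1P[<-|t0] tf tg fg; first by rewrite !heat0.
rewrite -lee_fin (heat_integral _ t0 tf) (heat_integral _ t0 tg).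
apply: ge0_le_integral => //.
- by move=> y _; exact: heat_integrand_ge0 tf.
- exact: measurable_heat_integrand tf.
- exact: measurable_heat_integrand tg.
- by move=> y _; rewrite lee_fin ler_wpM2l ?heat_kernel_ge0.
Qed.

Lemma test_cst (k : R) : 0 <= k -> test k (cst k).
Proof. by move=> k0; split=> // x; rewrite k0 lexx. Qed.

Lemma heat_cst (t k : R) x : 0 <= t -> 0 <= k -> heat t (cst k) x = k.
Proof.
rewrite le_eqVlt => /predU1P[<-|t0] k0; first by rewrite heat0.
apply: EFin_inj; rewrite (heat_integral _ t0 (test_cst k0)).
transitivity (\int[L]_y ((heat_kernel t (y - x))%:E * k%:E))%E => //.
rewrite ge0_integralZr//; last 2 first.
- by apply/measurable_EFinP; exact: measurable_heat_kernel.
- by move=> y _; rewrite lee_fin heat_kernel_ge0.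
by rewrite integral_heat_kernel// mul1e.
Qed.

(** The bounds come from comparison with the constants 0 and [M], which [heat] fixes; measurability
    is that of a Tonelli integral in its parameter. *)
Lemma test_heat (M t : R) f : 0 <= t -> test M f -> test M (heat t f).
Proof.
move=> t0 tf; have M0 := test_bound_ge0 tf; split; last first.
  move=> x; apply/andP; split.
    rewrite -(heat_cst x t0 (lexx 0)).
    by apply: (le_heat _ t0 (test_cst (lexx 0)) tf) => y; exact: test_ge0 tf.
  rewrite -[leRHS](heat_cst x t0 M0).
  by apply: (le_heat _ t0 tf (test_cst M0)) => y; exact: test_le tf.
move: t0; rewrite le_eqVlt => /predU1P[<-|t0].
  by rewrite (_ : heat 0 f = f); [case: tf|apply/funext => x; rewrite heat0].
apply/measurable_EFinP.
rewrite (_ : EFin \o _ = fun x => \int[L]_y ((heat_kernel t (y - x) * f y)%:E))%E; last first.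
  by apply/funext => x /=; rewrite (heat_integral _ t0 tf).
apply: (@measurable_fun_fubini_tonelli_F _ _ _ _ _ L
  (fun p : V * V => (heat_kernel t (p.2 - p.1) * f p.2)%:E)).
- apply/measurable_EFinP; apply: measurable_funM; first exact: measurable_heat_kernel2.
  by apply: measurableT_comp measurable_snd; case: tf.
- by move=> p; exact: heat_integrand_ge0 tf.
Qed.

Lemma testD M N f g : test M f -> test N g -> test (M + N) (fun x => f x + g x).
Proof.
move=> tf tg; split; first by apply: measurable_funD; [case: tf|case: tg].
move=> x; rewrite addr_ge0 ?(test_ge0 _ tf) ?(test_ge0 _ tg)//=.
by rewrite lerD ?(test_le _ tf) ?(test_le _ tg).
Qed.

Lemma testZ (k M : R) f : 0 <= k -> test M f -> test (k * M) (fun x => k * f x).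
Proof.
move=> k0 tf; split; first by apply: measurable_funM => //; case: tf.
by move=> x; rewrite mulr_ge0 ?(test_ge0 _ tf)//= ler_wpM2l// (test_le _ tf).
Qed.

Lemma heatD (M N t : R) f g x : 0 <= t -> test M f -> test N g ->
  heat t (fun y => f y + g y) x = heat t f x + heat t g x.
Proof.
rewrite le_eqVlt => /predU1P[<-|t0] tf tg; first by rewrite !heat0.
apply: EFin_inj; rewrite EFinD (heat_integral _ t0 tf) (heat_integral _ t0 tg).
rewrite (heat_integral _ t0 (testD tf tg)) -ge0_integralD//.
- by apply: eq_integral => y _; rewrite mulrDr EFinD.
- by move=> y _; exact: heat_integrand_ge0 tf.
- exact: measurable_heat_integrand tf.
- by move=> y _; exact: heat_integrand_ge0 tg.
- exact: measurable_heat_integrand tg.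
Qed.

Lemma heatZ (M k t : R) f x : 0 <= t -> 0 <= k -> test M f ->
  heat t (fun y => k * f y) x = k * heat t f x.
Proof.
rewrite le_eqVlt => /predU1P[<-|t0] k0 tf; first by rewrite !heat0.
apply: EFin_inj; rewrite EFinM (heat_integral _ t0 tf).
rewrite (heat_integral _ t0 (testZ k0 tf)) -ge0_integralZl//.
- by apply: eq_integral => y _; rewrite mulrCA EFinM.
- exact: measurable_heat_integrand tf.
- by move=> y _; exact: heat_integrand_ge0 tf.
Qed.

Lemma gaussE (A : R) (c y : V) :
  gauss A c y = expR (\sum_i (- (y 0 i - c 0 i) ^+ 2 / (2 * A))).
Proof. by rewrite /gauss mulNr mulr_suml -sumrN; under eq_bigr do rewrite -mulNr. Qed.

Lemma test_gauss (A : R) c : 0 < A -> test 1 (gauss A c : V -> R).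
Proof.
move=> A0; split; first exact: measurable_gauss.
by move=> x; rewrite gauss_ge0 gauss_le1.
Qed.

(* Completing the square. *)
Lemma gaussM (t A : R) (c y z : V) : 0 < t -> 0 < A ->
  gauss t y z * gauss A c z =
  gauss (A + t) c y * gauss (A * t / (A + t)) (\row_i ((A * y 0 i + t * c 0 i) / (A + t))) z.
Proof.
move=> t0 A0; rewrite !gaussE -!expRD -!big_split /=; congr expR.
apply: eq_bigr => i _; rewrite mxE.
field.
by rewrite !gt_eqF// ?addr_gt0.
Qed.

(** After completing the square, what is left to integrate is a Gaussian of variance
    [A t / (A + t)]; its integral against the normalisation of the kernel leaves the power of
    [A / (A + t)]. *)
Lemma heat_gauss (t A : R) (c y : V) : 0 <= t -> 0 < A ->
  heat t (gauss A c) y = (A / (A + t)) `^ (d%:R / 2) * gauss (A + t) c y.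
Proof.
rewrite le_eqVlt => /predU1P[<-|t0] A0.
  by rewrite heat0 addr0 divff ?gt_eqF// powR1 mul1r.
have At0 : 0 < A + t by rewrite addr_gt0.
have p0 : 0 < pi :> R by exact: pi_gt0.
apply: EFin_inj; rewrite (heat_integral _ t0 (test_gauss c A0)).
under eq_integral.
  move=> z _; rewrite heat_kernelE -mulrA gaussM// mulrA EFinM.
  over.
rewrite /= ge0_integralZl//; last 3 first.
- by apply/measurable_EFinP; exact: measurable_gauss.
- by move=> z _; rewrite lee_fin gauss_ge0.
- by rewrite lee_fin mulr_ge0 ?powR_ge0 ?gauss_ge0.
rewrite integral_gauss ?divr_gt0 ?mulr_gt0// -EFinM; congr (_%:E).
rewrite mulrAC; congr (_ * _).
rewrite (_ : 2 * pi * (A * t / (A + t)) = (2 * pi * t) * (A / (A + t))); last by ring.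
rewrite (@powRM _ (2 * pi * t)); last 2 first.
- by rewrite !mulr_ge0// ltW.
- by rewrite divr_ge0// ltW.
rewrite mulrA powRN mulVf ?mul1r//.
by rewrite gt_eqF// powR_gt0// !mulr_gt0.
Qed.

End heat.

(** * First and second moments of the process *)

Section integral_bounds.
Context d (T : measurableType d) (R : realType) (mu : {measure set T -> \bar R}).

Import HBNNSimple.

(** Stated for an arbitrary [f]: its integral is a supremum over simple functions below [f], each of
    which is at most [k] on [D]. This allows the time integral of the log-Laplace equation to be
    bounded without studying the measurability of its integrand. *)
Lemma ge0_integral_le_cst (D : set T) (f : T -> \bar R) (k : R) : measurable D -> 0 <= k ->
  (forall x, D x -> 0 <= f x <= k%:E)%E -> (\int[mu]_(x in D) f x <= k%:E * mu D)%E.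
Proof.
move=> mD k0 fk; rewrite integral_mkcond ge0_integralTE; last first.
  by apply: erestrict_ge0 => x /fk/andP[].
apply: ge_ereal_sup => _ [h /= hf <-]; rewrite -integralT_nnsfun.
rewrite -[leRHS](integral_cst mu mD) [leRHS]integral_mkcond.
apply: ge0_le_integral => //.
- by move=> x _; rewrite lee_fin.
- exact/measurable_EFinP.
- exact/(measurable_restrictT _ _).1.
- move=> x _; apply: le_trans (hf x) _; rewrite /patch; case: ifPn => // /set_mem Dx.
  by have /andP[] := fk x Dx.
Qed.

(** The form of Fatou's lemma that suits moments: the [F n] are quotients built from exponentials,
    whose integrals the log-Laplace equation controls, and [G] is the moment in the limit. *)
Lemma fatou_le (F : nat -> T -> R) (G : T -> R) (c : nat -> R) (l : R) :
  (forall n, measurable_fun setT (F n)) -> (forall n x, 0 <= F n x) ->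
  (forall x, F n x @[n --> \oo] --> G x) ->
  (forall n, \int[mu]_x (F n x)%:E <= (c n)%:E)%E -> c n @[n --> \oo] --> l ->
  (\int[mu]_x (G x)%:E <= l%:E)%E.
Proof.
move=> mF F0 FG Fc cl.
have -> : (\int[mu]_x (G x)%:E = \int[mu]_x (limn_einf (fun n => (F n x)%:E)))%E.
  apply: eq_integral => x _; apply/esym.
  have : (F n x)%:E @[n --> \oo] --> (G x)%:E by apply: cvg_EFin; [exact: nearW|exact: FG].
  by move/cvg_limn_einf_sup => [].
apply: (le_trans (fatou mu measurableT _ _)).
- by move=> n; exact/measurable_EFinP.
- by move=> n x _; rewrite lee_fin.
have cl' : (c n)%:E @[n --> \oo] --> l%:E by apply: cvg_EFin; [exact: nearW|].
rewrite limn_einf_lim -(cvg_lim _ cl')//.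
apply: lee_lim.
- exact: is_cvg_einfs.
- by apply/cvg_ex; exists l%:E.
- apply: nearW => n; apply: le_trans (Fc n); apply: ereal_inf_lbound.
  by exists n => //=.
Qed.

End integral_bounds.

(** * Elementary inequalities for the exponential *)

Section exp_bounds.
Context {R : realType}.

Lemma one_sub_expRN_le (y : R) : 1 - expR (- y) <= y.
Proof. by have := expR_ge1Dx (- y); lra. Qed.

(** Through [e^(-y) <= 1 / (1 + y) <= 1 - y + y^2]. *)
Lemma one_sub_expRN_ge (y : R) : 0 <= y -> y - y ^+ 2 <= 1 - expR (- y).
Proof.
move=> y0; have e1 := expR_ge1Dx y.
have y1 : 0 < 1 + y by rewrite ltr_wpDr.
have : expR (- y) <= (1 + y)^-1.
  by rewrite expRN lef_pV2// posrE expR_gt0.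
have : (1 + y)^-1 <= 1 - y + y ^+ 2.
  rewrite -[leLHS]mul1r ler_pdivrMr//.
  have : 0 <= y ^+ 3 by exact: exprn_ge0.
  nra.
lra.
Qed.

(* Squaring [exp(-y/2) >= 1 - y/2]. *)
Lemma expRN_second_order (y : R) : y <= 2 -> y ^+ 2 / 4 <= expR (- y) - 1 + y.
Proof.
move=> y2; have h := expR_ge1Dx (- y / 2).
have -> : expR (- y) = expR (- y / 2) ^+ 2.
  by rewrite -expRM_natl; congr expR; field.
have : (1 + - y / 2) ^+ 2 <= expR (- y / 2) ^+ 2.
  by rewrite ler_sqr ?nnegrE ?expR_ge0//; lra.
lra.
Qed.

Lemma expR_sub1_le (x : R) : expR x - 1 <= x * expR x.
Proof.
have h := expR_ge1Dx (- x).
have e0 := expR_gt0 x.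
have : (1 - x) * expR x <= 1.
  have {2}<- : expR (- x) * expR x = 1 by rewrite expRN mulVf ?gt_eqF.
  by rewrite ler_pM2r.
lra.
Qed.

End exp_bounds.

(** * Pairing of finite measures with test functions *)

Section pairing.
Context {R : realType} {d : nat}.
Local Notation V := 'rV[R]_d.
Implicit Types nu : finmeas R d.

Lemma test_integrable M (f : V -> R) nu : test M f -> nu.-integrable setT (EFin \o f).
Proof.
move=> [mf fM]; apply: measurable_bounded_integrable => //.
  by rewrite -ge0_fin_numE// fin_num_measure.
exists M; split; first exact: num_real.
move=> x Mx y _ /=; have /andP[f0 fy] := fM y; rewrite ger0_norm//.
exact: le_trans fy (ltW Mx).
Qed.

Lemma pairing_ge0 M (f : V -> R) nu : test M f -> 0 <= pairing nu f.
Proof. by move=> tf; apply: Rintegral_ge0 => x _; exact: test_ge0 tf. Qed.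

Lemma le_pairing M N (f g : V -> R) nu : test M f -> test N g ->
  (forall x, f x <= g x) -> pairing nu f <= pairing nu g.
Proof.
move=> tf tg fg; apply: le_Rintegral => //.
- exact: test_integrable tf.
- exact: test_integrable tg.
Qed.

Lemma pairingD M N (f g : V -> R) nu : test M f -> test N g ->
  pairing nu (fun x => f x + g x) = pairing nu f + pairing nu g.
Proof.
by move=> tf tg; apply: RintegralD => //; [exact: test_integrable tf|exact: test_integrable tg].
Qed.

Lemma pairingZ M k (f : V -> R) nu : test M f ->
  pairing nu (fun x => k * f x) = k * pairing nu f.
Proof. by move=> tf; apply: RintegralZl => //; exact: test_integrable tf. Qed.

Lemma pairing_cst k nu : pairing nu (cst k) = k * pairing nu (cst 1).
Proof. by rewrite -(pairingZ k nu (test_cst ler01)); apply: eq_Rintegral => x _; rewrite /= mulr1. Qed.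

Lemma pairing_dirac M (f : V -> R) x : test M f ->
  pairing (\d_x : finmeas R d) f = f x.
Proof.
move=> [mf _]; rewrite /pairing /Rintegral integral_dirac//; last exact/measurable_EFinP.
by rewrite diracT mul1e.
Qed.

(** Continuity makes [pairing _ f] continuous for the weak topology, hence Borel on
    [finmeas R d]. *)
Definition ctest (M : R) (f : V -> R) := continuous f /\ forall x, 0 <= f x <= M.

Lemma continuous_measurable_mx (f : V -> R) : continuous f -> measurable_fun setT f.
Proof.
move=> cf; apply: (measurability _ (RGenOpens.measurableE R)).
move=> _ [_ [a [b ->]] <-]; rewrite setTI; apply: open_measurable_mx.
by apply: open_comp; [move=> x _; exact: cf|exact: interval_open].
Qed.

Lemma ctest_test M f : ctest M f -> test M f.
Proof. by move=> [cf fM]; split => //; exact: continuous_measurable_mx. Qed.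

Lemma continuous_pairing M (f : V -> R) : ctest M f ->
  continuous (fun nu : finmeas R d => pairing nu f).
Proof.
move=> [cf fM] nu.
have /cvg_finmeasP : nbhs nu --> nu by [].
apply => //; exists M => x; have /andP[f0 fx] := fM x.
by rewrite ger0_norm.
Qed.

Lemma measurable_pairing M (f : V -> R) : ctest M f ->
  measurable_fun [set: finmeas R d] (fun nu => pairing nu f).
Proof.
move=> cf; apply: (measurability _ (RGenOpens.measurableE R)).
move=> _ [_ [a [b ->]] <-]; rewrite setTI; apply: sub_sigma_algebra.
by apply: open_comp; [move=> x _; exact: (continuous_pairing cf)|exact: interval_open].
Qed.

End pairing.

(** * Moments from the log-Laplace functional *)

Section moments.
Context {R : realType} {d : nat} {disp : measure_display}
  {Omega : measurableType disp}.
Variables (X : R -> Omega -> finmeas R d) (P : finmeas R d -> probability Omega R).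
Variables (alpha beta : R).
Hypotheses (alpha0 : 0 < alpha) (beta0 : 0 < beta).
Hypothesis sbm : super_brownian_motion X P alpha beta.
Local Notation V := 'rV[R]_d.
Implicit Types (nu : finmeas R d) (f : V -> R).

Lemma measurable_state t : 0 <= t -> measurable_fun setT (X t).
Proof. by case: sbm => -[+ _ _ _ _] _; apply. Qed.

Lemma measurable_pairing_state M f t : ctest M f -> 0 <= t ->
  measurable_fun setT (fun w => pairing (X t w) f).
Proof.
move=> cf t0.
exact: (measurableT_comp (measurable_pairing cf) (measurable_state t0)).
Qed.

(** Bound for the coefficient of [theta^2] in the expansion of the log-Laplace exponent of
    [theta * f], integrated against [nu]. *)
Definition var_cst (M t : R) nu : R := alpha * M ^+ 2 * t * expR (2 * beta * t) * pairing nu (cst 1).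

Lemma var_cst_ge0 M t nu : 0 <= t -> 0 <= var_cst M t nu.
Proof.
move=> t0; rewrite mulr_ge0 ?(pairing_ge0 nu (test_cst ler01))//.
by rewrite mulr_ge0 ?expR_ge0// mulr_ge0// mulr_ge0 ?sqr_ge0// ltW.
Qed.

(** Dropping the non-negative integral term gives the upper bound, hence
    [u s <= theta M e^(beta s)]. Inserted into the integral term, this bounds the integrand by
    [theta^2 alpha M^2 e^(beta (t - r) + 2 beta r)], whose exponent is at most [2 beta t], over an
    interval of length [t]. *)
Lemma log_laplace_bounds M f u t x theta : test M f -> 0 <= t -> 0 < theta ->
  log_laplace_solution alpha beta (fun y => theta * f y) u ->
  test (expR (beta * t) * (theta * M)) (u t) /\
  theta * (expR (beta * t) * heat t f x) -
    theta ^+ 2 * (alpha * M ^+ 2 * t * expR (2 * beta * t)) <= u t x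
    <= theta * (expR (beta * t) * heat t f x).
Proof.
move=> tf t0 th0 [u0 mu ueq].
have M0 := test_bound_ge0 tf.
have tth : test (theta * M) (fun y => theta * f y) by exact: (testZ (ltW th0) tf).
have int0 s y : 0 <= s -> (0 <= \int[lebesgue_measure]_(r in `[0%R, s])
       growing_semigroup beta (s - r) (fun z => (alpha * u r z ^+ 2)%:E) y)%E.
  move=> s0; apply: integral_ge0 => r /=; rewrite in_itv/= => /andP[r0 rs].
  rewrite /growing_semigroup mule_ge0 ?lee_fin ?expR_ge0//.
  rewrite /brownian_semigroup; case: ifP => _.
    by rewrite lee_fin mulr_ge0 ?sqr_ge0// ltW.
  apply: integral_ge0 => z _; apply: mule_ge0; first by rewrite lee_fin heat_kernel_ge0.
  by rewrite lee_fin mulr_ge0 ?sqr_ge0// ltW.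
have grow s y : 0 <= s -> growing_semigroup beta s (EFin \o (fun y => theta * f y)) y =
    (theta * (expR (beta * s) * heat s f y))%:E.
  move=> s0; rewrite /growing_semigroup (heatE _ s0 tth) -EFinM (heatZ _ s0 (ltW th0) tf).
  by congr (_%:E); ring.
have ub s y : 0 <= s -> u s y <= theta * (expR (beta * s) * heat s f y).
  move=> s0; rewrite -lee_fin -grow// -(ueq s y s0) leeDl//; exact: int0.
have tu s : 0 <= s -> test (expR (beta * s) * (theta * M)) (u s).
  move=> s0; split.
    have -> : u s = (fun p => u p.1 p.2) \o (fun y : V => (s, y)) by [].
    apply: (measurable_comp _ _ mu) => //.
    - by apply: measurableX.
    - by move=> _ [y _ <-] /=; split => //=; rewrite in_itv/= s0.
  - exact: measurable_pair1.
  move=> y; rewrite (u0 s y s0)/=; apply: le_trans (ub s y s0) _.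
  rewrite mulrCA ler_wpM2l ?expR_ge0// ler_wpM2l ?(ltW th0)//.
  by rewrite (test_le _ (test_heat s0 tf)).
split; first exact: tu.
rewrite ub// andbT.
set K := alpha * M ^+ 2 * t * expR (2 * beta * t).
have : (\int[lebesgue_measure]_(r in `[0%R, t])
       growing_semigroup beta (t - r) (fun z => (alpha * u r z ^+ 2)%:E) x <= (theta ^+ 2 * K)%:E)%E.
  have -> : theta ^+ 2 * K = (theta ^+ 2 * (alpha * M ^+ 2 * expR (2 * beta * t))) * t.
    by rewrite /K; ring.
  have : (lebesgue_measure (`[0%R, t] : set R) = t%:E)%E.
    rewrite lebesgue_measure_itv/= lte_fin; case: ltgtP t0 => // [_ _|<- _//].
    by rewrite oppr0 adde0.
  rewrite EFinM => <-; apply: ge0_integral_le_cst => //.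
    by rewrite !mulr_ge0 ?sqr_ge0 ?expR_ge0// ltW.
  move=> r /=; rewrite in_itv/= => /andP[r0 rt].
  have tr0 : 0 <= t - r by rewrite subr_ge0.
  set B := expR (beta * r) * (theta * M).
  have B0 : 0 <= B by rewrite !mulr_ge0 ?expR_ge0 ?(ltW th0).
  have tur : test (alpha * B ^+ 2) (fun z => alpha * u r z ^+ 2).
    apply: testZ; first exact: ltW.
    split; first by apply: measurable_funX; case: (tu r r0).
    move=> y; rewrite sqr_ge0 ler_sqr ?nnegrE ?u0// ?(test_le _ (tu r r0))//.
  rewrite /growing_semigroup (heatE _ tr0 tur) -EFinM !lee_fin.
  rewrite mulr_ge0 ?expR_ge0 ?(test_ge0 _ (test_heat tr0 tur))//=.
  apply: (@le_trans _ _ (expR (beta * (t - r)) * (alpha * B ^+ 2))).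
    by rewrite ler_wpM2l ?expR_ge0// (test_le _ (test_heat tr0 tur)).
  rewrite /B exprMn exprMn (_ : expR _ * _ = (theta ^+ 2 * (alpha * M ^+ 2)) * (expR (beta * (t - r)) * expR (beta * r) ^+ 2)); last by ring.
  rewrite [leRHS](_ : _ = (theta ^+ 2 * (alpha * M ^+ 2)) * expR (2 * beta * t)); last by ring.
  rewrite ler_wpM2l//.
    by rewrite mulr_ge0 ?sqr_ge0// mulr_ge0 ?sqr_ge0// ltW.
  rewrite expr2 -!expRD ler_expR.
  by have : 0 <= beta * (t - r); [rewrite mulr_ge0// ltW|lra].
by move=> h; rewrite lerBlDr -lee_fin EFinD -grow// -(ueq t x t0) leeD2l.
Qed.

(** The witness is [U = <nu, u(t)>], and the pointwise bounds are integrated against [nu]. Two-sided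
    bounds to second order in [theta] are all that the moments require; the Laplace functional is
    never differentiated. *)
Lemma laplace_bounds M f nu t theta : ctest M f -> 0 <= t -> 0 < theta ->
  exists U, (\int[P nu]_w (expR (- (theta * pairing (X t w) f)))%:E = (expR (- U))%:E)%E /\ 0 <= U /\
    theta * (expR (beta * t) * pairing nu (heat t f)) - theta ^+ 2 * var_cst M t nu <= U
    <= theta * (expR (beta * t) * pairing nu (heat t f)).
Proof.
move=> cf t0 th0; have tf := ctest_test cf.
have tth : test (theta * M) (fun y => theta * f y) by exact: (testZ (ltW th0) tf).
case: sbm => _ /(_ (fun y => theta * f y)).
case => [|x|| u [su _] E].
- by case: tth.
- exact: test_ge0 tth.
- by exists (theta * M) => x; exact: test_le tth.
exists (pairing nu (u t)); split.
  rewrite -(E nu t t0) unlock; apply: eq_integral => w _.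
  by rewrite (pairingZ _ _ tf).
have tu : test (expR (beta * t) * (theta * M)) (u t).
  by case: (log_laplace_bounds 0 tf t0 th0 su).
have b x := (log_laplace_bounds x tf t0 th0 su).2.
set k := alpha * M ^+ 2 * t * expR (2 * beta * t) in b.
have k0 : 0 <= k.
  by rewrite /k mulr_ge0 ?expR_ge0// mulr_ge0// mulr_ge0 ?sqr_ge0// ltW.
have th := test_heat t0 tf.
have te : test (theta * expR (beta * t) * M) (fun x => theta * expR (beta * t) * heat t f x).
  by apply: testZ th; rewrite mulr_ge0 ?expR_ge0// ltW.
have E1 : theta * (expR (beta * t) * pairing nu (heat t f)) =
    pairing nu (fun x => theta * expR (beta * t) * heat t f x).
  by rewrite (pairingZ _ _ th) mulrA.
split; first exact: pairing_ge0 tu.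
rewrite E1; apply/andP; split; last first.
  by apply: (le_pairing nu tu te) => x; rewrite -mulrA; case/andP: (b x).
have -> : theta ^+ 2 * var_cst M t nu = pairing nu (cst (theta ^+ 2 * k)).
  by rewrite [RHS]pairing_cst /var_cst -/k mulrA.
have tk : test (theta ^+ 2 * k) (cst (theta ^+ 2 * k) : V -> R).
  by apply: test_cst; rewrite mulr_ge0// sqr_ge0.
rewrite lerBlDr -(pairingD _ tu tk).
apply: (le_pairing nu te (testD tu tk)) => x /=.
by rewrite -lerBlDr -mulrA; case/andP: (b x).
Qed.

Lemma cvg_invS : (n.+1%:R^-1 : R) @[n --> \oo] --> 0.
Proof. by have := @cvg_harmonic R. Qed.

(** With [Z = <X_t, f>], the quotients [(1 - e^(-theta Z)) / theta] increase to [Z] as [theta]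
    decreases to 0. Their means are at most [m], so Fatou bounds the mean of [Z] by [m]; being at
    most [Z], they also give the reverse inequality once their means are seen to tend to [m]. *)
Lemma first_moment M f nu t : ctest M f -> 0 <= t ->
  (\int[P nu]_w (pairing (X t w) f)%:E = (expR (beta * t) * pairing nu (heat t f))%:E)%E.
Proof.
move=> cf t0; have tf := ctest_test cf.
set m := expR (beta * t) * _.
have m0 : 0 <= m by rewrite mulr_ge0 ?expR_ge0// (pairing_ge0 _ (test_heat t0 tf)).
have Z0 w : 0 <= pairing (X t w) f by exact: pairing_ge0 tf.
have mZ := measurable_pairing_state cf t0.
have b0 := var_cst_ge0 M nu t0.
set b := var_cst M t nu in b0.
have mE theta : measurable_fun setT (fun w => expR (- (theta * pairing (X t w) f))).
  apply: measurableT_comp => //; apply: measurableT_comp => //.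
  exact: measurable_funM.
have Eth theta : 0 < theta -> exists2 U,
    (\int[P nu]_w (1 - expR (- (theta * pairing (X t w) f)))%:E = (1 - expR (- U))%:E)%E &
    0 <= U /\ theta * m - theta ^+ 2 * b <= U <= theta * m.
  move=> th0; have [U [EU bU]] := laplace_bounds nu cf t0 th0.
  exists U => //; under eq_integral do rewrite EFinB.
  rewrite integralB//=; last 2 first.
  - exact: finite_measure_integrable_cst.
  - apply: measurable_bounded_integrable => //.
      by rewrite -ge0_fin_numE// fin_num_measure.
    exists 1; split; first exact: num_real.
    move=> x x1 w _ /=; rewrite ger0_norm ?expR_ge0//; apply: le_trans (ltW x1).
    by rewrite -expR0 ler_expR oppr_le0 mulr_ge0// ltW.
  have I1 : (\int[P nu]__ 1 = 1)%E by rewrite integral_cst//= mul1e; exact: probability_setT.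
  by rewrite EU I1.
have le_m : (\int[P nu]_w (pairing (X t w) f)%:E <= m%:E)%E.
  apply: (@fatou_le _ _ _ (P nu) (fun n w => n.+1%:R * (1 - expR (- (n.+1%:R^-1 * pairing (X t w) f))))
    _ (fun=> m)) => //; last exact: cvg_cst.
  - move=> n; apply: measurable_funM => //; exact: measurable_funB.
  - move=> n w; rewrite mulr_ge0// subr_ge0 -expR0 ler_expR oppr_le0 mulr_ge0//.
  - move=> w; apply: (@squeeze_cvgr _ _ _ _ (fun n => pairing (X t w) f - n.+1%:R^-1 * pairing (X t w) f ^+ 2) (fun=> pairing (X t w) f)).
    + apply: nearW => n; set z := pairing _ _; have n0 : 0 < n.+1%:R :> R by [].
      have y0 : 0 <= n.+1%:R^-1 * z by rewrite mulr_ge0 ?invr_ge0// /z.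
      rewrite -(ler_pM2l (_ : 0 < n.+1%:R^-1)) ?invr_gt0// mulKf ?gt_eqF//.
      rewrite -[X in _ && X](ler_pM2l (_ : 0 < n.+1%:R^-1)) ?invr_gt0// mulKf ?gt_eqF//.
      rewrite one_sub_expRN_le andbT.
      by apply: le_trans (one_sub_expRN_ge y0); rewrite mulrBr exprMn expr2 mulrA.
    + rewrite -[X in _ --> X]subr0; apply: cvgB; first exact: cvg_cst.
      rewrite -[X in _ --> X](mul0r (pairing (X t w) f ^+ 2)).
      by apply: cvgM; [exact: cvg_invS|exact: cvg_cst].
    + exact: cvg_cst.
  - move=> n; under eq_integral do rewrite EFinM.
    rewrite ge0_integralZl//; last 2 first.
    + by apply/measurable_EFinP; exact: measurable_funB.
    + by move=> w _; rewrite lee_fin subr_ge0 -expR0 ler_expR oppr_le0 mulr_ge0.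
    have [//|U -> [_ /andP[_ Um]]] := Eth n.+1%:R^-1.
    rewrite -EFinM lee_fin -(ler_pM2l (_ : 0 < n.+1%:R^-1)) ?invr_gt0// mulKf ?gt_eqF//.
    exact: le_trans (one_sub_expRN_le _) Um.
apply/eqP; rewrite eq_le le_m/=.
(* Of the two losses, [b] comes from the expansion of [U], and [m^2] from [1 - e^(-U) >= U - U^2]
   with [U <= th m]. *)
have H n : ((m - n.+1%:R^-1 * (b + m ^+ 2))%:E <= \int[P nu]_w (pairing (X t w) f)%:E)%E.
  set th : R := n.+1%:R^-1; have th0 : 0 < th by rewrite invr_gt0.
  have [U EU [U0 /andP[Ul Uu]]] := Eth th th0.
  apply: (@le_trans _ _ (\int[P nu]_w (n.+1%:R * (1 - expR (- (th * pairing (X t w) f))))%:E)%E); last first.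
    apply: ge0_le_integral => //.
    - by move=> w _; rewrite lee_fin mulr_ge0// subr_ge0 -expR0 ler_expR oppr_le0 mulr_ge0// ltW.
    - by apply/measurable_EFinP; apply: measurable_funM => //; exact: measurable_funB.
    - exact/measurable_EFinP.
    - move=> w _; rewrite lee_fin -(ler_pM2l th0) mulKf ?gt_eqF//; exact: one_sub_expRN_le.
  under eq_integral do rewrite EFinM.
  rewrite ge0_integralZl//; last 2 first.
  - by apply/measurable_EFinP; exact: measurable_funB.
  - by move=> w _; rewrite lee_fin subr_ge0 -expR0 ler_expR oppr_le0 mulr_ge0// ltW.
  rewrite EU -EFinM lee_fin -(ler_pM2l th0) mulKf ?gt_eqF//.
  apply: le_trans (one_sub_expRN_ge U0).
  have : U ^+ 2 <= (th * m) ^+ 2 by rewrite ler_sqr ?nnegrE// mulr_ge0// ltW.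
  rewrite exprMn; nra.
have fin : (\int[P nu]_w (pairing (X t w) f)%:E \is a fin_num)%E.
  rewrite ge0_fin_numE; last by apply: integral_ge0 => w _; rewrite lee_fin.
  exact: le_lt_trans le_m (ltry _).
rewrite -(fineK fin) lee_fin.
apply: (@ler_cvg_to nat \oo _ R (fun n => m - n.+1%:R^-1 * (b + m ^+ 2)) (fun=> fine (\int[P nu]_w (pairing (X t w) f)%:E)%E)).
- rewrite -[X in _ --> X]subr0; apply: cvgB; first exact: cvg_cst.
  rewrite -[X in _ --> X](mul0r (b + m ^+ 2)).
  by apply: cvgM; [exact: cvg_invS|exact: cvg_cst].
- exact: cvg_cst.
- by apply: nearW => n; rewrite -lee_fin (fineK fin).
Qed.

(** Let [Y = Z - m] be the centred pairing and [phi = e^(-theta Y) - 1 + theta Y >= 0]. The mean of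
    [phi] is at most [e^(theta^2 b) - 1], while [phi >= theta^2 Y^2 / 4] where [theta Y <= 2],
    whence the factor 4. Letting [theta] tend to 0 with Fatou also proves that the second moment is
    finite. *)
Lemma second_moment M f nu t : ctest M f -> 0 <= t ->
  (\int[P nu]_w ((pairing (X t w) f - expR (beta * t) * pairing nu (heat t f)) ^+ 2)%:E
    <= (4 * var_cst M t nu)%:E)%E.
Proof.
move=> cf t0; have tf := ctest_test cf.
have fm := first_moment nu cf t0.
set m := expR (beta * t) * pairing nu (heat t f) in fm *.
have m0 : 0 <= m by rewrite mulr_ge0 ?expR_ge0// (pairing_ge0 _ (test_heat t0 tf)).
have Z0 w : 0 <= pairing (X t w) f by exact: pairing_ge0 tf.
have mZ := measurable_pairing_state cf t0.
have b0 := var_cst_ge0 M nu t0.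
set b := var_cst M t nu in b0 *.
have mY : measurable_fun setT (fun w => pairing (X t w) f - m) by exact: measurable_funB.
have mphi th : measurable_fun setT (fun w => expR (- (th * (pairing (X t w) f - m)))).
  by apply: measurableT_comp => //; apply: measurableT_comp => //; exact: measurable_funM.
pose phi th w := expR (- (th * (pairing (X t w) f - m))) - 1 + th * (pairing (X t w) f - m).
have phi0 th w : 0 <= phi th w.
  by rewrite /phi; have := expR_ge1Dx (- (th * (pairing (X t w) f - m))); lra.
have mphi' th : measurable_fun setT (phi th).
  by apply: measurable_funD; [exact: measurable_funB|exact: measurable_funM].
have Ephi th : 0 < th -> (\int[P nu]_w (phi th w)%:E <= (expR (th ^+ 2 * b) - 1)%:E)%E.
  move=> th0; have [U [EU [U0 /andP[Ul Uu]]]] := laplace_bounds nu cf t0 th0.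
  (* The constant [1 + th * m] is added so that both sides consist of integrals of non-negative
     functions. *)
  have E : (\int[P nu]_w (phi th w)%:E + (1 + th * m)%:E = (expR (th * m) * expR (- U) + th * m)%:E)%E.
    have -> : ((1 + th * m)%:E = \int[P nu]_w (1 + th * m)%:E)%E.
      by rewrite integral_cst//= -[LHS]mule1; congr (_ * _)%E; exact/esym/probability_setT.
    rewrite -ge0_integralD//; last 3 first.
    - by move=> w _; rewrite lee_fin.
    - exact/measurable_EFinP.
    - by move=> w _; rewrite lee_fin addr_ge0// mulr_ge0// ltW.
    transitivity (\int[P nu]_w ((expR (th * m))%:E * (expR (- (th * pairing (X t w) f)))%:E +
        th%:E * (pairing (X t w) f)%:E))%E.
      apply: eq_integral => w _; rewrite -!EFinM -!EFinD; congr (_%:E).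
      by rewrite /phi mulrBr opprB expRD; ring.
    rewrite ge0_integralD//; last 3 first.
    - by apply/measurable_EFinP; apply: measurable_funM => //; apply: measurableT_comp => //; apply: measurableT_comp => //; exact: measurable_funM.
    - by move=> w _; rewrite -EFinM lee_fin mulr_ge0// ltW.
    - by apply/measurable_EFinP; exact: measurable_funM.
    rewrite ge0_integralZl//; last first.
      by apply/measurable_EFinP; apply: measurableT_comp => //; apply: measurableT_comp => //; exact: measurable_funM.
    rewrite ge0_integralZl//; last 3 first.
    - exact/measurable_EFinP.
    - by move=> w _; rewrite lee_fin.
    - by rewrite lee_fin ltW.
    by rewrite EU fm -!EFinM -EFinD.
  rewrite -(leeD2rE _ _ (_ : (1 + th * m)%:E \is a fin_num))// E -EFinD lee_fin -expRD.
  suff : expR (th * m - U) <= expR (th ^+ 2 * b) by lra.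
  by rewrite ler_expR; move: Ul; rewrite -/m -/b; lra.
(* One-sided truncation: [phi] grows only linearly as [Y] tends to plus infinity. At each point
   [F n] is the full square for large [n]. *)
pose F n w := if n.+1%:R^-1 * (pairing (X t w) f - m) <= 2 then (pairing (X t w) f - m) ^+ 2 else 0.
have -> : (\int[P nu]_w ((pairing (X t w) f - m) ^+ 2)%:E = 4%:E * \int[P nu]_w ((pairing (X t w) f - m) ^+ 2 / 4)%:E)%E.
  rewrite -ge0_integralZl//.
  - by apply: eq_integral => w _; rewrite -EFinM; congr (_%:E); field.
  - by apply/measurable_EFinP; apply: measurable_funM => //; exact: measurable_funX.
  - by move=> w _; rewrite lee_fin divr_ge0// sqr_ge0.
rewrite EFinM lee_pmul2l//.
have mF n : measurable_fun setT (F n).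
  apply: measurable_fun_ifT => //; last exact: measurable_funX.
  apply: (measurable_fun_ler) => //; exact: measurable_funM.
apply: (@fatou_le _ _ _ (P nu) (fun n w => F n w / 4) _ (fun n => b * expR (n.+1%:R^-1 ^+ 2 * b))).
- by move=> n; exact: measurable_funM.
- by move=> n w; rewrite divr_ge0// /F; case: ifP => // _; exact: sqr_ge0.
- move=> w; apply: cvgM; last exact: cvg_cst.
  have : n.+1%:R^-1 * (pairing (X t w) f - m) @[n --> \oo] --> 0.
    rewrite -[X in _ --> X](mul0r (pairing (X t w) f - m)).
    by apply: cvgM; [exact: cvg_invS|exact: cvg_cst].
  move=> /cvgr_le /(_ 2 ltac:(done)) H.
  apply: cvg_near_cst; near=> n; rewrite /F ifT//.
  by near: n.
- move=> n; set th : R := n.+1%:R^-1; have th0 : 0 < th by rewrite invr_gt0.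
  apply: (@le_trans _ _ (\int[P nu]_w ((th ^+ 2)^-1%:E * (phi th w)%:E))%E).
    apply: ge0_le_integral => //.
    - by move=> w _; rewrite lee_fin divr_ge0// /F; case: ifP => // _; exact: sqr_ge0.
    - by apply/measurable_EFinP; exact: measurable_funM.
    - by apply/measurable_EFinP; exact: measurable_funM.
    - move=> w _; rewrite -EFinM lee_fin /F; case: ifPn => [h|_]; last first.
        by rewrite mul0r mulr_ge0// invr_ge0 sqr_ge0.
      rewrite [leRHS]mulrC ler_pdivlMr ?exprn_gt0//.
      have := expRN_second_order h; rewrite exprMn -/th /phi; lra.
  rewrite ge0_integralZl//; last 3 first.
  + exact/measurable_EFinP.
  + by move=> w _; rewrite lee_fin.
  + by rewrite lee_fin invr_ge0 sqr_ge0.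
  apply: (@le_trans _ _ ((th ^+ 2)^-1%:E * (expR (th ^+ 2 * b) - 1)%:E)%E).
    by apply: lee_wpmul2l (Ephi th th0); rewrite lee_fin invr_ge0 sqr_ge0.
  rewrite -EFinM lee_fin mulrC ler_pdivrMr ?exprn_gt0//.
  by apply: le_trans (expR_sub1_le _) _; lra.
- rewrite -[X in _ --> X]mulr1; apply: cvgM; first exact: cvg_cst.
  have : n.+1%:R^-1 ^+ 2 * b @[n --> \oo] --> 0.
    rewrite -[X in _ --> X](mul0r b); apply: cvgM; last exact: cvg_cst.
    rewrite -[X in _ --> X](mulr0 0); under eq_fun do rewrite expr2.
    by apply: cvgM; exact: cvg_invS.
  move=> h; suff : expR (n.+1%:R^-1 ^+ 2 * b) @[n --> \oo] --> expR (0 : R) by rewrite expR0.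
  by apply: continuous_cvg h; exact: continuous_expR.
Unshelve. all: by end_near. Qed.

End moments.

(** * Integral form of the Markov property *)

Section monotone_class.
Local Open Scope ereal_scope.
Context d d' (T : measurableType d) (S : measurableType d') (R : realType).
Variables (mu : {measure set T -> \bar R}) (V : T -> S).
Hypothesis mV : measurable_fun setT V.

Import HBNNSimple.

Section disintegration.
Variables (A : set T) (mA : measurable A) (k : T -> {measure set S -> \bar R}).
Hypothesis mk : forall B, measurable B -> measurable_fun setT (fun w => k w B).
Hypothesis muk : forall B, measurable B -> mu (A `&` V @^-1` B) = \int[mu]_(w in A) k w B.

Let eq_integral_nnsfun (f : {nnsfun S >-> R}) :
  \int[mu]_(w in A) (f (V w))%:E = \int[mu]_(w in A) \int[k w]_z (f z)%:E.
Proof.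
transitivity (\sum_(r \in range f) r%:E * mu (A `&` V @^-1` (f @^-1` [set r]))).
  under eq_integral do rewrite fimfunE -fsumEFin//.
  rewrite ge0_integral_fsum//; last 2 first.
  - move=> r; apply/measurable_EFinP; apply: measurable_funM => //.
    by apply: measurable_funTS; apply: measurableT_comp => //; exact: measurableT_comp.
  - by move=> r z _; rewrite EFinM nnfun_muleindic_ge0.
  apply: eq_fsbigr => r /[!inE] -[z _ <-].
  under eq_integral do rewrite EFinM.
  rewrite ge0_integralZl//; last 2 first.
  - apply/measurable_EFinP; apply: measurable_funTS; apply: measurableT_comp => //.
  - by rewrite lee_fin.
  congr (_ * _).
  have mE : measurable (V @^-1` (f @^-1` [set f z])).
    by rewrite -[X in measurable X]setTI; apply: mV.
  rewrite -[LHS](_ : \int[mu]_(w in A) (\1_(V @^-1` (f @^-1` [set f z])) w)%:E = _)//.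
  by rewrite integral_indic// setIC.
transitivity (\int[mu]_(w in A) \sum_(r \in range f) r%:E * k w (f @^-1` [set r])).
  rewrite ge0_integral_fsum//; last 2 first.
  - by move=> r; apply: measurable_funeM; apply: measurable_funTS; exact: mk.
  - by move=> r w _; exact: nnsfun_mulemu_ge0.
  apply: eq_fsbigr => r /[!inE] -[z _ <-].
  rewrite muk// ge0_integralZl//.
  - by apply: measurable_funTS; exact: mk.
  - by rewrite lee_fin.
by apply: eq_integral => w _; rewrite integralT_nnsfun sintegralE.
Qed.

(** The assumption on sets extends to simple functions by linearity, then to [G] by monotone
    convergence, both under [mu] and under each [k w]. *)
Lemma integral_disintegration (G : S -> \bar R) : measurable_fun setT G -> (forall x, 0 <= G x) ->
  \int[mu]_(w in A) G (V w) = \int[mu]_(w in A) \int[k w]_z G z.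
Proof.
move=> mG G0; pose g := nnsfun_approx measurableT mG.
have gG x : (g n x)%:E @[n --> \oo] --> G x by exact: cvg_nnsfun_approx.
have ndg x : nondecreasing_seq (fun n => (g n x)%:E).
  by move=> m n mn; rewrite lee_fin; exact/lefP/nd_nnsfun_approx.
transitivity (limn (fun n => \int[mu]_(w in A) (g n (V w))%:E)).
  rewrite -monotone_convergence//.
  - by apply: eq_integral => w _; apply/esym/cvg_lim => //; exact: gG.
  - by move=> n; apply/measurable_EFinP; apply: measurable_funTS; exact: measurableT_comp.
  - by move=> n w _; rewrite lee_fin.
have mi n : measurable_fun setT (fun w => \int[k w]_z (g n z)%:E).
  apply: measurable_fun_integral_kernel => //.
  - by move=> z; rewrite lee_fin.
  - exact/measurable_EFinP.
have indg w : nondecreasing_seq (fun n => \int[k w]_z (g n z)%:E).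
  move=> m n mn; apply: ge0_le_integral => //.
  - by move=> x _; rewrite lee_fin.
  - exact/measurable_EFinP.
  - exact/measurable_EFinP.
  - by move=> x _; exact: ndg.
under eq_fun do rewrite eq_integral_nnsfun.
rewrite -monotone_convergence//; last 2 first.
- by move=> n; apply: measurable_funTS; exact: mi.
- by move=> n w _; apply: integral_ge0 => z _; rewrite lee_fin.
apply: eq_integral => w _; rewrite -monotone_convergence//.
- by apply: eq_integral => z _; apply/cvg_lim => //; exact: gG.
- by move=> n; exact/measurable_EFinP.
- by move=> n z _; rewrite lee_fin.
Qed.

End disintegration.

Section density.
Variables (Z Y : T -> R).
Hypotheses (mZ : measurable_fun setT Z) (Z0 : forall w, (0 <= Z w)%R).
Hypotheses (mY : measurable_fun setT Y) (Y0 : forall w, (0 <= Y w)%R).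
Hypothesis ZY : forall B, measurable B ->
  \int[mu]_(w in V @^-1` B) (Z w)%:E = \int[mu]_(w in V @^-1` B) (Y w)%:E.

Let integral_nnsfun_density (W : T -> \bar R) (f : {nnsfun S >-> R}) :
  measurable_fun setT W -> (forall w, 0 <= W w) ->
  \int[mu]_w ((f (V w))%:E * W w) =
  \sum_(r \in range f) r%:E * \int[mu]_(w in V @^-1` (f @^-1` [set r])) W w.
Proof.
move=> mW W0.
transitivity (\int[mu]_w \sum_(r \in range f) (r * \1_(f @^-1` [set r]) (V w))%:E * W w).
  apply: eq_integral => w _.
  rewrite -ge0_mule_fsuml => [|r]; last exact: nnfun_muleindic_ge0.
  by rewrite fsumEFin// -(fimfunE _ (V w)).
have mi r : measurable_fun setT (fun w => (\1_(f @^-1` [set r]) (V w))%:E : \bar R).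
  by apply/measurable_EFinP; apply: measurableT_comp.
rewrite ge0_integral_fsum//; last 2 first.
- move=> r; apply: emeasurable_funM => //; apply/measurable_EFinP.
  by apply: measurable_funM => //; apply/measurable_EFinP; exact: mi.
- by move=> r w _; rewrite mule_ge0// nnfun_muleindic_ge0.
apply: eq_fsbigr => r /[!inE] -[z _ <-].
under eq_integral do rewrite EFinM -muleA.
rewrite ge0_integralZl//.
- congr (_ * _); rewrite [RHS]integral_mkcond; apply: eq_integral => w _.
  by rewrite epatch_indic muleC.
- exact: emeasurable_funM.
- by move=> w _; rewrite mule_ge0// lee_fin.
- by rewrite lee_fin.
Qed.

(** [ZY] says that [Z] and [Y] have the same conditional expectation given [V]; the conclusion
    multiplies both by a function of [V]. It stands in for taking a known factor out of a
    conditional expectation. *)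
Lemma eq_integral_density (F : S -> \bar R) : measurable_fun setT F -> (forall x, 0 <= F x) ->
  \int[mu]_w (F (V w) * (Z w)%:E) = \int[mu]_w (F (V w) * (Y w)%:E).
Proof.
move=> mF F0; pose g := nnsfun_approx measurableT mF.
suff H (W : T -> R) : measurable_fun setT W -> (forall w, (0 <= W w)%R) ->
    \int[mu]_w (F (V w) * (W w)%:E) = limn (fun n => \int[mu]_w ((g n (V w))%:E * (W w)%:E)).
  rewrite !H//; apply: congr_lim; apply/funext => n.
  rewrite !integral_nnsfun_density//; try exact/measurable_EFinP.
  by apply: eq_fsbigr => r _; rewrite ZY.
move=> mW W0; rewrite -monotone_convergence//.
- apply: eq_integral => w _; apply/esym/cvg_lim => //.
  by apply: cvgeZr => //; exact: cvg_nnsfun_approx.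
- move=> n; apply: emeasurable_funM; apply/measurable_EFinP => //.
  exact: measurableT_comp.
- by move=> n w _; rewrite mule_ge0// lee_fin.
- move=> w _ m n mn; rewrite lee_wpmul2r// lee_fin//.
  exact/lefP/nd_nnsfun_approx.
Qed.

End density.
End monotone_class.

Definition law_measure d d' (T : measurableType d) (S : measurableType d') (R : realType)
    (mu : {measure set T -> \bar R}) (V : T -> S) (mV : measurable_fun setT V) :
  {measure set S -> \bar R} :=
  measure_function_pushforward__canonical__measure_function_Measure mu mV.

(** * Markov property for integrals and conditional means *)

Section markov.
Context {R : realType} {d : nat} {disp : measure_display}
  {Omega : measurableType disp}.
Variables (X : R -> Omega -> finmeas R d) (P : finmeas R d -> probability Omega R).
Variables (alpha beta : R).
Hypotheses (alpha0 : 0 < alpha) (beta0 : 0 < beta).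
Hypothesis sbm : super_brownian_motion X P alpha beta.
Local Notation V := 'rV[R]_d.
Implicit Types (nu mu : finmeas R d) (f : V -> R).

Lemma natural_filtration_sub s A : natural_filtration X s A -> measurable A.
Proof.
have ms : sigma_algebra setT (measurable : set (set Omega)) by exact: sigma_algebra_measurable.
apply: (smallest_sub ms).
move=> B [r /=]; rewrite in_itv/= => /andP[r0 _] [C mC <-].
by apply: (measurable_state sbm r0).
Qed.

Lemma preimage_natural_filtration r s (B : set (finmeas R d)) : 0 <= r <= s -> measurable B ->
  natural_filtration X s (X r @^-1` B).
Proof.
move=> rs mB; apply: sub_gen_smallest; exists r; first by rewrite /= in_itv.
by exists B => //; rewrite setTI.
Qed.

Lemma markov_integral mu s t A (G : finmeas R d -> \bar R) : 0 <= s -> 0 <= t ->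
  natural_filtration X s A -> measurable_fun setT G -> (forall nu, (0 <= G nu)%E) ->
  (\int[P mu]_(w in A) G (X (s + t) w) =
   \int[P mu]_(w in A) \int[P (X s w)]_w' G (X t w'))%E.
Proof.
move=> s0 t0 As mG G0; have mA := natural_filtration_sub As.
have st0 : 0 <= s + t by rewrite addr_ge0.
have [[_ _ _ ker markov] _] := sbm.
have mXt := measurable_state sbm t0.
pose k w := law_measure (P (X s w)) mXt.
rewrite (@integral_disintegration _ _ _ _ _ (P mu) _ (measurable_state sbm st0) A mA k) //.
- apply: eq_integral => w _.
  by rewrite (ge0_integral_pushforward mXt).
- move=> B mB; have := ker t B t0 mB => mk.
  exact: measurableT_comp mk (measurable_state sbm s0).
- by move=> B mB; exact: markov.
Qed.

Lemma measurable_kernel_integral t (G : finmeas R d -> \bar R) : 0 <= t ->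
  measurable_fun setT G -> (forall nu, (0 <= G nu)%E) ->
  measurable_fun setT (fun nu => \int[P nu]_w G (X t w))%E.
Proof.
move=> t0 mG G0; have [[_ _ _ ker _] _] := sbm.
have mXt := measurable_state sbm t0.
have := @measurable_fun_integral_kernel _ _ _ _ R (fun nu => law_measure (P nu) mXt) (fun U => ker t U t0) _ G0 mG.
apply: eq_measurable_fun => nu _.
by rewrite (ge0_integral_pushforward mXt).
Qed.

(** [heat t f] need not be shown continuous: by [first_moment] the pairing is [e^(-beta t)] times a
    mean under [P nu], which depends measurably on [nu] by the kernel property of the process. *)
Lemma measurable_mean M f t : ctest M f -> 0 <= t ->
  measurable_fun [set: finmeas R d] (fun nu => pairing nu (heat t f)).
Proof.
move=> cf t0; have tf := ctest_test cf.
have H : measurable_fun [set: finmeas R d] (fun nu => \int[P nu]_w (pairing (X t w) f)%:E)%E.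
  apply: (measurable_kernel_integral (G := fun nu => (pairing nu f)%:E)) => //.
  - by apply/measurable_EFinP; exact: measurable_pairing cf.
  - by move=> nu; rewrite lee_fin (pairing_ge0 _ tf).
have H2 : measurable_fun [set: finmeas R d] (fun nu => expR (- (beta * t)) * fine (\int[P nu]_w (pairing (X t w) f)%:E)%E).
  by apply: measurable_funM => //; exact: measurableT_comp H.
apply: eq_measurable_fun H2 => nu _.
by rewrite (first_moment alpha0 beta0 sbm nu cf t0)/= mulrA -expRD addNr expR0 mul1r.
Qed.

Lemma markov_mean mu M f s t A : ctest M f -> 0 <= s -> 0 <= t -> natural_filtration X s A ->
  (\int[P mu]_(w in A) (pairing (X (s + t) w) f)%:E =
   \int[P mu]_(w in A) (expR (beta * t) * pairing (X s w) (heat t f))%:E)%E.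
Proof.
move=> cf s0 t0 As; have tf := ctest_test cf.
rewrite (@markov_integral mu s t A (fun nu => (pairing nu f)%:E))//.
- by apply: eq_integral => w _; rewrite (first_moment alpha0 beta0 sbm _ cf t0).
- by apply/measurable_EFinP; exact: measurable_pairing cf.
- by move=> nu; rewrite lee_fin (pairing_ge0 _ tf).
Qed.

End markov.

(** * The discounted martingales and their fluctuations *)

Section maximal_inequality.
Local Open Scope ereal_scope.
Context d (T : measurableType d) (R : realType) (P : probability T R).
Variables (G : nat -> set (set T)) (D : nat -> T -> R) (n : nat) (lam : R).
Local Notation F i := (<<s G i >>).
Hypotheses (lam0 : (0 < lam)%R)
  (mF : forall i A, F i A -> measurable A)
  (ndF : forall i j, (i <= j)%N -> F i `<=` F j)
  (iD : forall i, P.-integrable setT (EFin \o D i))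
  (FD : forall i, F i [set w | lam < `|D i w|]%R)
  (FD0 : forall i, F i [set w | 0 <= D i w]%R)
  (mart : forall i A, (i <= n)%N -> F i A ->
    \int[P]_(w in A) (D i w)%:E = \int[P]_(w in A) (D n w)%:E).

(** [A] is cut along the sign of [D i]. Both pieces belong to [F i], so the martingale identity
    holds on each, and there [D i] is its absolute value up to a sign. *)
Let submartingale i A : (i <= n)%N -> F i A ->
  \int[P]_(w in A) `|(D i w)%:E| <= \int[P]_(w in A) `|(D n w)%:E|.
Proof.
move=> ni FA.
have iDA j B : measurable B -> P.-integrable B (EFin \o D j).
  by move=> mB; apply: integrableS (iD j).
have mA := mF FA.
pose Q := [set w | 0 <= D i w]%R.
have FQ : F i Q by exact: FD0.
have FAQ : F i (A `&` Q) by exact: (@measurableI _ (g_sigma_algebraType (G i))).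
have FAQC : F i (A `&` ~` Q).
  by apply: (@measurableI _ (g_sigma_algebraType (G i))) => //; exact: measurableC.
have mAQ := mF FAQ; have mAQC := mF FAQC.
have mD j B : measurable B -> measurable_fun B (fun w => `|(D j w)%:E|).
  by move=> mB; apply: measurableT_comp => //; exact: measurable_int (iDA j B mB).
have AQ : A = (A `&` Q) `|` (A `&` ~` Q) by rewrite -setIUr setUv setIT.
have dAQ : [disjoint A `&` Q & A `&` ~` Q].
  by apply/disj_setPS => w [[_ q] [_ nq]].
have mU j : measurable_fun (A `&` Q `|` A `&` ~` Q) (fun w => `|(D j w)%:E|).
  by apply: mD => //; exact: measurableU.
rewrite AQ !ge0_integral_setU//.
apply: leeD.
- have -> : \int[P]_(w in A `&` Q) `|(D i w)%:E| = \int[P]_(w in A `&` Q) (D i w)%:E.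
    by apply: eq_integral => w /[!inE] -[_ q]; rewrite gee0_abs.
  rewrite (mart ni FAQ).
  apply: le_integral => //.
  - exact: iDA.
  - exact: integrable_abse (iDA _ _ mAQ).
  - by move=> w _; exact: lee_abs.
- have -> : \int[P]_(w in A `&` ~` Q) `|(D i w)%:E| = - \int[P]_(w in A `&` ~` Q) (D i w)%:E.
    rewrite -integralN; last exact: integrable_add_def (iDA i _ mAQC).
    apply: eq_integral => w /[!inE] -[_ /negP]; rewrite -ltNge => q.
    by rewrite lte0_abs.
  rewrite (mart ni FAQC) -integralN; last exact: integrable_add_def (iDA n _ mAQC).
  apply: le_integral => //.
  - exact: integrableN (iDA _ _ mAQC).
  - exact: integrable_abse (iDA _ _ mAQC).
  - by move=> w _; rewrite -abseN; exact: lee_abs.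
Qed.

(* [seqDU A i] is the event that the level [lam] is first exceeded at time [i]. *)
Lemma maximal_inequality :
  lam%:E * P (\big[setU/set0]_(i < n.+1) [set w | lam < `|D i w|]%R) <= \int[P]_w `|(D n w)%:E|.
Proof.
pose A i := [set w | lam < `|D i w|]%R.
have FB i : F i (seqDU A i).
  apply: (@measurableD _ (g_sigma_algebraType (G i))); first exact: FD.
  apply: (@bigsetU_measurable _ (g_sigma_algebraType (G i))) => j _.
  by apply: (ndF (ltnW (ltn_ord j))); exact: FD.
have mB i : measurable (seqDU A i) by exact: mF (FB i).
have mD : measurable_fun setT (fun w => `|(D n w)%:E|).
  by apply: measurableT_comp => //; exact: measurable_int (iD n).
have AE : \big[setU/set0]_(i < n.+1) A i = \big[setU/set0]_(i <- index_iota 0 n.+1) seqDU A i.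
  by rewrite big_mkord; exact: bigsetU_seqDU.
have mU : measurable (\big[setU/set0]_(i < n.+1) A i).
  by apply: bigsetU_measurable => i _; apply: mF; exact: FD.
apply: (@le_trans _ _ (\int[P]_(w in \big[setU/set0]_(i < n.+1) A i) `|(D n w)%:E|)); last first.
  exact: ge0_subset_integral.
rewrite AE in mU *.
have tB : trivIset [set` index_iota 0 n.+1] (seqDU A).
  by apply: sub_trivIset (trivIset_seqDU A).
rewrite ge0_integral_bigsetU//; last 2 first.
- exact: iota_uniq.
- exact: measurable_funTS.
rewrite [X in lam%:E * X](_ : _ = \sum_(i <- index_iota 0 n.+1) P (seqDU A i)); last first.
  rewrite !big_mkord measure_semi_additive//; last by rewrite big_mkord in mU.
rewrite ge0_sume_distrr//.
rewrite big_seq [leRHS]big_seq; apply: lee_sum => i; rewrite mem_index_iota => /andP[_ ni].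
apply: le_trans (submartingale (leq_trans ni (leqnn _)) (FB i)).
rewrite -integral_cst//; apply: ge0_le_integral => //.
- by move=> w _; rewrite lee_fin ltW.
- apply: measurableT_comp => //; apply: measurable_funTS; exact: measurable_int (iD i).
- by move=> w [/ltW lw _]; rewrite /= lee_fin.
Qed.

End maximal_inequality.

(** * Conditional variance of the pairing *)

Section fluctuation.
Context {R : realType} {d : nat} {disp : measure_display}
  {Omega : measurableType disp}.
Variables (X : R -> Omega -> finmeas R d) (P : finmeas R d -> probability Omega R).
Variables (alpha beta : R).
Hypotheses (alpha0 : 0 < alpha) (beta0 : 0 < beta).
Hypothesis sbm : super_brownian_motion X P alpha beta.
Local Notation V := 'rV[R]_d.
Implicit Types (nu mu : finmeas R d) (f : V -> R).

Let mp M f : ctest M f -> measurable_fun [set: finmeas R d] (fun nu => pairing nu f).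
Proof. exact: measurable_pairing. Qed.

(** Variance plus squared mean, in the form [E Z^2 + m^2 = E (Z - m)^2 + 2 m E Z], where every
    integrand is non-negative. *)
Lemma integral_sqr_pairing_le M f nu t : ctest M f -> 0 <= t ->
  (\int[P nu]_w (pairing (X t w) f ^+ 2)%:E <=
   (4 * var_cst alpha beta M t nu + (expR (beta * t) * pairing nu (heat t f)) ^+ 2)%:E)%E.
Proof.
move=> cf t0; have tf := ctest_test cf.
have := second_moment alpha0 beta0 sbm nu cf t0.
have := first_moment alpha0 beta0 sbm nu cf t0.
set m := expR _ * _; set v := 4 * _ => EZ EZ2.
have m0 : 0 <= m by rewrite mulr_ge0 ?expR_ge0// (pairing_ge0 _ (test_heat t0 tf)).
have mZ := measurable_pairing_state sbm cf t0.
have Z0 w : 0 <= pairing (X t w) f by exact: pairing_ge0 tf.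
have E : (\int[P nu]_w (pairing (X t w) f ^+ 2)%:E + (m ^+ 2)%:E =
    \int[P nu]_w ((pairing (X t w) f - m) ^+ 2)%:E + (2 * m ^+ 2)%:E)%E.
  have -> : ((m ^+ 2)%:E = \int[P nu]_w (m ^+ 2)%:E)%E.
    by rewrite integral_cst//= -[LHS]mule1; congr (_ * _)%E; exact/esym/probability_setT.
  have -> : ((2 * m ^+ 2)%:E = \int[P nu]_w ((2 * m)%:E * (pairing (X t w) f)%:E))%E.
    rewrite ge0_integralZl//.
    - by rewrite EZ -EFinM; congr (_%:E); ring.
    - exact/measurable_EFinP.
    - by move=> w _; rewrite lee_fin.
    - by rewrite lee_fin mulr_ge0.
  rewrite -!ge0_integralD//.
  - by apply: eq_integral => w _; rewrite -EFinM -!EFinD; congr (_%:E); ring.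
  - by move=> w _; rewrite lee_fin sqr_ge0.
  - by apply/measurable_EFinP; apply: measurable_funX; exact: measurable_funB.
  - by move=> w _; rewrite -EFinM lee_fin mulr_ge0// mulr_ge0.
  - by apply/measurable_EFinP; exact: measurable_funM.
  - by move=> w _; rewrite lee_fin sqr_ge0.
  - by apply/measurable_EFinP; exact: measurable_funX.
  - by move=> w _; rewrite lee_fin sqr_ge0.
rewrite -(leeD2rE _ _ (_ : (m ^+ 2)%:E \is a fin_num))// E.
apply: (le_trans (leeD2r _ EZ2)); rewrite -!EFinD lee_fin; lra.
Qed.

(** Write [Z] for the pairing at time [s + t] and [Y = g (X s)] for its conditional mean, so that
    [E (Z - Y)^2 = E Z^2 - E Y^2]. The Markov property and the bound of the second moment from [X s]
    give [E Z^2 <= E Y^2] plus a multiple of the mean mass at time [s], which is where [e^(beta s)]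
    comes from. *)
Lemma conditional_variance M f mu s t : ctest M f -> 0 <= s -> 0 <= t ->
  (\int[P mu]_w ((pairing (X (s + t) w) f - expR (beta * t) * pairing (X s w) (heat t f)) ^+ 2)%:E
    <= (4 * alpha * M ^+ 2 * t * expR (2 * beta * t) * expR (beta * s) * pairing mu (cst 1))%:E)%E.
Proof.
move=> cf s0 t0; have tf := ctest_test cf.
have st0 : 0 <= s + t by rewrite addr_ge0.
have c1 : ctest 1 (cst 1 : V -> R).
  by split; [exact: cst_continuous|move=> x; rewrite /= ler01 lexx].
have M0 := test_bound_ge0 tf.
have th := test_heat t0 tf.
pose g nu := expR (beta * t) * pairing nu (heat t f).
pose K := alpha * M ^+ 2 * t * expR (2 * beta * t).
have K0 : 0 <= K.
  by rewrite /K mulr_ge0 ?expR_ge0// mulr_ge0// mulr_ge0 ?sqr_ge0// ltW.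
have mg : measurable_fun [set: finmeas R d] g.
  by apply: measurable_funM => //; exact: (measurable_mean alpha0 beta0 sbm cf t0).
have g0 nu : 0 <= g nu by rewrite mulr_ge0 ?expR_ge0// (pairing_ge0 _ th).
have mZ := measurable_pairing_state sbm cf st0.
have mY : measurable_fun setT (fun w => g (X s w)).
  exact: measurableT_comp mg (measurable_state sbm s0).
have mass0 w : 0 <= pairing (X s w) (cst 1) by exact: pairing_ge0 (ctest_test c1).
have mmass := measurable_pairing_state sbm c1 s0.
have Z0 w : 0 <= pairing (X (s + t) w) f by exact: pairing_ge0 tf.
(* Finiteness is what allows [E Y^2] to be cancelled at the end; [Y] is at most [e^(beta t) M] times
   the mass, whose second moment is finite. *)
have EY2 : (\int[P mu]_w (g (X s w) ^+ 2)%:E < +oo)%E.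
  apply: (@le_lt_trans _ _ (\int[P mu]_w (((expR (beta * t) * M) ^+ 2)%:E * (pairing (X s w) (cst 1) ^+ 2)%:E))%E).
    apply: ge0_le_integral => //.
    - by move=> w _; rewrite lee_fin sqr_ge0.
    - by apply/measurable_EFinP; exact: measurable_funX.
    - by apply/measurable_EFinP; apply: measurable_funM => //; exact: measurable_funX.
    - move=> w _; rewrite -EFinM lee_fin -exprMn ler_sqr ?nnegrE ?g0//; last first.
        by rewrite mulr_ge0// mulr_ge0// expR_ge0.
      rewrite /g -mulrA ler_wpM2l ?expR_ge0// -pairing_cst.
      by apply: (le_pairing _ th (test_cst M0)) => x; exact: test_le th.
  rewrite ge0_integralZl//.
  - rewrite lte_mul_pinfty//; first by rewrite lee_fin sqr_ge0.
    exact: le_lt_trans (integral_sqr_pairing_le mu c1 s0) (ltry _).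
  - by apply/measurable_EFinP; exact: measurable_funX.
  - by move=> w _; rewrite lee_fin sqr_ge0.
  - by rewrite lee_fin sqr_ge0.
have Emass : (\int[P mu]_w (pairing (X s w) (cst 1))%:E = (expR (beta * s) * pairing mu (cst 1))%:E)%E.
  rewrite (first_moment alpha0 beta0 sbm mu c1 s0); congr (_ * _)%:E.
  by apply: eq_Rintegral => x _; rewrite heat_cst.
have EZ2 : (\int[P mu]_w (pairing (X (s + t) w) f ^+ 2)%:E <=
    (4 * K * (expR (beta * s) * pairing mu (cst 1)))%:E + \int[P mu]_w (g (X s w) ^+ 2)%:E)%E.
  have FT : natural_filtration X s setT by exact: (@measurableT _ (g_sigma_algebraType _)).
  have mG : measurable_fun [set: finmeas R d] (fun nu => (pairing nu f ^+ 2)%:E).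
    by apply/measurable_EFinP; apply: measurable_funX; exact: mp cf.
  rewrite (markov_integral sbm mu s0 t0 FT mG); last by move=> nu; rewrite lee_fin sqr_ge0.
  rewrite EFinM -Emass -ge0_integralZl//; last 3 first.
  - exact/measurable_EFinP.
  - by move=> w _; rewrite lee_fin.
  - by rewrite lee_fin mulr_ge0.
  rewrite -ge0_integralD//; last 4 first.
  - by move=> w _; rewrite -EFinM lee_fin mulr_ge0// mulr_ge0.
  - by apply/measurable_EFinP; exact: measurable_funM.
  - by move=> w _; rewrite lee_fin sqr_ge0.
  - by apply/measurable_EFinP; exact: measurable_funX.
  apply: ge0_le_integral => //.
  - by move=> w _; apply: integral_ge0 => w' _; rewrite lee_fin sqr_ge0.
  - apply: (measurableT_comp (measurable_kernel_integral sbm t0 mG _) (measurable_state sbm s0)).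
    by move=> nu; rewrite lee_fin sqr_ge0.
  - by apply: emeasurable_funD; apply/measurable_EFinP; [exact: measurable_funM|exact: measurable_funX].
  - move=> w _; apply: le_trans (integral_sqr_pairing_le (X s w) cf t0) _.
    by rewrite -EFinM -EFinD lee_fin /var_cst -/K -/(g _) mulrA.
(* [g (X s)] is the known factor, and [markov_mean] identifies the conditional expectation of the
   other one. *)
have EZY : (\int[P mu]_w ((g (X s w))%:E * (pairing (X (s + t) w) f)%:E) =
    \int[P mu]_w (g (X s w) ^+ 2)%:E)%E.
  rewrite (@eq_integral_density _ _ _ _ _ (P mu) (X s) (measurable_state sbm s0)
    _ (fun w => g (X s w)) mZ Z0 mY (fun w => g0 _) _ (EFin \o g))//.
  - move=> B mB; apply: (markov_mean alpha0 beta0 sbm mu cf s0 t0).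
    by apply: preimage_natural_filtration => //; rewrite s0 lexx.
  - exact/measurable_EFinP.
set I := (\int[P mu]_w (g (X s w) ^+ 2)%:E)%E in EY2 EZ2 EZY.
have I0 : (0 <= I)%E by apply: integral_ge0 => w _; rewrite lee_fin sqr_ge0.
have Ifin : I \is a fin_num by rewrite ge0_fin_numE.
have E : (\int[P mu]_w ((pairing (X (s + t) w) f - g (X s w)) ^+ 2)%:E + 2%:E * I =
    \int[P mu]_w (pairing (X (s + t) w) f ^+ 2)%:E + I)%E.
  have -> : (2%:E * I = \int[P mu]_w (2%:E * ((g (X s w))%:E * (pairing (X (s + t) w) f)%:E)))%E.
    rewrite ge0_integralZl//; first by rewrite EZY.
    + by apply/measurable_EFinP; exact: measurable_funM.
    + by move=> w _; rewrite -EFinM lee_fin mulr_ge0.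
  rewrite -[LHS]ge0_integralD//; first rewrite -[RHS]ge0_integralD//.
  - by apply: eq_integral => w _; rewrite -!EFinM -!EFinD; congr (_%:E); ring.
  - by move=> w _; rewrite lee_fin sqr_ge0.
  - by apply/measurable_EFinP; exact: measurable_funX.
  - by move=> w _; rewrite lee_fin sqr_ge0.
  - by apply/measurable_EFinP; exact: measurable_funX.
  - by move=> w _; rewrite lee_fin sqr_ge0.
  - by apply/measurable_EFinP; apply: measurable_funX; exact: measurable_funB.
  - by move=> w _; rewrite -!EFinM lee_fin mulr_ge0// mulr_ge0.
  - by apply/measurable_EFinP; apply: measurable_funM => //; exact: measurable_funM.
have I2fin : (2%:E * I)%E \is a fin_num by rewrite fin_numM.
rewrite -(leeD2rE _ _ I2fin) E.
apply: (le_trans (leeD2r _ EZ2)).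
rewrite -addeA -(_ : (2%:E * I = I + I)%E); last first.
  by rewrite -(fineK Ifin) -EFinM -EFinD; congr (_%:E); ring.
rewrite leeD2rE//.
by rewrite lee_fin (_ : 4 * K * _ = 4 * alpha * M ^+ 2 * t * expR (2 * beta * t) * expR (beta * s) * pairing mu (cst 1))// /K; ring.
Qed.

End fluctuation.

(** * The discounted martingales and their maximal inequality *)

Section discounted_process.
Context {R : realType} {d : nat} {disp : measure_display}
  {Omega : measurableType disp}.
Variables (X : R -> Omega -> finmeas R d) (P : finmeas R d -> probability Omega R).
Variables (alpha beta : R).
Hypotheses (alpha0 : 0 < alpha) (beta0 : 0 < beta).
Hypothesis sbm : super_brownian_motion X P alpha beta.
Local Notation V := 'rV[R]_d.
Implicit Types (nu mu : finmeas R d) (f : V -> R).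

(* A martingale in [t] on [0, T], for the laws [P mu]. *)
Definition disc f (T t : R) (w : Omega) : R :=
  expR (- (beta * t)) * pairing (X t w) (heat (T - t) f).

Lemma measurable_pairing_heat M f (T t : R) : ctest M f -> t <= T ->
  measurable_fun [set: finmeas R d]
    (fun nu => expR (- (beta * t)) * pairing nu (heat (T - t) f)).
Proof.
move=> cf tT; apply: measurable_funM => //.
by apply: (measurable_mean alpha0 beta0 sbm cf); rewrite subr_ge0.
Qed.

Lemma measurable_disc M f (T t : R) : ctest M f -> 0 <= t <= T ->
  measurable_fun setT (disc f T t).
Proof.
move=> cf /andP[t0 tT].
exact: (measurableT_comp (measurable_pairing_heat cf tT) (measurable_state sbm t0)).
Qed.

Lemma disc_ge0 M f (T t : R) w : test M f -> t <= T -> 0 <= disc f T t w.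
Proof.
move=> tf tT; rewrite mulr_ge0 ?expR_ge0//.
by apply: pairing_ge0; apply: test_heat tf; rewrite subr_ge0.
Qed.

(** The conditional mean of [<X_T, f>] at time [t] is [e^(beta (T - t)) <X_t, P_(T-t) f>]; the
    discount factors combine to [e^(-beta t)]. *)
Lemma disc_martingale mu M f (T t : R) A : ctest M f -> 0 <= t <= T -> natural_filtration X t A ->
  (\int[P mu]_(w in A) (disc f T t w)%:E = \int[P mu]_(w in A) (disc f T T w)%:E)%E.
Proof.
move=> cf /andP[t0 tT] At; have tf := ctest_test cf.
have tT0 : 0 <= T - t by rewrite subr_ge0.
have T0 : 0 <= T by exact: le_trans tT.
have mA := natural_filtration_sub sbm At.
have E : (\int[P mu]_(w in A) (disc f T T w)%:E =
    (expR (- (beta * T)))%:E * \int[P mu]_(w in A) (pairing (X T w) f)%:E)%E.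
  rewrite -ge0_integralZl//.
  - apply: eq_integral => w _; rewrite -EFinM /disc; congr (_ * _)%:E.
    by apply: eq_Rintegral => y _; rewrite subrr heat0.
  - by apply/measurable_EFinP; apply: measurable_funTS; exact: (measurable_pairing_state sbm cf T0).
  - by move=> w _; rewrite lee_fin (pairing_ge0 _ tf).
have TE : T = t + (T - t) by ring.
rewrite E {3}TE (markov_mean alpha0 beta0 sbm mu cf t0 tT0 At) -ge0_integralZl//.
- apply: eq_integral => w _; rewrite -EFinM /disc mulrA -expRD.
  by congr (expR _ * _)%:E; ring.
- apply/measurable_EFinP; apply: measurable_funTS; apply: measurable_funM => //.
  exact: (measurableT_comp (measurable_mean alpha0 beta0 sbm cf tT0) (measurable_state sbm t0)).
- move=> w _; rewrite lee_fin mulr_ge0 ?expR_ge0//.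
  exact: pairing_ge0 (test_heat tT0 tf).
Qed.

Lemma disc_integrable mu M f (T t : R) : ctest M f -> 0 <= t <= T ->
  (P mu).-integrable setT (EFin \o disc f T t).
Proof.
move=> cf tT; have /andP[t0 tT'] := tT; have tf := ctest_test cf.
have mD := measurable_disc cf tT.
apply/integrableP; split; first exact/measurable_EFinP.
have T0 : 0 <= T by exact: le_trans tT'.
have FT : natural_filtration X t setT by exact: (@measurableT _ (g_sigma_algebraType _)).
under eq_integral do rewrite gee0_abs ?lee_fin ?(disc_ge0 _ tf)//.
rewrite (disc_martingale mu cf tT FT) /disc.
under eq_integral do rewrite EFinM.
rewrite ge0_integralZl//.
- rewrite lte_mul_pinfty// ?lee_fin ?expR_ge0//.
  have -> : (\int[P mu]_w (pairing (X T w) (heat (T - T) f))%:E = \int[P mu]_w (pairing (X T w) f)%:E)%E.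
    by apply: eq_integral => w _; congr (_%:E); apply: eq_Rintegral => y _; rewrite subrr heat0.
  by rewrite (first_moment alpha0 beta0 sbm mu cf T0) ltry.
- apply/measurable_EFinP; have := measurable_mean alpha0 beta0 sbm cf (_ : 0 <= T - T).
  rewrite subrr lexx => /(_ isT) h.
  exact: (measurableT_comp h (measurable_state sbm T0)).
- by move=> w _; rewrite lee_fin; apply: pairing_ge0; apply: test_heat tf; rewrite subrr.
Qed.

(** After discounting, the variance is at most [q^2 C] with [q = e^(-beta s / 2)], because [- 2 beta
    T + 2 beta (T - s) + beta s = - beta s]. The inequality [|z| <= q / 2 + z^2 / (2 q)] then
    replaces Cauchy-Schwarz. *)
Lemma disc_variation mu M f (s T : R) : ctest M f -> 0 <= s <= T ->
  (\int[P mu]_w `|(disc f T T w - disc f T s w)%:E| <=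
   (expR (- (beta * s) / 2) * (1 + 4 * alpha * M ^+ 2 * (T - s) * pairing mu (cst 1)) / 2)%:E)%E.
Proof.
move=> cf sT; have /andP[s0 sT'] := sT; have tf := ctest_test cf.
have T0 : 0 <= T by exact: le_trans sT'.
have Ts0 : 0 <= T - s by rewrite subr_ge0.
set q := expR (- (beta * s) / 2); have q0 : 0 < q by exact: expR_gt0.
have mD t : 0 <= t <= T -> measurable_fun setT (disc f T t) by exact: measurable_disc cf.
have TT : 0 <= T <= T by rewrite T0 lexx.
have mB : measurable_fun setT (fun w => disc f T T w - disc f T s w).
  by apply: measurable_funB; exact: mD.
pose C := 4 * alpha * M ^+ 2 * (T - s) * pairing mu (cst 1).
have var : (\int[P mu]_w ((disc f T T w - disc f T s w) ^+ 2)%:E <= (q ^+ 2 * C)%:E)%E.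
  have := conditional_variance alpha0 beta0 sbm mu cf s0 Ts0.
  rewrite (_ : s + (T - s) = T); last by ring.
  move=> H.
  have -> : (\int[P mu]_w ((disc f T T w - disc f T s w) ^+ 2)%:E =
      (expR (- (2 * beta * T)))%:E * \int[P mu]_w ((pairing (X T w) f - expR (beta * (T - s)) * pairing (X s w) (heat (T - s) f)) ^+ 2)%:E)%E.
    rewrite -ge0_integralZl//.
    - apply: eq_integral => w _; rewrite -EFinM; congr (_%:E).
      have -> : disc f T T w = expR (- (beta * T)) * pairing (X T w) f.
        by rewrite /disc; congr (_ * _); apply: eq_Rintegral => y _; rewrite subrr heat0.
      have -> : disc f T s w = expR (- (beta * T)) * (expR (beta * (T - s)) * pairing (X s w) (heat (T - s) f)).
        by rewrite /disc mulrA -expRD; congr (expR _ * _); ring.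
      by rewrite -mulrBr exprMn expr2 -expRD; congr (expR _ * _); ring.
    - apply/measurable_EFinP; apply: measurable_funX; apply: measurable_funB.
        exact: (measurable_pairing_state sbm cf T0).
      apply: measurable_funM => //.
      exact: (measurableT_comp (measurable_mean alpha0 beta0 sbm cf Ts0) (measurable_state sbm s0)).
    - by move=> w _; rewrite lee_fin sqr_ge0.
  apply: (le_trans (lee_wpmul2l _ H)); first by rewrite lee_fin.
  rewrite -EFinM lee_fin.
  have -> : q ^+ 2 = expR (- (2 * beta * T)) * expR (2 * beta * (T - s)) * expR (beta * s).
    by rewrite expr2 -!expRD; congr expR; field.
  by rewrite /C le_eqVlt; apply/orP; left; apply/eqP; ring.
apply: (@le_trans _ _ (\int[P mu]_w (q / 2 + (disc f T T w - disc f T s w) ^+ 2 / (2 * q))%:E)%E).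
  apply: ge0_le_integral => //.
  - by apply: measurableT_comp => //; exact/measurable_EFinP.
  - apply/measurable_EFinP; apply: measurable_funD => //; apply: measurable_funM => //; exact: measurable_funX.
  - move=> w _; rewrite lee_fin; set z := _ - _.
    rewrite -subr_ge0 -(real_normK (num_real z)).
    rewrite (_ : _ - _ = (`|z| - q) ^+ 2 / (2 * q)); last by field; rewrite gt_eqF.
    by rewrite divr_ge0 ?sqr_ge0// mulr_ge0// ltW.
under eq_integral do rewrite EFinD.
rewrite ge0_integralD//; last 3 first.
- by move=> w _; rewrite lee_fin divr_ge0// ltW.
- by move=> w _; rewrite lee_fin divr_ge0 ?sqr_ge0// mulr_ge0// ltW.
- by apply/measurable_EFinP; apply: measurable_funM => //; exact: measurable_funX.
rewrite integral_cst//=.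
have -> : (\int[P mu]_w ((disc f T T w - disc f T s w) ^+ 2 / (2 * q))%:E = ((2 * q)^-1)%:E * \int[P mu]_w ((disc f T T w - disc f T s w) ^+ 2)%:E)%E.
  rewrite -ge0_integralZl//.
  - by apply: eq_integral => w _; rewrite -EFinM mulrC.
  - by apply/measurable_EFinP; exact: measurable_funX.
  - by move=> w _; rewrite lee_fin sqr_ge0.
  - by rewrite lee_fin invr_ge0 mulr_ge0// ltW.
have P1 : ((q / 2)%:E * P mu setT = (q / 2)%:E)%E.
  by rewrite -[RHS]mule1; congr (_ * _)%E; exact: probability_setT.
rewrite P1; apply: (@le_trans _ _ ((q / 2)%:E + ((2 * q)^-1)%:E * (q ^+ 2 * C)%:E)%E).
  by rewrite leeD2l// lee_wpmul2l// lee_fin invr_ge0 mulr_ge0// ltW.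
rewrite -EFinM -EFinD lee_fin le_eqVlt; apply/orP; left; apply/eqP.
by rewrite -/C; field; rewrite gt_eqF.
Qed.

Lemma le_natural_filtration r s : r <= s -> natural_filtration X r `<=` natural_filtration X s.
Proof.
move=> rs; apply: sub_sigma_algebra2 => B [q /=]; rewrite in_itv/= => /andP[q0 qr] ?.
by exists q => //=; rewrite in_itv/= q0 (le_trans qr).
Qed.

Lemma disc_adapted M f (T r s : R) : ctest M f -> 0 <= r <= T -> r <= s ->
  measurable_fun [set: g_sigma_algebraType (\bigcup_(r in `[0, s]) preimage_set_system setT (X r) measurable)] (disc f T r).
Proof.
move=> cf /andP[r0 rT] rs.
apply: (measurableT_comp (measurable_pairing_heat cf rT)).
move=> _ B mB; rewrite setTI; apply: preimage_natural_filtration mB.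
by rewrite r0.
Qed.

Definition grid (s T : R) (k i : nat) : R := s + (T - s) * (i%:R / 2 ^+ k).

Lemma grid_itv s T k i : s <= T -> (i <= 2 ^ k)%N -> s <= grid s T k i <= T.
Proof.
move=> sT ik; have Ts : 0 <= T - s by rewrite subr_ge0.
rewrite /grid lerDl mulr_ge0//= -lerBrDl ler_piMr// ler_pdivrMr ?exprn_gt0// mul1r.
by rewrite -natrX ler_nat.
Qed.

Lemma le_grid s T k i j : s <= T -> (i <= j)%N -> grid s T k i <= grid s T k j.
Proof.
move=> sT ij; rewrite lerD2l ler_wpM2l ?subr_ge0// ler_wpM2r ?invr_ge0 ?exprn_ge0//.
by rewrite ler_nat.
Qed.

Lemma gridS s T k i : grid s T k.+1 (2 * i) = grid s T k i.
Proof.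
by rewrite /grid natrM exprS; congr (_ + _ * _); field; rewrite expf_neq0.
Qed.

Lemma gridT s T k : grid s T k (2 ^ k) = T.
Proof.
by rewrite /grid natrX divff ?mulr1 ?expf_neq0//; ring.
Qed.

Lemma disc_maximal_grid mu M f (s T lam : R) k : ctest M f -> 0 <= s <= T -> 0 < lam ->
  (P mu (\big[setU/set0]_(i < (2 ^ k).+1)
     [set w | (lam < `|disc f T (grid s T k (minn i (2 ^ k))) w - disc f T s w|)%R]) <=
   (expR (- (beta * s) / 2) * (1 + 4 * alpha * M ^+ 2 * (T - s) * pairing mu (cst 1)) / 2 / lam)%:E)%E.
Proof.
move=> cf sT lam0; have /andP[s0 sT'] := sT; have tf := ctest_test cf.
have T0 : 0 <= T by exact: le_trans sT'.
pose n := (2 ^ k)%N.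
(* Indices beyond [2 ^ k] are frozen at [T]: [maximal_inequality] asks for adaptedness and
   integrability at every index. *)
pose tau i := grid s T k (minn i n).
have tauT i : s <= tau i <= T by apply: grid_itv => //; exact: geq_minr.
have tau0 i : 0 <= tau i <= T by have /andP[a ->] := tauT i; rewrite (le_trans s0 a).
have tauS i : s <= tau i by have /andP[] := tauT i.
pose G i := \bigcup_(r in `[0, tau i]) preimage_set_system setT (X r) measurable.
pose D i w := disc f T (tau i) w - disc f T s w.
have mD i : measurable_fun [set: g_sigma_algebraType (G i)] (D i).
  by apply: measurable_funB; apply: (disc_adapted cf).
have taun : tau n = T by rewrite /tau minnn gridT.
have H := @maximal_inequality _ _ _ (P mu) G D n lam lam0.
have Dn w : D n w = disc f T T w - disc f T s w by rewrite /D taun.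
rewrite EFinM muleC lee_pdivlMl//.
apply: (@le_trans _ _ (\int[P mu]_w `|(D n w)%:E|)%E); last first.
  by under eq_integral do rewrite Dn; exact: (disc_variation mu cf sT).
have sub i A : <<s G i>> A -> measurable A by exact: (natural_filtration_sub sbm (s := tau i)).
suff K : (lam%:E * P mu (\big[setU/set0]_(i < n.+1) [set w | (lam < `|D i w|)%R]) <= \int[P mu]_w `|(D n w)%:E|)%E.
  by move: K; rewrite {1}/D /tau /n.
apply: (H sub) => {H}.
- move=> i j ij; apply: le_natural_filtration; apply: le_grid => //.
  by rewrite leq_min geq_minr andbT (leq_trans (geq_minl _ _)).
- move=> i; rewrite (_ : EFin \o D i = (fun w => (disc f T (tau i) w)%:E - (disc f T s w)%:E)%E)//.
  by apply: integrableB => //; apply: (disc_integrable mu cf).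
- move=> i; rewrite (_ : [set w | _] = [set: g_sigma_algebraType (G i)] `&` (fun w => `|D i w|) @^-1` `]lam, +oo[%classic).
    by apply: (measurableT_comp (@normr_measurable R setT) (mD i)).
  by rewrite setTI; apply/seteqP; split => w /=; rewrite in_itv/= andbT.
- move=> i; rewrite (_ : [set w | _] = [set: g_sigma_algebraType (G i)] `&` D i @^-1` `[0, +oo[%classic).
    exact: mD.
  by rewrite setTI; apply/seteqP; split => w /=; rewrite in_itv/= andbT.
- move=> i A ni FA; have mA := sub _ _ FA.
  have iA t : 0 <= t <= T -> (P mu).-integrable A (EFin \o disc f T t).
    by move=> tT; apply: integrableS (disc_integrable mu cf tT).
  have E j : (\int[P mu]_(w in A) (D j w)%:E = \int[P mu]_(w in A) (disc f T (tau j) w)%:E - \int[P mu]_(w in A) (disc f T s w)%:E)%E.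
    by rewrite -integralB_EFin//; apply: iA.
  by rewrite (E i) (E n) taun (disc_martingale mu cf (tau0 i) FA).
Qed.

(** The bound on one grid does not depend on its level. By [gridS] each grid contains the previous
    one, so the exceptional events increase with [k] and their union obeys the same bound. *)
Lemma disc_maximal mu M f (s T lam : R) : ctest M f -> 0 <= s <= T -> 0 < lam ->
  exists E : set Omega, [/\ measurable E,
   (P mu E <= (expR (- (beta * s) / 2) * (1 + 4 * alpha * M ^+ 2 * (T - s) * pairing mu (cst 1)) / 2 / lam)%:E)%E &
   forall w, ~ E w -> forall k i, (i <= 2 ^ k)%N ->
     `|disc f T (grid s T k i) w - disc f T s w| <= lam].
Proof.
move=> cf sT lam0; have /andP[s0 sT'] := sT.
pose A k (i : nat) := [set w | (lam < `|disc f T (grid s T k (minn i (2 ^ k))) w - disc f T s w|)%R].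
pose E k := \big[setU/set0]_(i < (2 ^ k).+1) A k i.
have mA k i : measurable (A k i).
  have mD : measurable_fun setT (fun w => disc f T (grid s T k (minn i (2 ^ k))) w - disc f T s w).
    apply: measurable_funB; apply: (measurable_disc cf).
      have /andP[a ->] := grid_itv sT' (geq_minr i (2 ^ k)).
      by rewrite (le_trans s0 a).
    by rewrite s0.
  rewrite (_ : A k i = setT `&` (fun w => `|disc f T (grid s T k (minn i (2 ^ k))) w - disc f T s w|) @^-1` `]lam, +oo[%classic).
    by apply: (measurableT_comp (@normr_measurable R setT) mD).
  by rewrite setTI; apply/seteqP; split => w /=; rewrite in_itv/= andbT.
have mE k : measurable (E k) by apply: bigsetU_measurable.
have EP k w : E k w <-> exists2 i, (i <= 2 ^ k)%N & lam < `|disc f T (grid s T k i) w - disc f T s w|.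
  rewrite /E -bigcup_mkord; split.
    by move=> [i /=]; rewrite ltnS => ik; rewrite /A /= (minn_idPl ik); exists i.
  by move=> [i ik h]; exists i; [rewrite /= ltnS|rewrite /A /= (minn_idPl ik)].
have ndE : {homo E : k l / (k <= l)%N >-> (k <= l)%O}.
  apply/nondecreasing_seqP => k; apply/subsetPset => w /EP[i ik h].
  by apply/EP; exists (2 * i)%N; [rewrite expnS leq_mul2l ik orbT|rewrite gridS].
exists (\bigcup_k E k); split.
- exact: bigcup_measurable.
- have cE : P mu (E k) @[k --> \oo] --> P mu (\bigcup_k E k).
    exact: nondecreasing_cvg_mu mE (bigcup_measurable (fun k _ => mE k)) ndE.
  rewrite -(cvg_lim _ cE)//; apply: lime_le.
    apply: ereal_nondecreasing_is_cvgn => k l kl /=; apply: le_measure; rewrite ?inE//.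
    by have := ndE _ _ kl; rewrite subsetEset.
  by apply: nearW => k; exact: (disc_maximal_grid mu k cf sT lam0).
- move=> w nE k i ik; rewrite leNgt; apply/negP => h; apply: nE.
  by exists k => //; apply/EP; exists i.
Qed.

End discounted_process.

(** * Pointwise heat estimates *)

Lemma le_powRl {R : realType} (r a b : R) : 0 <= r -> 0 <= a <= b -> a `^ r <= b `^ r.
Proof.
move=> r0 /andP[a0 ab]; apply: (ge0_ler_powR r0) => //; rewrite nnegrE//.
exact: le_trans ab.
Qed.

Section heat_estimates.
Context {R : realType} {d : nat}.
Local Notation V := 'rV[R]_d.
Local Notation L := (lebesgue_vec d).
Implicit Types (f : V -> R) (x y z : V).

(** Bernoulli's inequality for [a ^+ d], which is at most [a^(d/2)] because [a <= 1]. *)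
Lemma powR_half_ge (a : R) : 0 <= a <= 1 -> 1 - d%:R * (1 - a) <= a `^ (d%:R / 2).
Proof.
move=> /andP[a0 a1].
have bern n : 1 - n%:R * (1 - a) <= a ^+ n.
  elim: n => [|n IH]; first by rewrite mul0r subr0 expr0.
  rewrite exprS -natr1; have := ler_wpM2l a0 IH.
  have : 0 <= n%:R * (1 - a) ^+ 2 by rewrite mulr_ge0 ?sqr_ge0.
  nra.
apply: (le_trans (bern d)).
move: a0; rewrite le_eqVlt => /predU1P[<-|a0].
  case: d => [|n]; first by rewrite expr0 mul0r powRr0.
  by rewrite expr0n powR_ge0.
have a01 : 0 < a <= 1 by rewrite a0.
rewrite -powR_mulrn; last exact: ltW.
apply: (ger_powR a01).
by rewrite ler_pdivrMr// ler_peMr// ler1n.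
Qed.

Lemma continuous_sqdist x : continuous (fun y : V => \sum_i (y 0 i - x 0 i) ^+ 2).
Proof.
pose F (i : 'I_d) (y : V) : R := (y 0 i - x 0 i) ^+ 2.
have cF i : true -> continuous (F i).
  move=> _; have H (y : V) : (fun z : V => (z 0 i - x 0 i) * (z 0 i - x 0 i)) @ y --> (y 0 i - x 0 i) * (y 0 i - x 0 i).
    have c0 : (fun z : V => z 0 i : R) @ y --> (y 0 i : R) by exact: coord_continuous.
    have h : (fun z : V => z 0 i - x 0 i) @ y --> y 0 i - x 0 i by exact: (cvgB c0 (cvg_cst _)).
    exact: (cvgM h h).
  by move=> y; exact: H.
exact: (continuous_big (@add_continuous R^o) (r := index_enum 'I_d) cF).
Qed.

Lemma continuous_gauss (A : R) x : continuous (gauss A x : V -> R).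
Proof.
have H (y : V) : gauss A x @ y --> gauss A x y.
  have h0 : (fun z : V => \sum_i (z 0 i - x 0 i) ^+ 2) @ y --> \sum_i (y 0 i - x 0 i) ^+ 2.
    exact: continuous_sqdist.
  have h : (fun z : V => (\sum_i (z 0 i - x 0 i) ^+ 2) * - (2 * A)^-1) @ y --> (\sum_i (y 0 i - x 0 i) ^+ 2) * - (2 * A)^-1.
    exact: (cvgM h0 (cvg_cst _)).
  rewrite (_ : gauss A x = expR \o (fun z : V => (\sum_i (z 0 i - x 0 i) ^+ 2) * - (2 * A)^-1)).
    exact: (cvg_comp _ expR h (@continuous_expR R _)).
  by apply/funext => z; rewrite /gauss /= mulrN mulNr.
by move=> y; exact: H.
Qed.

Lemma gauss_center (A : R) y : gauss A y y = 1.
Proof. by rewrite /gauss big1 ?oppr0 ?mul0r ?expR0// => i _; rewrite subrr expr0n. Qed.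

Lemma le_gauss (A B : R) y z : 0 < A -> A <= B -> gauss A y z <= gauss B y z.
Proof.
move=> A0 AB; rewrite ler_expR !mulNr lerN2.
apply: ler_wpM2l; first by apply: sumr_ge0 => i _; exact: sqr_ge0.
by rewrite lef_pV2 ?posrE ?mulr_gt0// ?(lt_le_trans A0)// ler_pM2l.
Qed.

Lemma gauss_sqr (A : R) y z : 0 < A -> gauss (2 * A) y z ^+ 2 = gauss A y z.
Proof.
move=> A0; rewrite /gauss expr2 -expRD; congr expR; field.
by rewrite gt_eqF.
Qed.

(** Coordinatewise [(z - y)^2 <= 2 (y - x)^2 + 2 (z - x)^2]. This separates the point [y] carrying
    mass from the point [z] of the support of [f]. *)
Lemma gauss_split (A : R) x y z : 0 < A ->
  gauss (A / 2) x y * gauss (A / 2) x z <= gauss A y z.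
Proof.
move=> A0; rewrite !gaussE -expRD ler_expR -big_split; apply: ler_sum => i _ /=.
rewrite (_ : 2 * (A / 2) = A); last by field.
rewrite -mulrDl ler_pdivlMr ?mulr_gt0//.
rewrite (_ : (_ + _) / A * (2 * A) = 2 * (- (y 0 i - x 0 i) ^+ 2 - (z 0 i - x 0 i) ^+ 2)); last first.
  by field; rewrite gt_eqF.
have := sqr_ge0 (z 0 i + y 0 i - 2 * x 0 i); nra.
Qed.

(** * Heat estimates for functions dominated by a Gaussian *)

Section dominated.
Variables (M C : R) (f : V -> R).
Hypothesis tf : test M f.
Hypothesis fC : forall y, f y <= C * gauss 1 0 y.

Let C0 : 0 <= C.
Proof. by have := le_trans (test_ge0 0 tf) (fC 0); rewrite gauss_center mulr1. Qed.

Lemma dominated_integrable : L.-integrable setT (EFin \o f).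
Proof.
have mf := tf.1; apply/integrableP; split; first exact/measurable_EFinP.
apply: (@le_lt_trans _ _ (\int[L]_y (C%:E * (gauss 1 0 y)%:E))%E).
  apply: ge0_le_integral => //.
  - by apply: measurableT_comp => //; exact/measurable_EFinP.
  - by apply/measurable_EFinP; apply: measurable_funM => //; exact: measurable_gauss.
  - by move=> y _; rewrite -EFinM gee0_abs lee_fin ?(test_ge0 _ tf).
rewrite ge0_integralZl//.
- by rewrite integral_gauss// -EFinM ltry.
- by apply/measurable_EFinP; exact: measurable_gauss.
- by move=> y _; rewrite lee_fin gauss_ge0.
Qed.

Lemma dominated_EFin : (\int[L]_y (f y)%:E = (\int[L]_y f y)%:E)%E.
Proof. by rewrite /Rintegral fineK//; exact: integrable_fin_num dominated_integrable. Qed.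

Lemma heat_le_integral r y : 0 < r ->
  heat r f y <= (2 * pi * r) `^ (- (d%:R / 2)) * \int[L]_z f z.
Proof.
move=> r0; rewrite -lee_fin (heat_integral _ r0 tf) EFinM -dominated_EFin.
rewrite -ge0_integralZl//.
- apply: ge0_le_integral => //.
  + by move=> z _; exact: heat_integrand_ge0 tf.
  + exact: measurable_heat_integrand tf.
  + by apply/measurable_EFinP; apply: measurable_funM => //; exact: tf.1.
  + move=> z _; rewrite -EFinM lee_fin heat_kernelE ler_wpM2r ?(test_ge0 _ tf)//.
    by rewrite ler_piMr ?powR_ge0 ?gauss_le1.
- by apply/measurable_EFinP; exact: tf.1.
- by move=> z _; rewrite lee_fin (test_ge0 _ tf).
- by rewrite lee_fin powR_ge0.
Qed.

(** By [gauss_split] around [x], the kernel is at least a factor in [y] alone times a factor in [z],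
    and the latter is at least [e^(-K/r)] on the support of [f]. For [r] large and [y] much closer
    to [x] than [sqrt r], this matches [heat_le_integral]. *)
Lemma heat_ge_integral (K r : R) x y : 0 < r ->
  (forall z, f z != 0 -> \sum_i (z 0 i - x 0 i) ^+ 2 <= K) ->
  (2 * pi * r) `^ (- (d%:R / 2)) * (gauss (r / 2) x y * expR (- (K / r))) * (\int[L]_z f z)
    <= heat r f y.
Proof.
move=> r0 fK; rewrite -lee_fin (heat_integral _ r0 tf) EFinM -dominated_EFin.
rewrite -ge0_integralZl//.
- apply: ge0_le_integral => //.
  + move=> z _; rewrite -EFinM lee_fin mulr_ge0 ?(test_ge0 _ tf)//.
    by apply: mulr_ge0; [exact: powR_ge0|apply: mulr_ge0; [exact: gauss_ge0|exact: expR_ge0]].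
  + by apply/measurable_EFinP; apply: measurable_funM => //; exact: tf.1.
  + exact: measurable_heat_integrand tf.
  + move=> z _; rewrite -EFinM lee_fin heat_kernelE.
    have [->|fz0] := eqVneq (f z) 0; first by rewrite !mulr0.
    rewrite ler_wpM2r ?(test_ge0 _ tf)// ler_wpM2l ?powR_ge0//.
    apply: le_trans (gauss_split x y z r0); rewrite ler_wpM2l ?gauss_ge0//.
    rewrite ler_expR mulNr lerN2 (_ : 2 * (r / 2) = r); last by field.
    by rewrite ler_wpM2r ?invr_ge0 ?(ltW r0)//; exact: fK.
- by apply/measurable_EFinP; exact: tf.1.
- by move=> z _; rewrite lee_fin (test_ge0 _ tf).
- by rewrite lee_fin; apply: mulr_ge0; [exact: powR_ge0|apply: mulr_ge0; [exact: gauss_ge0|exact: expR_ge0]].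
Qed.

(** Both [f] and [heat r f] lie between 0 and [C * gauss 2 0], the variance of the majorant being
    [1 + r <= 2] after time [r]. *)
Lemma heat_sub_le_gauss2 r y : 0 <= r <= 1 -> `|heat r f y - f y| <= C * gauss 2 0 y.
Proof.
move=> /andP[r0 r1]; have f0 := test_ge0 y tf.
have h0 := test_ge0 y (test_heat r0 tf).
have g12 : gauss 1 0 y <= gauss 2 0 y by apply: le_gauss => //; lra.
have h1 : heat r f y <= C * gauss 2 0 y.
  have tg : test (C * 1) (fun z => C * gauss 1 0 z) by apply: testZ => //; exact: test_gauss.
  apply: (le_trans (le_heat _ r0 tf tg fC)).
  rewrite (heatZ _ r0 C0 (test_gauss 0 ltr01)) ler_wpM2l// heat_gauss//.
  apply: (@le_trans _ _ (1 * gauss (1 + r) 0 y)).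
    apply: ler_wpM2r; first exact: gauss_ge0.
    have a01 : 0 <= 1 / (1 + r) <= 1 by rewrite divr_ge0 ?ler_pdivrMr//=; lra.
    by apply: le_trans (le_powRl _ a01) _; rewrite ?divr_ge0// powR1.
  by rewrite mul1r; apply: le_gauss; lra.
have f1 : f y <= C * gauss 2 0 y by apply: le_trans (fC y) _; exact: ler_wpM2l.
by rewrite ler_norml; apply/andP; split; lra.
Qed.

Hypothesis uc : forall e, 0 < e ->
  exists2 D, 0 <= D & forall y z, `|f z - f y| <= e + D * (1 - gauss 1 y z).

(** The modulus of continuity is written with [1 - gauss 1 y z] because [heat] acts on it in closed
    form: the error at [y] is at most [e / 2 + D (1 - (1 + r)^(-d/2))], hence at most
    [e / 2 + D d r]. *)
Lemma heat_sub_le_cst e : 0 < e ->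
  exists2 eta, 0 < eta <= 1 & forall r y, 0 <= r <= eta -> `|heat r f y - f y| <= e.
Proof.
move=> e0; have e20 : 0 < e / 2 by rewrite divr_gt0.
have [D D0 uD] := uc e20.
have K0 : 0 < D * d%:R + 1 by rewrite ltr_wpDl// mulr_ge0.
(* Ensures [D d r <= e / 2]; the added 1 covers the case [D d = 0]. *)
exists (Num.min 1 (e / 2 / (D * d%:R + 1))).
  by rewrite lt_min ltr01 divr_gt0//= ge_min lexx.
move=> r y /andP[r0]; rewrite le_min => /andP[r1 re].
have reD : D * d%:R * r <= e / 2.
  by move: re; rewrite ler_pdivlMr// mulrDr mulr1; nra.
have tg : test (D * 1) (fun z => D * gauss 1 y z) by apply: testZ => //; exact: test_gauss.
have hg : heat r (fun z => D * gauss 1 y z) y = D * (1 / (1 + r)) `^ (d%:R / 2).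
  by rewrite (heatZ _ r0 D0 (test_gauss y ltr01)) heat_gauss// gauss_center mulr1.
have a01 : 0 <= 1 / (1 + r) <= 1.
  by rewrite divr_ge0 ?ler_pdivrMr//=; lra.
have := powR_half_ge a01; set a := _ `^ _ in hg *.
have -> : 1 - 1 / (1 + r) = r / (1 + r) by field; lra.
move=> ha.
have ra : r / (1 + r) <= r by rewrite ler_pdivrMr; nra.
have hD : D * (1 - a) <= e / 2.
  apply: le_trans reD; rewrite -mulrA ler_wpM2l//.
  have : d%:R * (r / (1 + r)) <= d%:R * r by rewrite ler_wpM2l.
  lra.
have f0 := test_ge0 y tf; have M0 := test_bound_ge0 tf.
have tc1 : test (f y + e / 2 + D) (cst (f y + e / 2 + D) : V -> R).
  by apply: test_cst; rewrite !addr_ge0// ltW.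
have tc2 : test (e / 2 + D) (cst (e / 2 + D) : V -> R).
  by apply: test_cst; rewrite addr_ge0// ltW.
(* Terms are moved across the inequality so that [heat] is applied to non-negative functions
   only. *)
have up : heat r f y + D * a <= f y + e / 2 + D.
  rewrite -hg -(heatD _ r0 tf tg) -[leRHS](heat_cst y r0 (test_bound_ge0 tc1)).
  apply: (le_heat _ r0 (testD tf tg) tc1) => z /=.
  by have := uD y z; rewrite ler_norml; lra.
have lo : f y + D * a <= heat r f y + (e / 2 + D).
  rewrite -hg -{1}(heat_cst y r0 (test_bound_ge0 tc2)) -(heatD _ r0 tf tc2).
  rewrite -{1}(heat_cst y r0 f0) -(heatD _ r0 (test_cst f0) tg).
  apply: (le_heat _ r0 (testD (test_cst f0) tg) (testD tf tc2)) => z /=.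
  by have := uD y z; rewrite ler_norml; lra.
by rewrite ler_norml; apply/andP; split; nra.
Qed.

(* The geometric mean of the uniform bound and of the Gaussian bound. *)
Lemma heat_sub_le_gauss4 e : 0 < e ->
  exists2 eta, 0 < eta <= 1 & forall r y, 0 <= r <= eta ->
    `|heat r f y - f y| <= e * gauss 4 0 y.
Proof.
(* Multiplied by [C * gauss 2 0 y], this is at most [(e * gauss 4 0 y) ^+ 2]: squaring a [gauss]
   halves its variance. *)
move=> e0; have e'0 : 0 < e ^+ 2 / (C + 1).
  by rewrite divr_gt0 ?exprn_gt0// ltr_wpDl.
have [eta /andP[eta0 eta1] H] := heat_sub_le_cst e'0.
exists eta; first by rewrite eta0.
move=> r y /andP[r0 re].
have h1 : `|heat r f y - f y| <= e ^+ 2 / (C + 1) by apply: H; rewrite r0.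
have h2 : `|heat r f y - f y| <= C * gauss 2 0 y.
  by apply: heat_sub_le_gauss2; rewrite r0 (le_trans re).
rewrite -(@ler_sqr _ `|_|) ?nnegrE// ?mulr_ge0 ?gauss_ge0 ?(ltW e0)//.
rewrite expr2; apply: (le_trans (ler_pM _ _ h1 h2)) => //.
rewrite exprMn (_ : 4 = 2 * 2 :> R); last by ring.
rewrite gauss_sqr// mulrA ler_wpM2r ?gauss_ge0// -mulrA ler_piMr ?sqr_ge0//.
rewrite mulrC ler_pdivrMr; [lra|by rewrite ltr_wpDl].
Qed.

End dominated.

(** The ratio [4 / (4 + r)] in [heat_gauss] is smallest at [r = 1], which gives [4 / 5]; widening
    the Gaussian only helps. *)
Lemma heat_gauss4_ge r y : 0 <= r <= 1 ->
  (4 / 5) `^ (d%:R / 2) * gauss 4 0 y <= heat r (gauss 4 0) y.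
Proof.
move=> /andP[r0 r1]; rewrite heat_gauss//; apply: ler_pM; rewrite ?powR_ge0 ?gauss_ge0//.
- apply: le_powRl; rewrite ?divr_ge0//=.
  by rewrite ler_pdivlMr; lra.
- by apply: le_gauss; lra.
Qed.

(** Counterpart of [heat_le_integral] for a Gaussian wider than [gauss 1 0]; the last factor is the
    integral of [gauss 4 0]. *)
Lemma heat_gauss4_le r y : 0 < r ->
  heat r (gauss 4 0) y <= (2 * pi * r) `^ (- (d%:R / 2)) * (2 * pi * 4) `^ (d%:R / 2).
Proof.
move=> r0; rewrite heat_gauss ?(ltW r0)//.
rewrite powRN -ler_pdivrMl ?invr_gt0 ?powR_gt0 ?mulr_gt0 ?pi_gt0// invrK.
rewrite mulrA -powRM ?divr_ge0 ?mulr_ge0 ?pi_ge0 ?(ltW r0)//; last by lra.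
apply: (@le_trans _ _ ((2 * pi * r * (4 / (4 + r))) `^ (d%:R / 2) * 1)).
  by rewrite ler_wpM2l ?powR_ge0// gauss_le1//; lra.
rewrite mulr1; apply: le_powRl; first by rewrite divr_ge0.
have p0 := @pi_ge0 R; have h : 0 <= 4 / (4 + r) by rewrite divr_ge0//; lra.
apply/andP; split; first by apply: mulr_ge0 => //; apply: mulr_ge0; [exact: mulr_ge0|exact: ltW].
rewrite mulrA ler_pdivrMr; last lra.
nra.
Qed.

End heat_estimates.

(** * Continuous functions with compact support *)

Section compact_support.
Context {R : realType} {d : nat}.
Local Notation V := 'rV[R]_d.
Variable f : V -> R.
Hypotheses (cf : continuous f) (sf : compact (closure [set y | f y != 0])).

Let K := closure [set y | f y != 0].

Let f_out y : ~ K y -> f y = 0.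
Proof. by move=> nK; apply/eqP; apply: contrapT => fy; apply: nK; apply: subset_closure; exact/negP. Qed.

Lemma compact_upper_bound (g : V -> R) : continuous g -> exists B, forall y, K y -> g y <= B.
Proof.
move=> cg; have /compact_bounded [B [Br HB]] : compact (g @` K).
  apply: continuous_compact => //; exact: continuous_subspaceT.
exists (B + 1) => y Ky; apply: le_trans (ler_norm _) _; apply: HB; first by rewrite ltrDl.
by exists y.
Qed.

Lemma compact_support_bounded : exists2 M, 0 <= M & forall y, `|f y| <= M.
Proof.
have cn : continuous (fun y => `|f y|).
  by move=> y; apply: continuous_comp; [exact: cf|exact: norm_continuous].
have [B HB] := compact_upper_bound cn.
exists (Num.max B 0); first by rewrite le_max lexx orbT.
move=> y; have [Ky|nK] := pselect (K y); first by rewrite le_max HB.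
by rewrite (f_out nK) normr0 le_max lexx orbT.
Qed.

Lemma compact_support_radius (x : V) : exists2 r, 0 <= r &
  forall y, f y != 0 -> \sum_i (y 0 i - x 0 i) ^+ 2 <= r.
Proof.
have cn := @continuous_sqdist R d x.
have [B HB] := compact_upper_bound cn.
exists (Num.max B 0); first by rewrite le_max lexx orbT.
by move=> y fy; rewrite le_max HB//; exact: subset_closure.
Qed.

(** The near-covering form of compactness yields one [dl] for all [y] in [K]. The conclusion is
    symmetric in [y] and [z], and if neither lies in [K] both values vanish. *)
Lemma compact_support_uc (e : R) : 0 < e -> exists2 dl, 0 < dl &
  forall y z, ball y dl z -> `|f z - f y| <= e.
Proof.
move=> e0.
have H : \forall dl \near 0^'+, K `<=` (fun y => forall z, ball y dl z -> `|f z - f y| <= e).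
  apply: ((compact_near_coveringP _).1 sf) => x Kx.
  have /cvgrPdist_lt Hx := @cf x; have e20 : 0 < e / 2 by rewrite divr_gt0.
  have /nbhs_ballP[rho /= rho0 Hr] := Hx _ e20.
  exists (ball x (rho / 2), [set dl | dl < rho / 2]); first split => /=.
  - by apply: nbhsx_ballx; rewrite divr_gt0.
  - by apply: nbhs_right_lt; rewrite divr_gt0.
  move=> [y dl] /= [xy dlr] z yz.
  have hz : ball x rho z by apply: (ball_split xy); apply: le_ball yz; exact: ltW.
  have hy : ball x rho y by apply: le_ball xy; rewrite ler_pdivrMr// ler_pMr// ler1n.
  have := Hr _ hz; have := Hr _ hy => /= a b.
  rewrite (_ : f z - f y = (f x - f y) - (f x - f z)); last by ring.
  apply: (le_trans (ler_normB _ _)).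
  by rewrite (splitr e) lerD// ltW.
have : \forall dl \near 0^'+, 0 < dl /\ (K `<=` (fun y => forall z, ball y dl z -> `|f z - f y| <= e)).
  by near=> dl; split; [near: dl; exact: nbhs_right_gt|near: dl; exact: H].
move=> /filter_ex [dl [dl0 Hdl]]; exists dl => // y z yz.
have [Ky|nKy] := pselect (K y); first exact: Hdl.
have [Kz|nKz] := pselect (K z); first by rewrite distrC; apply: Hdl => //; exact: ball_sym.
by rewrite !f_out// subrr normr0 ltW.
Unshelve. all: by end_near. Qed.

(** Within sup-distance [dl] the term [e] suffices. Otherwise some coordinate differs by at least
    [dl], so [1 - gauss 1 y z] is at least [1 - e^(-dl^2/2)], and [D] is chosen to lift this to
    [M]. *)
Lemma compact_support_modulus (e : R) : (forall y, 0 <= f y) -> 0 < e ->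
  exists2 D, 0 <= D & forall y z, `|f z - f y| <= e + D * (1 - gauss 1 y z).
Proof.
move=> f0 e0; have [dl dl0 H] := compact_support_uc e0.
have [M M0 HM] := compact_support_bounded.
have q0 : 0 < 1 - expR (- (dl ^+ 2) / 2).
  by rewrite subr_gt0 -[ltRHS]expR0 ltr_expR mulNr oppr_lt0 divr_gt0 ?exprn_gt0.
have D0 : 0 <= M / (1 - expR (- (dl ^+ 2) / 2)) by rewrite divr_ge0// ltW.
exists (M / (1 - expR (- (dl ^+ 2) / 2))) => // y z.
have g0 : 0 <= 1 - gauss 1 y z by rewrite subr_ge0 gauss_le1.
have [yz|nyz] := pselect (ball y dl z).
  by apply: (le_trans (H _ _ yz)); rewrite lerDl mulr_ge0.
have [i hi] : exists i, dl <= `|z 0 i - y 0 i|.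
  apply: contrapT => /forallNP h; apply: nyz; split=> // i j.
  by rewrite ord1 /ball /= distrC ltNge; exact/negP.
have gd : gauss 1 y z <= expR (- (dl ^+ 2) / 2).
  rewrite ler_expR mulr1 ler_wpM2r// lerN2 (bigD1 i)//=.
  apply: ler_wpDr; first by apply: sumr_ge0 => j _; exact: sqr_ge0.
  by rewrite -[leRHS]real_normK ?num_real// ler_sqr ?nnegrE// ltW.
have fM : `|f z - f y| <= M.
  have := HM z; have := HM y; have := f0 z; have := f0 y.
  by rewrite !ler_norml => ? ? /andP[? ?] /andP[? ?]; apply/andP; split; lra.
apply: (le_trans fM); apply: ler_wpDl; first exact: ltW.
rewrite -mulrA ler_peMr// ler_pdivlMl//; lra.
Qed.

Lemma compact_support_dominated : exists2 C, 0 <= C & forall y, f y <= C * gauss 1 0 y.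
Proof.
have [M M0 HM] := compact_support_bounded.
have [r r0 Hr] := compact_support_radius 0.
(* On the support of [f], [gauss 1 0] is at least [e^(-r/2)]. *)
exists (M * expR (r / 2)); first by rewrite mulr_ge0// expR_ge0.
move=> y; have [->|fy] := eqVneq (f y) 0.
  by rewrite !mulr_ge0 ?expR_ge0 ?gauss_ge0.
apply: (le_trans (ler_norm _)); apply: (le_trans (HM y)).
rewrite -mulrA ler_peMr// /gauss -expRD -[leLHS]expR0 ler_expR.
by have := Hr y fy; lra.
Qed.

End compact_support.

(** * Almost sure estimates *)

Section summable_events.
Context {R : realType}.

(** With [N = K + 2], [e^(gam m)] is at least [(1 + gam m / N)^N], and [1 + gam m / N >= c (m + 1)]
    by the choice of [c]. *)
Lemma poly_expRN_le (gam : R) (K : nat) : 0 < gam ->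
  exists2 C, 0 <= C & forall m : nat,
    m.+1%:R ^+ K * expR (- (gam * m%:R)) <= C / m.+1%:R ^+ 2.
Proof.
move=> g0; pose N := K.+2; have N0 : 0 < N%:R :> R by rewrite ltr0n.
pose c := Num.min 1 (gam / N%:R).
have c0 : 0 < c by rewrite lt_min ltr01 divr_gt0.
exists (c^-1 ^+ N); first by rewrite exprn_ge0// invr_ge0 ltW.
move=> m; have m0 : 0 < m.+1%:R :> R by rewrite ltr0n.
rewrite ler_pdivlMr ?exprn_gt0// mulrAC -exprD addn2 expRN ler_pdivrMr ?expR_gt0//.
rewrite exprVn ler_pdivlMl ?exprn_gt0// -exprMn.
have -> : expR (gam * m%:R) = expR (gam * m%:R / N%:R) ^+ N.
  by rewrite -expRM_natl; congr expR; field; rewrite gt_eqF.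
rewrite ler_pXn2r ?nnegrE ?expR_ge0//; last by rewrite mulr_ge0 ?ltW.
apply: le_trans (expR_ge1Dx _); rewrite -natr1 mulrDr mulr1 addrC lerD//.
  by rewrite /c ge_min lexx.
by rewrite mulrAC ler_wpM2r// /c ge_min lexx orbT.
Qed.

Lemma sum_invn2_le n : \sum_(i < n) (i.+1%:R ^+ 2)^-1 <= 2 :> R.
Proof.
suff H k : \sum_(i < k.+1) (i.+1%:R ^+ 2)^-1 <= 2 - k.+1%:R^-1 :> R.
  case: n => [|n]; first by rewrite big_ord0.
  by apply: (le_trans (H n)); rewrite gerBl invr_ge0.
elim: k => [|k IH]; first by rewrite big_ord_recr big_ord0/= expr1n invr1 add0r; lra.
rewrite big_ord_recr/=; apply: (le_trans (lerD IH (lexx _))).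
have k0 : 0 < k.+1%:R :> R by [].
have -> : k.+2%:R = k.+1%:R + 1 :> R by rewrite natr1.
set a := k.+1%:R in k0 *.
rewrite -subr_ge0 (_ : _ - _ = (a * (a + 1) ^+ 2)^-1); last first.
  by field; rewrite !gt_eqF// ltr_wpDl// ltW.
by rewrite invr_ge0 mulr_ge0 ?exprn_ge0// ltW// ltr_wpDl// ltW.
Qed.

Context d (T : measurableType d) (P : probability T R).

(** Borel-Cantelli with an explicit summable rate. *)
Lemma ae_eventually_notin (E : nat -> set T) (C : R) : (forall n, measurable (E n)) -> 0 <= C ->
  (forall n, P (E n) <= (C / n.+1%:R ^+ 2)%:E)%E ->
  {ae P, forall w, exists n0, forall n, (n0 <= n)%N -> ~ E n w}.
Proof.
move=> mE C0 PE; exists (lim_sup_set E); split.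
- by apply: bigcap_measurable => // n _; apply: bigcup_measurable => k _; exact: mE.
- apply: lim_sup_set_cvg0 => //; apply: (@le_lt_trans _ _ (C * 2)%:E); last exact: ltry.
  apply: lime_le; first exact: is_cvg_nneseries.
  apply: nearW => n; rewrite big_mkord.
  apply: (@le_trans _ _ (\sum_(i < n) (C / i.+1%:R ^+ 2)%:E)%E).
    by apply: lee_sum => i _; exact: PE.
  by rewrite sumEFin lee_fin -mulr_sumr ler_wpM2l// sum_invn2_le.
- move=> w /= nw n _; apply: contrapT => h; apply: nw; exists n => k nk Ek.
  by apply: h; exists k.
Qed.

Lemma markov_le (Z : T -> R) (c lam : R) : measurable_fun setT Z -> (forall w, 0 <= Z w) -> 0 < lam ->
  (\int[P]_w (Z w)%:E <= c%:E)%E -> (P [set w | lam < Z w]%R <= (c / lam)%:E)%E.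
Proof.
move=> mZ Z0 l0 Zc.
have mA : measurable [set w | lam < Z w]%R.
  rewrite (_ : [set _ | _] = setT `&` Z @^-1` `]lam, +oo[%classic); first exact: mZ.
  by rewrite setTI; apply/seteqP; split => w /=; rewrite in_itv/= andbT.
rewrite EFinM muleC lee_pdivlMl//; apply: le_trans Zc.
rewrite -integral_cst//.
apply: (@le_trans _ _ (\int[P]_(w in [set w | lam < Z w]%R) (Z w)%:E)%E).
  apply: ge0_le_integral => //.
  - by move=> w _; rewrite lee_fin ltW.
  - by apply/measurable_EFinP; exact: measurable_funTS.
  - by move=> w /= lw; rewrite lee_fin ltW.
apply: ge0_subset_integral => //.
- exact/measurable_EFinP.
- by move=> w _; rewrite lee_fin.
Qed.

End summable_events.

(** * Almost sure control of the mass, its spread and the martingales *)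

Section almost_sure.
Context {R : realType} {d : nat} {disp : measure_display}
  {Omega : measurableType disp}.
Variables (X : R -> Omega -> finmeas R d) (P : finmeas R d -> probability Omega R).
Variables (alpha beta : R).
Hypotheses (alpha0 : 0 < alpha) (beta0 : 0 < beta).
Hypothesis sbm : super_brownian_motion X P alpha beta.
Local Notation V := 'rV[R]_d.
Implicit Types (nu mu : finmeas R d) (f : V -> R).

Lemma ctest1 : ctest 1 (cst 1 : V -> R).
Proof. by split; [exact: cst_continuous|move=> x; rewrite /= ler01 lexx]. Qed.

Lemma ctest_gauss (A : R) x : 0 < A -> ctest 1 (gauss A x : V -> R).
Proof.
by move=> A0; split; [exact: continuous_gauss|move=> y; rewrite gauss_ge0 gauss_le1].
Qed.

Lemma disc_mass T t w : t <= T -> disc X beta (cst 1) T t w = mass_martingale X beta t w.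
Proof.
move=> tT; rewrite /disc /mass_martingale; congr (_ * _).
by apply: eq_Rintegral => y _; rewrite heat_cst ?subr_ge0.
Qed.

(** [disc_maximal] on [[m, m + 1]] for the constant function 1, which [heat] preserves. The level
    [1 / (m + 1)^2] is summable, and dividing by it costs a polynomial factor against
    [e^(-beta m / 2)]. *)
Lemma ae_mass_increments mu : {ae P mu, forall w, exists n0, forall m, (n0 <= m)%N ->
  forall k i, (i <= 2 ^ k)%N ->
  `|mass_martingale X beta (grid m%:R m.+1%:R k i) w - mass_martingale X beta m%:R w|
    <= (m.+1%:R ^+ 2)^-1}.
Proof.
have K0 : 0 <= 1 + 4 * alpha * pairing mu (cst 1).
  by rewrite addr_ge0// mulr_ge0 ?(pairing_ge0 _ (test_cst ler01))// mulr_ge0// ltW.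
have b20 : 0 < beta / 2 by rewrite divr_gt0.
have [C C0 HC] := poly_expRN_le 2 b20.
have mm (m : nat) : 0 <= (m%:R : R) <= m.+1%:R by rewrite ler0n ler_nat leqnSn.
have l0 (m : nat) : 0 < (m.+1%:R ^+ 2)^-1 :> R by rewrite invr_gt0 exprn_gt0.
have H m := disc_maximal alpha0 beta0 sbm mu ctest1 (mm m) (l0 m).
pose E m := projT1 (cid (H m)).
have mE m : measurable (E m) by rewrite /E; case: cid => ? [].
have PE m : (P mu (E m) <= (C * (1 + 4 * alpha * pairing mu (cst 1)) / m.+1%:R ^+ 2)%:E)%E.
  rewrite /E; case: cid => A [_ PA _] /=; apply: le_trans PA _; rewrite lee_fin.
  have -> : m.+1%:R - m%:R = 1 :> R by rewrite -natr1 addrC addKr.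
  rewrite invrK expr1n !mulr1; have := HC m.
  rewrite (_ : - (beta * m%:R) / 2 = - (beta / 2 * m%:R)); last by field.
  set a := _ ^+ 2; set e := expR _; set q := 1 + _ => h.
  have e0 : 0 <= a * e by rewrite mulr_ge0 ?expR_ge0// sqr_ge0.
  apply: (@le_trans _ _ (a * e * q)).
    have : 0 <= a * e * q by rewrite mulr_ge0.
    by rewrite (_ : e * q / 2 * a = a * e * q / 2); [lra|field].
  by rewrite [leRHS]mulrAC ler_wpM2r.
have C'0 : 0 <= C * (1 + 4 * alpha * pairing mu (cst 1)) by rewrite mulr_ge0.
have := ae_eventually_notin mE C'0 PE; apply: filterS => w [n0 Hn]; exists n0 => m nm k i ik.
have := Hn m nm; rewrite /E; case: cid => A [_ _ HA] /= /HA /(_ k i ik).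
have mle : m%:R <= m.+1%:R :> R by rewrite ler_nat.
have /andP[_ g1] := grid_itv mle ik.
by rewrite !disc_mass.
Qed.

(** The left-hand side is the discounted pairing with [1 - gauss A x]. From a unit mass at [x] its
    mean is [1 - (A / (A + m))^(d/2)], at most [4 d / m^3], and Markov's inequality at level [1 / m]
    leaves a summable [4 d / m^2]. *)
Lemma ae_spread x : {ae P (\d_x : finmeas R d), forall w, exists n0, forall n, (n0 <= n)%N ->
  mass_martingale X beta n.+2%:R w -
  expR (- (beta * n.+2%:R)) * pairing (X n.+2%:R w) (gauss ((n.+2%:R ^+ 4 - n.+2%:R) / 2) x) <= n.+2%:R^-1}.
Proof.
(* The shift to [m >= 2] keeps [A] positive; it would vanish at [m = 1]. *)
pose m n : R := n.+2%:R; pose A n : R := (m n ^+ 4 - m n) / 2.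
have m2 n : 2 <= m n by rewrite /m ler_nat.
have A4 n : m n ^+ 4 / 4 <= A n.
  have : 2 ^+ 3 <= m n ^+ 3 by rewrite ler_pXn2r ?nnegrE//; exact: le_trans (m2 n).
  by rewrite /A; have := m2 n; nra.
have m0 n : 0 < m n by exact: lt_le_trans (m2 n).
have A0 n : 0 < A n by apply: lt_le_trans (A4 n); rewrite divr_gt0// exprn_gt0.
pose h n (y : V) := 1 - gauss (A n) x y.
have ch n : ctest 1 (h n).
  split.
    have hc (y : V) : h n @ y --> h n y by exact: (cvgB (cvg_cst _) (@continuous_gauss R d (A n) x y)).
    by move=> y; exact: hc.
  by move=> y; rewrite subr_ge0 gauss_le1//= gerBl gauss_ge0.
have th n := ctest_test (ch n).
have tg n := ctest_test (ctest_gauss x (A0 n)).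
have hx n : heat (m n) (h n) x <= 4 * d%:R / m n ^+ 3.
  have E : heat (m n) (h n) x + heat (m n) (gauss (A n) x) x = 1.
    rewrite -(heatD _ (ltW (m0 n)) (th n) (tg n)) -[RHS](heat_cst x (ltW (m0 n)) ler01).
    by congr heat; apply/funext => y; rewrite /h subrK.
  have a01 : 0 <= A n / (A n + m n) <= 1.
    have Am : 0 < A n + m n by rewrite addr_gt0.
    by rewrite divr_ge0 ?(ltW (A0 n)) ?(ltW Am)//= ler_pdivrMr// mul1r lerDl ltW.
  move: E; rewrite heat_gauss ?(ltW (m0 n))// gauss_center mulr1 => E.
  have := powR_half_ge (d := d) a01.
  have am : 1 - A n / (A n + m n) <= 4 / m n ^+ 3.
    have -> : 1 - A n / (A n + m n) = m n / (A n + m n) by field; rewrite gt_eqF// addr_gt0.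
    rewrite ler_pdivrMr ?addr_gt0// mulrAC ler_pdivlMr ?exprn_gt0//.
    have := A4 n; have := m0 n; rewrite (_ : m n * m n ^+ 3 = m n ^+ 4); last by ring.
    lra.
  have := ler_wpM2l (ler0n R d) am.
  rewrite (_ : d%:R * (4 / m n ^+ 3) = 4 * d%:R / m n ^+ 3); last by ring.
  have -> : heat (m n) (h n) x = 1 - (A n / (A n + m n)) `^ (d%:R / 2).
    by apply/eqP; rewrite eq_sym subr_eq E.
  by move=> u v; apply: le_trans u; rewrite lerBlDr -lerBlDl.
pose Z n w := expR (- (beta * m n)) * pairing (X (m n) w) (h n).
have Z0 n w : 0 <= Z n w by rewrite mulr_ge0 ?expR_ge0// (pairing_ge0 _ (th n)).
have mZ n : measurable_fun setT (Z n).
  by apply: measurable_funM => //; exact: (measurable_pairing_state sbm (ch n) (ltW (m0 n))).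
have EZ n : (\int[P (\d_x : finmeas R d)]_w (Z n w)%:E <= (4 * d%:R / m n ^+ 3)%:E)%E.
  rewrite /Z; under eq_integral do rewrite EFinM.
  rewrite ge0_integralZl//.
  - rewrite (first_moment alpha0 beta0 sbm _ (ch n) (ltW (m0 n))) -EFinM lee_fin.
    rewrite mulrA -expRD addNr expR0 mul1r (pairing_dirac _ (test_heat (ltW (m0 n)) (th n))).
    exact: hx.
  - by apply/measurable_EFinP; exact: (measurable_pairing_state sbm (ch n) (ltW (m0 n))).
  - by move=> w _; rewrite lee_fin (pairing_ge0 _ (th n)).
have im n : 0 < (m n)^-1 by rewrite invr_gt0.
pose E n := [set w | (m n)^-1 < Z n w].
have mE n : measurable (E n).
  rewrite (_ : E n = setT `&` Z n @^-1` `](m n)^-1, +oo[%classic); first exact: mZ.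
  by rewrite setTI; apply/seteqP; split => w /=; rewrite in_itv/= andbT.
have PE n : (P (\d_x : finmeas R d) (E n) <= (4 * d%:R / n.+1%:R ^+ 2)%:E)%E.
  apply: (le_trans (markov_le (mZ n) (Z0 n) (im n) (EZ n))); rewrite lee_fin invrK.
  have -> : 4 * d%:R / m n ^+ 3 * m n = 4 * d%:R / m n ^+ 2 by field; rewrite gt_eqF.
  rewrite ler_wpM2l ?mulr_ge0// lef_pV2 ?posrE ?exprn_gt0// ler_pXn2r ?nnegrE//.
  by rewrite /m ler_nat.
have d0 : 0 <= 4 * d%:R :> R by rewrite mulr_ge0.
have := ae_eventually_notin mE d0 PE; apply: filterS => w [n0 Hn]; exists n0 => n nn.
have /negP := Hn n nn; rewrite -leNgt; apply: le_trans.
rewrite /Z /mass_martingale -mulrBr ler_wpM2l ?expR_ge0// lerBlDr.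
rewrite -(pairingD _ (th n) (tg n)) le_eqVlt; apply/orP; left; apply/eqP.
by apply: eq_Rintegral => y _; rewrite /h subrK.
Qed.

(* Right end of the [j]-th subblock, of length [1/m], of [m^4, (m+1)^4[; there are
   fewer than [(m+1)^5] of them. *)
Definition block_end (m j : nat) : R := m%:R ^+ 4 + j.+1%:R / m%:R.

(** [disc_maximal] on each [[m, T]] at level [m^(-1) T^(-d/2)], a union bound over the subblocks of
    one block, then Borel-Cantelli over the blocks. *)
Lemma ae_fluctuation mu M f : ctest M f ->
  {ae P mu, forall w, exists n0, forall n, (n0 <= n)%N ->
  forall j, (j < n.+3 ^ 5)%N -> forall k i, (i <= 2 ^ k)%N ->
  block_end n.+2 j `^ (d%:R / 2) *
  `|disc X beta f (block_end n.+2 j) (grid n.+2%:R (block_end n.+2 j) k i) w -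
    disc X beta f (block_end n.+2 j) n.+2%:R w| <= n.+2%:R^-1}.
Proof.
move=> cf; have tf := ctest_test cf.
pose K : R := 1 + 4 * alpha * M ^+ 2 * pairing mu (cst 1).
have p0 : 0 <= 4 * alpha * M ^+ 2 * pairing mu (cst 1).
  have a4 : 0 <= 4 * alpha by rewrite mulr_ge0// ltW.
  apply: mulr_ge0; last exact: (pairing_ge0 _ (test_cst ler01)).
  by apply: mulr_ge0 => //; exact: sqr_ge0.
have K0 : 0 <= K by rewrite addr_ge0.
have b20 : 0 < beta / 2 by rewrite divr_gt0.
(* Powers of [m + 1] to absorb: 5 for the number of subblocks, 6 for the factor [T - m] of the
   variance, 1 for the level [1 / m], and [6 d] from [T^(d/2) <= T^d], with the crude
   [T <= (m + 1)^6]. *)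
have [C C0 HC] := poly_expRN_le (12 + 6 * d) b20.
pose T n j := block_end n.+2 j.
have T16 n j : 1 <= T n j.
  rewrite /T /block_end; apply: ler_wpDr; first by rewrite divr_ge0.
  by rewrite exprn_ege1// ler1n.
have sT n j : 0 <= (n.+2%:R : R) <= T n j.
  rewrite ler0n/= /T /block_end; apply: ler_wpDr; first by rewrite divr_ge0.
  by rewrite ler_eXnr// ler1n.
have Tub n j : (j < n.+3 ^ 5)%N -> T n j <= n.+3%:R ^+ 6.
  move=> jn; rewrite /T /block_end.
  have : j.+1%:R / n.+2%:R <= n.+3%:R ^+ 5 :> R.
    rewrite ler_pdivrMr//; apply: (@le_trans _ _ (n.+3%:R ^+ 5)).
      by rewrite -natrX ler_nat.
    by rewrite ler_peMr ?exprn_ge0// ler1n.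
  have : n.+2%:R ^+ 4 <= n.+3%:R ^+ 4 :> R by rewrite ler_pXn2r ?nnegrE// ler_nat.
  have h3 : 3 <= n.+3%:R :> R by rewrite ler_nat.
  rewrite (_ : n.+3%:R ^+ 6 = n.+3%:R ^+ 4 * n.+3%:R ^+ 2); last by rewrite -exprD.
  rewrite (_ : n.+3%:R ^+ 5 = n.+3%:R ^+ 4 * n.+3%:R); last by rewrite -exprSr.
  have : 1 <= n.+3%:R ^+ 4 :> R by rewrite exprn_ege1// ler1n.
  set a := n.+3%:R ^+ 4; set b := n.+3%:R in h3 *; move=> a1 h4 h5.
  have h6 : a * (1 + b) <= a * b ^+ 2 by rewrite ler_pM2l; nra.
  by apply: le_trans h6; rewrite mulrDr mulr1 lerD.
have Tp0 n j : 0 < T n j `^ (d%:R / 2) by rewrite powR_gt0// (lt_le_trans _ (T16 n j)).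
have l0 n j : 0 < n.+2%:R^-1 / T n j `^ (d%:R / 2) by rewrite divr_gt0// invr_gt0.
have H n j := disc_maximal alpha0 beta0 sbm mu cf (sT n j) (l0 n j).
pose F n j := projT1 (cid (H n j)).
have mF n j : measurable (F n j) by rewrite /F; case: cid => ? [].
have PF n j : (j < n.+3 ^ 5)%N -> (P mu (F n j) <= (n.+3%:R ^+ (7 + 6 * d) * K * expR (- (beta / 2 * n.+2%:R)))%:E)%E.
  move=> jn; rewrite /F; case: cid => A [_ PA _] /=; apply: le_trans PA _; rewrite lee_fin.
  rewrite (_ : - (beta * n.+2%:R) / 2 = - (beta / 2 * n.+2%:R)); last by field.
  set e := expR _; set a : R := n.+3%:R; have e0 : 0 <= e by exact: expR_ge0.
  have a1 : 1 <= a by rewrite ler1n.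
  have Td : T n j `^ (d%:R / 2) <= a ^+ (6 * d).
    apply: (@le_trans _ _ (T n j `^ d%:R)).
      by apply: ler_powR => //; rewrite ler_pdivrMr// ler_peMr// ler1n.
    rewrite powR_mulrn; last exact: le_trans (T16 n j).
    have T0 : 0 <= T n j by exact: le_trans (T16 n j).
    have a0 : 0 <= a by exact: le_trans a1.
    by rewrite exprM; apply: lerXn2r; rewrite ?nnegrE ?exprn_ge0//; exact: Tub.
  rewrite invf_div invrK.
  have Q : (1 + 4 * alpha * M ^+ 2 * (T n j - n.+2%:R) * pairing mu (cst 1)) / 2 <= K * a ^+ 6.
    have h := Tub n j jn; have a6 : 1 <= a ^+ 6 by rewrite exprn_ege1.
    have s0 : 0 <= n.+2%:R :> R by [].
    rewrite (_ : _ * (T n j - _) * _ = (4 * alpha * M ^+ 2 * pairing mu (cst 1)) * (T n j - n.+2%:R)); last by ring.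
    rewrite /K; move: p0; set p := 4 * alpha * M ^+ 2 * _ => p0.
    have : p * (T n j - n.+2%:R) <= p * a ^+ 6 by rewrite ler_wpM2l// -/a; lra.
    have : 0 <= p * a ^+ 6 by rewrite mulr_ge0//; lra.
    lra.
  rewrite exprD (_ : a ^+ 7 = a ^+ 6 * a); last by rewrite -exprSr.
  rewrite (_ : _ * K * e = (e * (K * a ^+ 6)) * (a ^+ (6 * d) * a)); last by ring.
  have Ka : 0 <= K * a ^+ 6 by rewrite mulr_ge0// exprn_ge0//; lra.
  apply: ler_pM.
  - rewrite -mulrA mulr_ge0// divr_ge0// addr_ge0//.
    rewrite (_ : _ * (T n j - _) * _ = (4 * alpha * M ^+ 2 * pairing mu (cst 1)) * (T n j - n.+2%:R)); last by ring.
    by rewrite mulr_ge0// subr_ge0; have /andP[] := sT n j.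
  - by rewrite mulr_ge0// ltW.
  - by rewrite -mulrA ler_wpM2l.
  - by apply: ler_pM => //; [exact: ltW|rewrite /a ler_nat].
pose E n := \big[setU/set0]_(j < n.+3 ^ 5) F n j.
have mE n : measurable (E n) by apply: bigsetU_measurable.
have PE n : (P mu (E n) <= (C * K / n.+1%:R ^+ 2)%:E)%E.
  apply: (le_trans (@Boole_inequality _ _ _ (P mu) (F n) (n.+3 ^ 5) _)) => //.
  apply: (@le_trans _ _ (\sum_(j < n.+3 ^ 5) (n.+3%:R ^+ (7 + 6 * d) * K * expR (- (beta / 2 * n.+2%:R)))%:E)%E).
    by apply: lee_sum => j _; exact: PF.
  rewrite sumEFin lee_fin sumr_const card_ord -[leLHS]mulr_natl natrX.
  have := HC n.+2; rewrite (_ : (12 + 6 * d = 5 + (7 + 6 * d))%N); last by rewrite addnA.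
  rewrite (exprD _ 5 (7 + 6 * d)%N).
  set e := expR _; set a : R := n.+3%:R; set b := a ^+ 5; set c := a ^+ _ => h.
  rewrite (_ : b * (c * K * e) = (b * c * e) * K); last by ring.
  rewrite [leRHS]mulrAC ler_wpM2r//; apply: (le_trans h); rewrite ler_wpM2l//.
  have a0 : 0 < a by rewrite ltr0n.
  rewrite lef_pV2 ?posrE ?exprn_gt0//; apply: lerXn2r; rewrite ?nnegrE ?(ltW a0)//.
  by rewrite /a ler_nat; exact: leqW (leqnSn _).
have C'0 : 0 <= C * K by rewrite mulr_ge0.
have := ae_eventually_notin mE C'0 PE; apply: filterS => w [n0 Hn]; exists n0 => n nn j jn k i ik.
have : ~ F n j w.
  move=> Fw; apply: (Hn n nn); rewrite /E -bigcup_mkord; by exists j.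
rewrite /F; case: cid => A [_ _ HA] /= /HA /(_ k i ik).
by rewrite -/(T n j) ler_pdivlMr// mulrC.
Qed.

End almost_sure.

(** * From dyadic times to all times *)

Section right_continuity.
Context {R : realType}.

(** A level of mesh below [v - u], found from [k < 2 ^ k], and its first point beyond [u]. *)
Lemma grid_dense (s T u v : R) : s <= u -> u < v -> v <= T ->
  exists k i, (i <= 2 ^ k)%N /\ u < grid s T k i < v.
Proof.
move=> su uv vT.
have L0 : 0 < T - s by lra.
pose k := (Num.truncn ((T - s) / (v - u))).+1.
have kL : (T - s) / 2 ^+ k < v - u.
  rewrite ltr_pdivrMr ?exprn_gt0// mulrC -ltr_pdivrMr ?subr_gt0//.
  apply: (@lt_le_trans _ _ k%:R); first exact: truncnS_gt.
  by rewrite -natrX ler_nat ltnW// ltn_expl.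
have k0 : 0 < 2 ^+ k :> R by rewrite exprn_gt0.
pose y := (u - s) / (T - s) * 2 ^+ k.
have y0 : 0 <= y by rewrite mulr_ge0 ?divr_ge0 ?(ltW L0) ?(ltW k0)//; lra.
pose i := (Num.truncn y).+1.
have iy : y < i%:R by exact: truncnS_gt.
have yi : i%:R <= y + 1 by rewrite /i -natr1 lerD2r truncn_le.
set q : R := i%:R / 2 ^+ k.
have q1 : (u - s) / (T - s) < q by rewrite /q ltr_pdivlMr.
have q2 : q <= (u - s) / (T - s) + (2 ^+ k)^-1.
  rewrite /q ler_pdivrMr// mulrDl mulVf ?gt_eqF//; exact: yi.
have h1 : u - s < (T - s) * q by rewrite mulrC -ltr_pdivrMr.
have h2 : (T - s) * q <= (u - s) + (T - s) / 2 ^+ k.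
  apply: (le_trans (ler_wpM2l (ltW L0) q2)); rewrite mulrDr [X in X + _]mulrC divfK ?gt_eqF//.
exists k, i; rewrite /grid -/q; split; last by apply/andP; split; lra.
have : q < 1.
  by rewrite -(ltr_pM2l L0) mulr1; lra.
by rewrite /q ltr_pdivrMr// mul1r -natrX ltr_nat => /ltnW.
Qed.

(** A violation at [t] persists on an interval to the right of [t], which contains a grid point. The
    interval [[a, b[] is open on the right so that there is room after [t]. *)
Lemma right_continuous_grid (phi : R -> R) (s T a b lo hi : R) :
  s <= a -> b <= T -> (forall t, a <= t < b -> phi r @[r --> t^'+] --> phi t) ->
  (forall k i, (i <= 2 ^ k)%N -> a <= grid s T k i < b -> lo <= phi (grid s T k i) <= hi) ->
  forall t, a <= t < b -> lo <= phi t <= hi.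
Proof.
move=> sa bT cphi H t /andP[at_ tb].
have key (Q : R -> Prop) : (\forall r \near t^'+, Q r) -> exists k i,
    [/\ (i <= 2 ^ k)%N, a <= grid s T k i < b & Q (grid s T k i)].
  move=> [e /= e0 He].
  have tm : t < Num.min b (t + e) by rewrite lt_min tb ltrDl.
  have mT : Num.min b (t + e) <= T by rewrite ge_min bT.
  have [k [i [ik /andP[g1 g2]]]] := grid_dense (le_trans sa at_) tm mT.
  move: g2; rewrite lt_min => /andP[gb ge].
  exists k, i; split => //; first by rewrite gb (ltW (le_lt_trans at_ g1)).
  apply: He => //=; rewrite ltr0_norm; lra.
have c := cphi t; rewrite at_ tb in c; have {}c := c isT.
apply/andP; split; rewrite leNgt; apply/negP => h.
- have [k [i [ik gi]]] := key (fun r => phi r < lo) ltac:(by move/cvgr_lt : c; apply).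
  by have /andP[h1 _] := H k i ik gi; rewrite ltNge h1.
- have [k [i [ik gi]]] := key (fun r => hi < phi r) ltac:(by move/cvgr_gt : c; apply).
  by have /andP[_ h1] := H k i ik gi; rewrite ltNge h1.
Qed.

Lemma fourth_root_bracket (t : R) : 2 ^+ 4 <= t -> exists n : nat, n.+2%:R ^+ 4 <= t < n.+3%:R ^+ 4.
Proof.
move=> t16; pose p n := n.+2%:R ^+ 4 <= t.
have p0 : exists n, p n by exists 0%N.
have pb n : p n -> (n <= Num.truncn t)%N.
  rewrite /p => h; rewrite -ltnS -(ltr_nat R); apply: (@le_lt_trans _ _ t); last exact: truncnS_gt.
  apply: le_trans h; apply: (@le_trans _ _ n.+2%:R); first by rewrite ler_nat; exact: leqW (leqnSn _).
  by rewrite ler_eXnr// ler1n.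
case: (ex_maxnP p0 pb) => n pn mx; exists n; move: (pn); rewrite /p => ->/=; rewrite ltNge; apply/negP => h.
by have := mx n.+1 h; rewrite ltnn.
Qed.

Lemma invr_sqr_le (a : R) : 0 < a -> ((a + 1) ^+ 2)^-1 <= a^-1 - (a + 1)^-1.
Proof.
move=> a0; have a1 : 0 < a + 1 by rewrite ltr_wpDl// ltW.
rewrite -subr_ge0 (_ : _ - _ = (a * (a + 1) ^+ 2)^-1).
  by rewrite invr_ge0 mulr_ge0 ?exprn_ge0// ltW.
by field; rewrite !gt_eqF.
Qed.

Lemma perturb_itv (lo hi a b c x y : R) : lo <= x -> x <= hi -> `|y - x| <= a ->
  `|c - y| <= b -> lo - a - b <= c <= hi + a + b.
Proof. by move=> ? ?; rewrite !ler_norml => /andP[? ?] /andP[? ?]; lra. Qed.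

End right_continuity.

(** * Almost sure convergence of the discounted mass *)

Section mass_convergence.
Context {R : realType} {d : nat} {disp : measure_display}
  {Omega : measurableType disp}.
Variables (X : R -> Omega -> finmeas R d) (P : finmeas R d -> probability Omega R).
Variables (alpha beta : R).
Hypotheses (alpha0 : 0 < alpha) (beta0 : 0 < beta).
Hypothesis sbm : super_brownian_motion X P alpha beta.
Local Notation V := 'rV[R]_d.
Implicit Types (nu mu : finmeas R d) (f : V -> R).

Lemma right_continuous_state M f w t : ctest M f -> 0 <= t ->
  expR (- (beta * r)) * pairing (X r w) f @[r --> t^'+] --> expR (- (beta * t)) * pairing (X t w) f.
Proof.
move=> cf t0; have [[_ cadl _ _ _] _] := sbm.
have [rc _] := cadl w; have h := rc t t0.
apply: cvgM; last exact: (cvg_comp _ _ h (@continuous_pairing _ _ _ _ cf (X t w))).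
apply: cvg_at_right_filter.
have c0 : (fun r : R => - (beta * r)) @ t --> - (beta * t).
  by apply: cvgN; apply: cvgM; [exact: cvg_cst|exact: cvg_id].
exact: (cvg_comp _ expR c0 (@continuous_expR R _)).
Qed.

Lemma mass_martingale_ge0 t w : 0 <= mass_martingale X beta t w.
Proof. by rewrite mulr_ge0 ?expR_ge0// (pairing_ge0 _ (test_cst ler01)). Qed.

(** A quantitative Cauchy criterion: right continuity extends the grid bounds to all times of [[m, m
    + 1[], and [1 / (m + 1)^2 <= 1 / m - 1 / (m + 1)] telescopes, so the oscillation after time [m]
    is at most [1 / m]. *)
Lemma ae_mass_cvg mu : {ae P mu, forall w,
  mass_martingale X beta t w @[t --> +oo] --> mass_martingale_limit X beta w}.
Proof.
apply: filterS (ae_mass_increments alpha0 beta0 sbm mu) => w [n0 H].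
pose M t := mass_martingale X beta t w.
have Hloc m (t : R) : (n0 <= m)%N -> m%:R <= t < m.+1%:R -> `|M t - M m%:R| <= (m.+1%:R ^+ 2)^-1.
  move=> nm mt; have mle : m%:R <= m.+1%:R :> R by rewrite ler_nat.
  have := @right_continuous_grid R M m%:R m.+1%:R m%:R m.+1%:R
    (M m%:R - (m.+1%:R ^+ 2)^-1) (M m%:R + (m.+1%:R ^+ 2)^-1) (lexx _) (lexx _).
  move=> Hrc; rewrite ler_distl; apply: Hrc => //.
  - move=> r /andP[r0 _]; have r1 : 0 <= r by exact: le_trans r0.
    have := @right_continuous_state 1 (cst 1) w r (@ctest1 R d) r1; exact.
  - by move=> k i ik _; rewrite -ler_distl; exact: H.
have Hstep m : (n0 <= m)%N -> `|M m.+1%:R - M m%:R| <= (m.+1%:R ^+ 2)^-1.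
  by move=> nm; have := H m nm 0%N 1%N (leqnn _); rewrite (gridT _ _ 0).
have Htel m k : (n0 <= m)%N -> (0 < m)%N -> `|M (m + k)%:R - M m%:R| <= m%:R^-1 - (m + k)%:R^-1.
  move=> nm m0; elim: k => [|k IH]; first by rewrite addn0 !subrr normr0.
  have mk0 : 0 < (m + k)%:R :> R by rewrite ltr0n addn_gt0 m0.
  rewrite (_ : M (m + k.+1)%:R - M m%:R = (M (m + k).+1%:R - M (m + k)%:R) + (M (m + k)%:R - M m%:R)); last first.
    by rewrite addnS; ring.
  apply: (le_trans (ler_normD _ _)).
  have h1 := Hstep (m + k)%N (leq_trans nm (leq_addr _ _)).
  apply: (le_trans (lerD h1 IH)); rewrite addnS.
  have -> : (m + k).+1%:R = (m + k)%:R + 1 :> R by rewrite natr1.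
  set a := (m + k)%:R in mk0 *.
  have := invr_sqr_le mk0.
  set p := (_ ^+ 2)^-1; set q := (a + 1)^-1; lra.
have Hfar m (t : R) : (n0 <= m)%N -> (0 < m)%N -> m%:R <= t -> `|M t - M m%:R| <= m%:R^-1.
  move=> nm m0 mt; have t0 : 0 <= t by exact: le_trans mt.
  pose n := Num.truncn t; have /andP[nt tn] := truncn_itv t0.
  have mn : (m <= n)%N by rewrite -ltnS -(ltr_nat R); exact: le_lt_trans tn.
  have h1 := Hloc n t (leq_trans nm mn) (_ : n%:R <= t < n.+1%:R).
  have {}h1 : `|M t - M n%:R| <= (n.+1%:R ^+ 2)^-1 by apply: h1; rewrite nt tn.
  have := Htel m (n - m)%N nm m0; rewrite subnKC// => h2.
  rewrite (_ : M t - M m%:R = (M t - M n%:R) + (M n%:R - M m%:R)); last by ring.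
  apply: (le_trans (ler_normD _ _)); apply: (le_trans (lerD h1 h2)).
  have n0' : 0 < n%:R :> R by rewrite ltr0n (leq_trans m0).
  have : (n.+1%:R ^+ 2)^-1 <= n%:R^-1 :> R.
    rewrite lef_pV2 ?posrE ?exprn_gt0//; apply: (@le_trans _ _ n.+1%:R); first by rewrite ler_nat.
    by rewrite expr2 ler_peMr// ler1n.
  by move=> h; rewrite addrCA gerDl subr_le0.
(* [mass_martingale_limit] is a [lim], so existence of a limit is convergence to it. *)
suff : cvg (M t @[t --> +oo]) by [].
apply: cauchy_cvg; apply: cauchy_exP => e e0.
have [m [nm m0 me]] : exists m : nat, [/\ (n0 <= m)%N, (0 < m)%N & m%:R^-1 < e].
  pose m := maxn n0 (Num.truncn e^-1).+1; exists m; split; rewrite ?leq_max ?leqnn ?ltnSn ?orbT//.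
  rewrite -[ltRHS]invrK ltf_pV2 ?posrE ?invr_gt0//; last by rewrite ltr0n leq_max orbT.
  apply: (@lt_le_trans _ _ (Num.truncn e^-1).+1%:R); first exact: truncnS_gt.
  by rewrite ler_nat leq_maxr.
exists (M m%:R); exists m%:R; split; first exact: num_real.
move=> t mt /=; rewrite /ball /= distrC; apply: le_lt_trans me.
by apply: Hfar => //; exact: ltW.
Qed.

End mass_convergence.

(** * The local limit *)

Section local_limit.
Context {R : realType} {d : nat} {disp : measure_display}
  {Omega : measurableType disp}.
Variables (X : R -> Omega -> finmeas R d) (P : finmeas R d -> probability Omega R).
Variables (alpha beta : R).
Hypotheses (alpha0 : 0 < alpha) (beta0 : 0 < beta).
Hypothesis sbm : super_brownian_motion X P alpha beta.
Local Notation V := 'rV[R]_d.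
Local Notation L := (lebesgue_vec d).
Local Notation half := (d%:R / 2 : R).
Local Notation c := ((2 * pi : R) `^ (- half)).
Variables (M C K : R) (f : V -> R) (x : V).
Hypotheses (cf : ctest M f) (fC : forall y, f y <= C * gauss 1 0 y)
  (K0 : 0 <= K) (fK : forall y, f y != 0 -> \sum_i (y 0 i - x 0 i) ^+ 2 <= K)
  (uc : forall e, 0 < e -> exists2 D, 0 <= D & forall y z, `|f z - f y| <= e + D * (1 - gauss 1 y z)).
Local Notation I := (\int[L]_y f y).
Local Notation Ig := ((2 * pi * 4 : R) `^ half).
Local Notation kappa := ((4 / 5 : R) `^ half).
Variable w : Omega.
Local Notation mass t := (mass_martingale X beta t w).
Local Notation val h t := (expR (- (beta * t)) * pairing (X t w) h).

Let half0 : 0 <= half. Proof. by rewrite divr_ge0. Qed.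

Let c0 : 0 <= c. Proof. exact: powR_ge0. Qed.

Let tf : test M f. Proof. exact: ctest_test. Qed.

Let I0 : 0 <= I.
Proof. by apply: Rintegral_ge0 => y _; exact: test_ge0 tf. Qed.

Let scale (T th : R) : 0 < th -> 0 <= T ->
  T `^ half * (2 * pi * th) `^ (- half) = c * (T / th) `^ half.
Proof.
move=> th0 T0; have p0 := @pi_gt0 R.
rewrite !powRN (@powRM _ (2 * pi) th); [|by rewrite mulr_ge0// ltW|exact: ltW].
rewrite (@powRM _ T th^-1)//; last by rewrite invr_ge0 ltW.
have -> : th^-1 `^ half = (th `^ half)^-1 by rewrite -powR_inv1 ?(ltW th0)// powRAC powR_inv1// powR_ge0.
by rewrite invfM; ring.
Qed.

(* [m] indexes the block [m^4, (m+1)^4[ and [T] is the right end of one of its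
   subblocks. *)
Section block.
Variables (m T : R).
Hypotheses (m2 : 2 <= m) (mT : m ^+ 4 <= T).
Local Notation u := (m^-1).
Local Notation A := ((m ^+ 4 - m) / 2).

Let m0 : 0 < m. Proof. exact: lt_le_trans m2. Qed.

Let m4 : 8 * m <= m ^+ 4.
Proof.
rewrite exprSr ler_pM2r// (_ : 8 = 2 ^+ 3); last by ring.
by apply: lerXn2r; rewrite ?nnegrE// ltW.
Qed.

Let th0 : 0 < T - m.
Proof.
rewrite subr_gt0; apply: lt_le_trans mT; apply: lt_le_trans m4.
by rewrite ltr_pMl// ltr1n.
Qed.

Let T0 : 0 < T. Proof. by move: th0; rewrite subr_gt0; apply: lt_trans. Qed.

Let ratio_ge1 : 1 <= (T / (T - m)) `^ half.
Proof.
have th0' := th0; have m0' := m0.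
have h : 1 `^ half <= (T / (T - m)) `^ half.
  apply: le_powRl => //; rewrite ler01/= ler_pdivlMr// mul1r; lra.
by rewrite powR1 in h.
Qed.

(** [T / (T - m) <= 1 + 2 / m] amounts to [m^2 + 2 m <= 2 T], clear from [m^4 <= T]. The bound no
    longer mentions [T] and tends to 1. *)
Let ratio_le : (T / (T - m)) `^ half <= (1 + 2 * u) ^+ d.
Proof.
have u0 : 0 < u by rewrite invr_gt0.
have th0' := th0; have m0' := m0; have T0' := T0.
have r1 : T / (T - m) <= 1 + 2 * u.
  rewrite ler_pdivrMr// -subr_ge0.
  rewrite (_ : _ - _ = (2 * T - m ^+ 2 - 2 * m) * u); last by field; rewrite gt_eqF.
  have m24 : m ^+ 2 <= m ^+ 4 by rewrite ler_weXn2l//; move: m2; lra.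
  by apply: mulr_ge0; [move: m4 m0 mT m24; lra|exact: ltW].
have h1 : 1 <= T / (T - m) by rewrite ler_pdivlMr// mul1r; lra.
apply: (@le_trans _ _ ((1 + 2 * u) `^ half)).
  by apply: le_powRl => //; rewrite r1 divr_ge0// ltW.
have u1 : 1 <= 1 + 2 * u by rewrite lerDl mulr_ge0// ltW.
rewrite -powR_mulrn; last exact: le_trans u1.
by apply: ler_powR => //; rewrite ler_pdivrMr// ler_peMr// ler1n.
Qed.

Let mass0 : 0 <= mass m. Proof. exact: mass_martingale_ge0. Qed.

Let massE k : val (cst k) m = k * mass m.
Proof. by rewrite pairing_cst mulrCA. Qed.

(** A uniform bound on [heat (T - m) h] reduces the pairing to the total mass. It serves for [f] and
    for the Gaussian, [J] being the integral of the function. *)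
Lemma scaled_upper N h (J : R) : test N h -> 0 <= J ->
  (forall y, heat (T - m) h y <= (2 * pi * (T - m)) `^ (- half) * J) ->
  T `^ half * disc X beta h T m w <= c * (1 + 2 * u) ^+ d * J * mass m.
Proof.
move=> th J0 hJ; have T0' := T0; have th0' := th0.
set k := (2 * pi * (T - m)) `^ (- half) * J.
have k0 : 0 <= k by rewrite mulr_ge0 ?powR_ge0.
have hk : disc X beta h T m w <= k * mass m.
  rewrite -massE ler_wpM2l ?expR_ge0//.
  exact: (le_pairing _ (test_heat (ltW th0) th) (test_cst k0)).
apply: (le_trans (ler_wpM2l (powR_ge0 _ _) hk)).
by rewrite mulrA ler_wpM2r// /k mulrA (scale th0 (ltW T0)) ler_wpM2r// ler_wpM2l//; exact: ratio_le.
Qed.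

(** In [heat_ge_integral] with [r = T - m], the Gaussian factor is at least [gauss A x], because
    [A <= (T - m) / 2], and the exponential is at least [e^(-K/m)], because [m <= T - m]. The spread
    hypothesis then recovers all the mass but [1 / m]. *)
Lemma scaled_lower : mass m - val (gauss A x) m <= u ->
  c * expR (- (K * u)) * I * (mass m - u) <= T `^ half * disc X beta f T m w.
Proof.
move=> spread; have m0' := m0; have m4' := m4.
have th0' := th0; have A0 : 0 < A by apply: divr_gt0 => //; lra.
set k := (2 * pi * (T - m)) `^ (- half) * expR (- (K * u)) * I.
have k0 : 0 <= k by rewrite mulr_ge0// mulr_ge0 ?powR_ge0 ?expR_ge0.
have tg := test_gauss x A0.
have hk : k * val (gauss A x) m <= disc X beta f T m w.
  rewrite mulrCA -(pairingZ _ _ tg) ler_wpM2l ?expR_ge0//.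
  apply: (le_pairing _ (testZ k0 tg) (test_heat (ltW th0) tf)) => y.
  apply: le_trans (heat_ge_integral tf fC y th0 fK).
  rewrite (_ : k * _ = (2 * pi * (T - m)) `^ (- half) * (gauss A x y * expR (- (K * u))) * I); last by rewrite /k; ring.
  apply: ler_wpM2r => //; apply: ler_wpM2l; first exact: powR_ge0.
  apply: ler_pM; [exact: gauss_ge0|exact: expR_ge0|apply: le_gauss => //|].
    by rewrite ler_wpM2r// lerB.
  rewrite ler_expR lerN2; apply: ler_wpM2l => //.
  by rewrite lef_pV2 ?posrE//; move: m4 m0 mT; lra.
apply: le_trans (ler_wpM2l (powR_ge0 _ _) hk).
rewrite [leRHS](_ : _ = (T `^ half * (2 * pi * (T - m)) `^ (- half)) * (expR (- (K * u)) * I * val (gauss A x) m)); last by rewrite /k; ring.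
rewrite (scale th0 (ltW T0)).
have g0 : 0 <= val (gauss A x) m by rewrite mulr_ge0 ?expR_ge0// (pairing_ge0 _ tg).
have e0 : 0 <= expR (- (K * u)) * I by rewrite mulr_ge0 ?expR_ge0.
rewrite -4!mulrA ler_wpM2l// mulrA.
apply: (@le_trans _ _ (expR (- (K * u)) * I * val (gauss A x) m)).
  by rewrite ler_wpM2l//; lra.
by rewrite -mulrA ler_peMl// mulrA mulr_ge0.
Qed.

End block.

Section blocks.
Variables (n : nat) (e eta : R).
Local Notation m := (n.+2%:R : R).
Local Notation u := (m^-1).
Local Notation g := (gauss 4 0).
Hypotheses (e0 : 0 <= e) (eta1 : eta <= 1) (ueta : u <= eta)
  (Heta : forall r y, 0 <= r <= eta -> `|heat r f y - f y| <= e * g y)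
  (spread : mass m - val (gauss ((m ^+ 4 - m) / 2) x) m <= u).
Let small h := forall j, (j < n.+3 ^ 5)%N -> forall k i, (i <= 2 ^ k)%N ->
  block_end n.+2 j `^ half *
  `|disc X beta h (block_end n.+2 j) (grid m (block_end n.+2 j) k i) w -
    disc X beta h (block_end n.+2 j) m w| <= u.
Hypotheses (Hf : small f) (Hg : small g).

(** [G] is to bound [T^(d/2) e^(-beta t) <X_t, g>]: the upper bound at time [m], plus the
    fluctuation [u], divided by the loss [kappa] between [g] and [P_r g]. In [Up] and [Lo], [u] is
    the fluctuation for [f], and [e * G] the cost of replacing [P_r f] by [f]. *)
Local Notation G := (kappa^-1 * (c * (1 + 2 * u) ^+ d * Ig * mass m + u)).
Local Notation Up := (c * (1 + 2 * u) ^+ d * I * mass m + u + e * G).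
Local Notation Lo := (c * expR (- (K * u)) * I * (mass m - u) - u - e * G).

Let tg : test 1 (g : V -> R). Proof. exact: test_gauss. Qed.

Let kappa0 : 0 < kappa. Proof. by apply: powR_gt0; rewrite divr_gt0. Qed.

Let m2 : 2 <= m. Proof. by rewrite ler_nat. Qed.

Let u0 : 0 < u. Proof. by rewrite invr_gt0 ltr0n. Qed.

(* Over the last [1/m] units of time, [g] controls the error of replacing [f] by
   [P_r f], and [g] itself is controlled by [P_r g]. *)
Lemma gap_gauss t r : 0 <= r <= u -> kappa * val g t <= disc X beta g (t + r) t w.
Proof.
move=> /andP[r0 ru].
rewrite mulrCA -(pairingZ _ _ tg) /disc (_ : t + r - t = r); last by ring.
apply: ler_wpM2l; first exact: expR_ge0.
apply: (le_pairing _ (testZ (ltW kappa0) tg) (test_heat r0 tg)) => y.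
by apply: heat_gauss4_ge; rewrite r0/= (le_trans ru)// (le_trans ueta).
Qed.

Lemma gap_le t r : 0 <= r <= u -> `|val f t - disc X beta f (t + r) t w| <= e * val g t.
Proof.
move=> /andP[r0 ru]; have re : 0 <= r <= eta by rewrite r0 (le_trans ru).
rewrite /disc (_ : t + r - t = r); last by ring.
rewrite -mulrBr normrM ger0_norm ?expR_ge0// mulrCA ler_wpM2l ?expR_ge0//.
have th := test_heat r0 tf; have teg := testZ e0 tg.
have h1 : pairing (X t w) f <= pairing (X t w) (heat r f) + e * pairing (X t w) g.
  rewrite -(pairingZ _ _ tg) -(pairingD _ th teg).
  apply: (le_pairing _ tf (testD th teg)) => y /=.
  by have := Heta y re; rewrite ler_norml; lra.
have h2 : pairing (X t w) (heat r f) <= pairing (X t w) f + e * pairing (X t w) g.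
  rewrite -(pairingZ _ _ tg) -(pairingD _ tf teg).
  apply: (le_pairing _ th (testD tf teg)) => y /=.
  by have := Heta y re; rewrite ler_norml; lra.
by rewrite ler_norml; apply/andP; split; lra.
Qed.

(** At a grid point, [f] is compared with [P_(T-t) f] at time [t], then with the martingale value at
    time [m], where the scaled bounds apply. The grid spans all of [[m, T]], although only its
    points in the last [1 / m] are used. *)
Lemma subblock_le j t : (j < n.+3 ^ 5)%N ->
  block_end n.+2 j - u <= t < block_end n.+2 j ->
  Lo <= block_end n.+2 j `^ half * val f t <= Up.
Proof.
move=> jn; set T := block_end n.+2 j.
have T4 : m ^+ 4 <= T - u.
  by rewrite /T /block_end -[j.+1%:R]natr1 mulrDl mul1r addrA addrK lerDl divr_ge0.
have mT : m ^+ 4 <= T by apply: (le_trans T4); rewrite gerBl ltW.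
have m4 : m <= m ^+ 4 by rewrite ler_eXnr// ler1n.
have p0 : 0 <= T `^ half := powR_ge0 _ _.
move: t; apply: (@right_continuous_grid R (fun t => T `^ half * val f t) m T) => //.
- exact: le_trans T4.
- move=> t /andP[t0 _]; apply: cvgM; first exact: cvg_cst.
  have t1 : 0 <= t.
    by apply: le_trans t0; apply: le_trans T4; exact: exprn_ge0.
  have rc := @right_continuous_state R d disp Omega X P alpha beta sbm M f w t cf t1; exact: rc.
move=> k i ik; set t := grid m T k i => /andP[t1 t2].
have r0 : 0 <= T - t <= u by rewrite subr_ge0 (ltW t2) lerBlDr addrC -lerBlDr.
have tT : t + (T - t) = T by ring.
have := gap_gauss t r0; have := gap_le t r0; rewrite !tT => gf gg.
have hf := Hf jn ik; have hg := Hg jn ik; rewrite -/T -/t in hf hg.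
have mT0 : 0 < T - m.
  by rewrite subr_gt0; apply: lt_le_trans mT; rewrite ltr_eXnr// ltr1n.
have upf := scaled_upper m2 mT tf I0 (fun y => heat_le_integral tf fC y mT0).
have upg := scaled_upper m2 mT tg (powR_ge0 _ _) (fun y => heat_gauss4_le y mT0).
have lof := scaled_lower m2 mT spread.
move: gf gg hf hg upf upg lof.
set dft := disc _ _ _ _ t w; set dgt := disc _ _ _ _ t w.
set dfm := disc _ _ _ _ m w; set dgm := disc _ _ _ _ m w.
set vf := val f t; set vg := val g t; set p := T `^ half in p0 *.
move=> gf gg hf hg upf upg lof.
have hf' : `|p * dft - p * dfm| <= u.
  by rewrite -mulrBr normrM (ger0_norm p0); exact: hf.
have hg' : `|p * dgt - p * dgm| <= u.
  by rewrite -mulrBr normrM (ger0_norm p0); exact: hg.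
have gf' : `|p * vf - p * dft| <= e * (p * vg).
  by rewrite -mulrBr normrM (ger0_norm p0) mulrCA; exact: ler_wpM2l.
have vgG : e * (p * vg) <= e * G.
  apply: ler_wpM2l => //; rewrite ler_pdivlMl// mulrCA.
  apply: (le_trans (ler_wpM2l p0 gg)).
  move: hg'; rewrite ler_norml => /andP[_]; rewrite lerBlDr => /le_trans; apply.
  by rewrite addrC; exact: lerD.
exact: (perturb_itv lof upf hf' (le_trans gf' vgG)).
Qed.

(** Exchanges [T^(d/2)] for [t^(d/2)]. This is free for the upper bound; for the lower bound,
    [T <= t + u <= (1 + u) t] because [t >= 1], which costs [(1 + u)^d]. *)
Lemma block_le t : m ^+ 4 <= t < n.+3%:R ^+ 4 ->
  ((1 + u) ^+ d)^-1 * Lo <= t `^ half * val f t <= Up.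
Proof.
move=> /andP[t1 t2].
have m40 : 1 <= m ^+ 4 by apply: exprn_ege1; rewrite ler1n.
have t0 : 0 < t by move: m40 t1; lra.
have v0 : 0 <= val f t by apply: mulr_ge0; [exact: expR_ge0|exact: pairing_ge0 tf].
have mm0 : 0 < m by rewrite ltr0n.
have s0 : 0 <= (t - m ^+ 4) * m by rewrite mulr_ge0 ?subr_ge0// ltW.
pose j := Num.truncn ((t - m ^+ 4) * m).
have /andP[j1 j2] := truncn_itv s0; rewrite -/j in j1 j2.
have jn : (j < n.+3 ^ 5)%N.
  rewrite -(ltr_nat R) natrX; apply: (le_lt_trans j1).
  rewrite [ltRHS]exprSr; apply: (@lt_le_trans _ _ (n.+3%:R ^+ 4 * m)).
    by rewrite ltr_pM2r//; move: m40 t2; lra.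
  by rewrite ler_wpM2l ?exprn_ge0// ler_nat.
have Tu : block_end n.+2 j - u <= t < block_end n.+2 j.
  rewrite /block_end; apply/andP; split.
    rewrite -[j.+1%:R]natr1 mulrDl mul1r addrA addrK -lerBrDl ler_pdivrMr//.
  by rewrite -ltrBlDl ltr_pdivlMr.
have /andP[lo hi] := subblock_le jn Tu.
move: Tu lo hi; set T := block_end _ _ => /andP[T1 T2] lo hi.
have tT : t `^ half <= T `^ half by apply: le_powRl => //; rewrite !ltW.
apply/andP; split; last by apply: le_trans hi; exact: ler_wpM2r.
have u1 : 1 <= 1 + u by rewrite lerDl ltW.
rewrite ler_pdivrMl; last by apply: exprn_gt0; apply: lt_le_trans u1.
apply: (le_trans lo); rewrite [leRHS]mulrA ler_wpM2r//.
have Tt : T <= (1 + u) * t.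
  have : u <= u * t by rewrite ler_peMr ?(ltW u0)//; move: m40 t1; lra.
  by move=> ut; move: T1; rewrite lerBlDr mulrDl mul1r => /le_trans; apply; rewrite lerD2l.
apply: (@le_trans _ _ (((1 + u) * t) `^ half)).
  by apply: le_powRl => //; rewrite Tt (le_trans (ltW t0))// ltW.
have u10 := le_trans ler01 u1; rewrite powRM ?(ltW t0)//.
apply: ler_wpM2r; first exact: powR_ge0.
rewrite -powR_mulrn; last exact: le_trans u1.
by apply: ler_powR => //; rewrite ler_pdivrMr// ler_peMr// ler1n.
Qed.

End blocks.

(** Deterministic, along one path [w]. For fixed [e] the bounds of [block_le] tend to [l + e B] and
    [l - e B], with [B] the limit of [G]; then [e] is small. *)
Lemma local_limit W : mass t @[t --> +oo] --> W ->
  (exists n0, forall n, (n0 <= n)%N -> mass n.+2%:R -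
    val (gauss ((n.+2%:R ^+ 4 - n.+2%:R) / 2) x) n.+2%:R <= n.+2%:R^-1) ->
  (forall h, h = f \/ h = gauss 4 0 -> exists n0, forall n, (n0 <= n)%N ->
    forall j, (j < n.+3 ^ 5)%N -> forall k i, (i <= 2 ^ k)%N ->
    block_end n.+2 j `^ half *
    `|disc X beta h (block_end n.+2 j) (grid n.+2%:R (block_end n.+2 j) k i) w -
      disc X beta h (block_end n.+2 j) n.+2%:R w| <= n.+2%:R^-1) ->
  t `^ half * val f t @[t --> +oo] --> c * I * W.
Proof.
move=> massW [n1 H1] Hdisc.
have [n2 H2] := Hdisc _ (or_introl erefl).
have [n3 H3] := Hdisc _ (or_intror erefl).
pose u n : R := n.+2%:R^-1.
have ucvg : u n @[n --> \oo] --> (0 : R).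
  by have := @cvg_harmonic R; rewrite -(cvg_shiftS (@harmonic R)).
have Mcvg : mass n.+2%:R @[n --> \oo] --> W.
  have h : (fun n => n.+2%:R : R) @ \oo --> +oo.
    have := @cvgr_idn R; rewrite -(cvg_shiftS (fun n => n%:R : R)).
    by rewrite -(cvg_shiftS (fun n => n.+1%:R : R)).
  exact: (cvg_comp _ _ h massW).
have pcvg k : (1 + k * u n) ^+ d @[n --> \oo] --> (1 : R).
  have h : (fun n => 1 + k * u n) @ \oo --> (1 + k * 0 : R).
    by apply: cvgD; [exact: cvg_cst|apply: cvgM; [exact: cvg_cst|exact: ucvg]].
  rewrite mulr0 addr0 in h.
  have := cvg_comp _ (fun y : R => y ^+ d) h (@exprn_continuous R d 1).
  by rewrite expr1n.
have ecvg : expR (- (K * u n)) @[n --> \oo] --> (1 : R).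
  have h : (fun n => - (K * u n)) @ \oo --> (- (K * 0) : R).
    by apply: cvgN; apply: cvgM; [exact: cvg_cst|exact: ucvg].
  rewrite mulr0 oppr0 in h.
  have := cvg_comp _ expR h (@continuous_expR R 0).
  by rewrite expR0.
pose G n := kappa^-1 * (c * (1 + 2 * u n) ^+ d * Ig * mass n.+2%:R + u n).
pose U n := c * (1 + 2 * u n) ^+ d * I * mass n.+2%:R + u n.
pose Lw n := c * expR (- (K * u n)) * I * (mass n.+2%:R - u n) - u n.
have Gcvg : G n @[n --> \oo] --> kappa^-1 * (c * 1 * Ig * W + 0).
  apply: cvgM; first exact: cvg_cst.
  apply: cvgD => //; apply: cvgM => //; apply: cvgM; last exact: cvg_cst.
  by apply: cvgM; [exact: cvg_cst|exact: pcvg].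
have Ucvg : U n @[n --> \oo] --> c * 1 * I * W + 0.
  apply: cvgD => //; apply: cvgM => //; apply: cvgM; last exact: cvg_cst.
  by apply: cvgM; [exact: cvg_cst|exact: pcvg].
have Lcvg : Lw n @[n --> \oo] --> c * 1 * I * (W - 0) - 0.
  apply: cvgB => //; apply: cvgM; last exact: cvgB.
  apply: cvgM; last exact: cvg_cst.
  by apply: cvgM; [exact: cvg_cst|exact: ecvg].
set B := kappa^-1 * _ in Gcvg.
rewrite !mulr1 addr0 in Ucvg; rewrite !mulr1 !subr0 in Lcvg.
set l := c * I * W in Ucvg Lcvg *.
apply/cvgrPdist_lt => dl dl0.
(* Keeps [e |B|] below [dl], also when [B = 0]. *)
pose e := dl / (2 * (`|B| + 1)).
have B0 : 0 < `|B| + 1 by rewrite ltr_wpDl.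
have e0 : 0 < e by rewrite divr_gt0// mulr_gt0.
have eB : `|e * B| < dl.
  rewrite normrM gtr0_norm// /e mulrAC ltr_pdivrMr ?mulr_gt0//.
  by rewrite ltr_pM2l//; have := normr_ge0 B; lra.
have [eta /andP[eta0 eta1] Heta] := heat_sub_le_gauss4 tf fC uc e0.
have hi : \forall n \near \oo, U n + e * G n < l + dl.
  have h : U n + e * G n @[n --> \oo] --> l + e * B.
    by apply: cvgD => //; apply: cvgM => //; exact: cvg_cst.
  by move/cvgr_lt : h; apply; rewrite ltrD2l (le_lt_trans (ler_norm _)).
have lo : \forall n \near \oo, l - dl < ((1 + u n) ^+ d)^-1 * (Lw n - e * G n).
  have h : ((1 + u n) ^+ d)^-1 * (Lw n - e * G n) @[n --> \oo] --> 1^-1 * (l - e * B).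
    apply: cvgM; last by apply: cvgB => //; apply: cvgM => //; exact: cvg_cst.
    apply: cvgV => //; rewrite (_ : (fun _ => _) = (fun n => (1 + 1 * u n) ^+ d)); first exact: pcvg.
    by apply/funext => n; rewrite mul1r.
  move/cvgr_gt : h; apply; rewrite invr1 mul1r ltrD2l ltrN2.
  exact: le_lt_trans (ler_norm _) _.
have ue : \forall n \near \oo, u n <= eta by move/cvgr_le : ucvg; apply.
have [n4 _ H4] : \forall n \near \oo, [/\ U n + e * G n < l + dl,
    l - dl < ((1 + u n) ^+ d)^-1 * (Lw n - e * G n), u n <= eta & (maxn n1 (maxn n2 n3) <= n)%N].
  near=> n; split; [by near: n|by near: n|by near: n|].
  by near: n; exact: nbhs_infty_ge.
have H n t : (n4 <= n)%N -> n.+2%:R ^+ 4 <= t < n.+3%:R ^+ 4 ->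
    `|l - t `^ half * val f t| < dl.
  move=> nn tn; have [h1 h2 h3] := H4 n nn; rewrite !geq_max => /and3P[l1 l2 l3].
  have /andP[] := block_le (ltW e0) eta1 h3 Heta (H1 n l1) (H2 n l2) (H3 n l3) tn.
  move=> a1 a2; have b1 := lt_le_trans h2 a1; have b2 := le_lt_trans a2 h1.
  rewrite distrC ltr_norml; apply/andP; split.
    by rewrite ltrBrDl.
  by rewrite ltrBlDl.
near=> t.
have t4 : n4.+2%:R ^+ 4 <= t by near: t; exact: nbhs_pinfty_ge (num_real _).
have m4 n : 2 ^+ 4 <= n.+2%:R ^+ 4 :> R by rewrite lerXn2r ?nnegrE// ler_nat.
have [n nt] := fourth_root_bracket (le_trans (m4 n4) t4).
(* [n4 <= n] follows from [(n4 + 2)^4 <= t < (n + 3)^4]. *)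
apply: (H n) => //; rewrite -3!ltnS -(ltr_nat R) -(@ltr_pXn2r _ 4) ?nnegrE//.
by move: nt => /andP[_]; exact: le_lt_trans.
Unshelve. all: by end_near. Qed.
End local_limit.

(** * Non-negative functions, then the general case *)

Section nonneg_limit.
Context {R : realType} {d : nat} {disp : measure_display}
  {Omega : measurableType disp}.
Variables (X : R -> Omega -> finmeas R d) (P : finmeas R d -> probability Omega R).
Variables (alpha beta : R).
Hypotheses (alpha0 : 0 < alpha) (beta0 : 0 < beta).
Hypothesis sbm : super_brownian_motion X P alpha beta.
Local Notation V := 'rV[R]_d.

Lemma compact_support_ctest (f : V -> R) : continuous f ->
  compact (closure [set y | f y != 0]) -> (forall y, 0 <= f y) -> exists M, ctest M f.
Proof.
move=> cf sf f0; have [M M0 HM] := compact_support_bounded cf sf.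
by exists M; split => // y; rewrite f0 (le_trans (ler_norm _)).
Qed.

(** Four almost sure events are intersected: convergence of the mass, its spread, and the
    fluctuation bound for [f] and for [gauss 4 0]. *)
Lemma ae_nonneg_limit (x : V) (f : V -> R) : continuous f ->
  compact (closure [set y | f y != 0]) -> (forall y, 0 <= f y) ->
  {ae P (\d_x : finmeas R d), forall w,
    t `^ (d%:R / 2) * (expR (- (beta * t)) * pairing (X t w) f) @[t --> +oo] -->
    (2 * pi) `^ (- (d%:R / 2)) * (\int[lebesgue_vec d]_y f y) *
      mass_martingale_limit X beta w}.
Proof.
move=> cf sf f0; have [M cM] := compact_support_ctest cf sf f0.
have [C C0 fC] := compact_support_dominated cf sf.
have [K K0 fK] := compact_support_radius sf x.
have uc e (e0 : 0 < e) := compact_support_modulus cf sf f0 e0.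
have h1 := ae_mass_cvg alpha0 beta0 sbm (\d_x : finmeas R d).
have h2 := ae_spread alpha0 beta0 sbm x.
have h3 := ae_fluctuation alpha0 beta0 sbm (\d_x : finmeas R d) cM.
have c4 : ctest 1 (gauss 4 0 : V -> R) by exact: ctest_gauss.
have h4 := ae_fluctuation alpha0 beta0 sbm (\d_x : finmeas R d) c4.
apply: filterS (filterI (filterI h1 h2) (filterI h3 h4)) => w [[a1 a2] [a3 a4]].
have Hd h : h = f \/ h = gauss 4 0 -> exists n0, forall n, (n0 <= n)%N ->
    forall j, (j < n.+3 ^ 5)%N -> forall k i, (i <= 2 ^ k)%N ->
    block_end n.+2 j `^ (d%:R / 2) *
    `|disc X beta h (block_end n.+2 j) (grid n.+2%:R (block_end n.+2 j) k i) w -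
      disc X beta h (block_end n.+2 j) n.+2%:R w| <= n.+2%:R^-1.
  by case=> ->.
exact: (local_limit sbm cM fC K0 fK uc a1 a2 Hd).
Qed.

End nonneg_limit.

Lemma compact_support_max {R : realType} {d : nat} (f : 'rV[R]_d -> R) : continuous f ->
  compact (closure [set y | f y != 0]) ->
  continuous (fun y => Num.max (f y) 0) /\
  compact (closure [set y | Num.max (f y) 0 != 0]).
Proof.
move=> cf sf; split; first by move=> y; apply: continuous_max; [exact: cf|exact: cst_continuous].
apply: subclosed_compact sf _; first exact: closed_closure.
apply: closure_subset => y /=; apply: contra_neq => ->; exact: maxxx.
Qed.

(** By linearity from the positive and negative parts of [f]. The first conjunct certifies that
    [mass_martingale_limit], defined by [lim], is almost surely a genuine limit and so is [W(0)]. *)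
Theorem theorem3p2 (R : realType) (d : nat) (alpha beta : R)
    (disp : measure_display) (Omega : measurableType disp)
    (X : R -> Omega -> finmeas R d) (P : finmeas R d -> probability Omega R) :
  (1 <= d)%N -> 0 < alpha -> 0 < beta ->
  super_brownian_motion X P alpha beta ->
  forall x : 'rV[R]_d,
    {ae P (\d_x : finmeas R d), forall w,
      mass_martingale X beta t w @[t --> +oo] --> mass_martingale_limit X beta w} /\
    forall f : 'rV[R]_d -> R, continuous f -> compact (closure [set y | f y != 0]) ->
      {ae P (\d_x : finmeas R d), forall w,
        pairing (X t w) f / (expR (beta * t) * t `^ (- (d%:R / 2))) @[t --> +oo] -->
        (2 * pi) `^ (- (d%:R / 2)) * (\int[lebesgue_vec d]_y f y)%R *
          mass_martingale_limit X beta w}.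
Proof.
move=> _ alpha0 beta0 sbm x; split; first exact: ae_mass_cvg alpha0 beta0 sbm _.
move=> f cf sf.
have cN : continuous (fun y => - f y) by move=> y; apply: continuousN; exact: cf.
have sN : compact (closure [set y | - f y != 0]).
  by rewrite (_ : [set y | _] = [set y | f y != 0])//; apply/seteqP; split => y /=; rewrite oppr_eq0.
pose fp y := Num.max (f y) 0; pose fn y := Num.max (- f y) 0.
have [cp sp] := compact_support_max cf sf; have [cn sn] := compact_support_max cN sN.
have fp0 y : 0 <= fp y by rewrite le_max lexx orbT.
have fn0 y : 0 <= fn y by rewrite le_max lexx orbT.
have fE y : f y = fp y - fn y by rewrite /fp /fn; case: (lerP (f y) 0); case: (lerP (- f y) 0); lra.
have [Mp tp] := compact_support_ctest cp sp fp0.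
have [Mn tn] := compact_support_ctest cn sn fn0.
have [Cp _ dp] := compact_support_dominated cp sp.
have [Cn _ dn] := compact_support_dominated cn sn.
have pE nu : pairing nu f = pairing nu fp - pairing nu fn.
  rewrite /pairing -RintegralB//; last 2 first.
  - exact: (test_integrable nu (ctest_test tp)).
  - exact: (test_integrable nu (ctest_test tn)).
  by apply: eq_Rintegral => y _; exact: fE.
have IE : (\int[lebesgue_vec d]_y f y)%R =
    (\int[lebesgue_vec d]_y fp y)%R - (\int[lebesgue_vec d]_y fn y)%R.
  rewrite -RintegralB//; last 2 first.
  - exact: (dominated_integrable (ctest_test tp) dp).
  - exact: (dominated_integrable (ctest_test tn) dn).
  by apply: eq_Rintegral => y _; exact: fE.
have hp := ae_nonneg_limit alpha0 beta0 sbm x cp sp fp0.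
have hn := ae_nonneg_limit alpha0 beta0 sbm x cn sn fn0.
apply: filterS2 hp hn => w hp hn.
rewrite IE mulrBr mulrBl.
rewrite (_ : (fun _ => _) = (fun t => t `^ (d%:R / 2) * (expR (- (beta * t)) * pairing (X t w) fp) -
  t `^ (d%:R / 2) * (expR (- (beta * t)) * pairing (X t w) fn))); first exact: cvgB.
by apply/funext => t; rewrite pE powRN expRN invfM invrK; ring.
Qed.
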